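(* Let $M\ge2$, $N\ge1$, let $\omega_1,\dots,\omega_N$ be germs at $0\in\mathbb{C}^M$ of holomorphic $1$-forms in the variables $x=(x_1,\dots,x_M)$, and let $\mathcal{D}$ be the distribution on $(\mathbb{C}^{M+N},0)$, with coordinates $(x_1,\dots,x_M,z_1,\dots,z_N)$, defined by the system $dz_1=\omega_1,\dots,dz_N=\omega_N$. Then there exists a germ of holomorphic vector field on $(\mathbb{C}^{M+N},0)$, tangent to $\mathcal{D}$, which has the same field of meromorphic first integrals as $\mathcal{D}$.
   Context: A meromorphic first integral of $\mathcal{D}$ (resp. of a vector field $Z$) is a germ $F$ of meromorphic function in $(\mathbb{C}^{M+N},0)$ whose differential vanishes on $\mathcal{D}$ (resp. with $dF(Z)=0$). *)

(* Defs.v *)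
From HB Require Import structures.
From mathcomp Require Import all_boot all_order all_algebra.
From mathcomp Require Import complex.
From mathcomp Require Import boolp classical_sets reals topology normedtype derive.

Set Implicit Arguments.
Unset Strict Implicit.
Unset Printing Implicit Defensive.

Import Order.TTheory GRing.Theory Num.Theory.
Import numFieldNormedType.Exports.

Local Open Scope ring_scope.
Local Open Scope classical_set_scope.

(* The field of complex numbers, bundled so that the topology and the norm which
   MathComp-Analysis puts on every numFieldType apply to it.  (Directly on R[i],
   the module structure found by inference is the one over R.) *)
Definition cplx (R : realType) : numClosedFieldType := R[i].

(* A germ at 0 is given by a representative, a total function whose values away
   from 0 are irrelevant: each predicate below constrains it only on some
   neighbourhood of 0.  Differentiability is over cplx R, that is, complex. *)
Definition holomorphic_germ (R : realType) (V W : normedModType (cplx R))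
    (f : V -> W) : Prop :=
  \forall x \near (0 : V), differentiable f x.

(* A 1-form on C^m in coordinates: a(x) is the column of coefficients of
   dx_1, ..., dx_m at x, so that its value on a tangent vector v is v *m a(x). *)
Definition form_coeffs (R : realType) (m : nat) : Type :=
  'rV[cplx R]_m -> 'cV[cplx R]_m.

Definition form_eval (R : realType) (m : nat) (a : form_coeffs R m)
    (x v : 'rV[cplx R]_m) : cplx R :=
  (v *m a x) ord0 ord0.

(* A point of C^(M+N) is p = (x, z) with x = lsubmx p and z = rsubmx p; tangent
   vectors are split in the same way.  The fibre at p consists of the v with
   dz_i(v) = omega_i(v) for every i. *)
Definition distribution (R : realType) (M N : nat)
    (omega : 'I_N -> form_coeffs R M) (p : 'rV[cplx R]_(M + N)) :
    set 'rV[cplx R]_(M + N) :=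
  [set v | forall i : 'I_N,
     (rsubmx v) ord0 i = form_eval (omega i) (lsubmx p) (lsubmx v)].

(* Meromorphic germs at 0 are the quotients of holomorphic germs. *)
Record mero_germ (R : realType) (n : nat) := MeroGerm {
  mero_num : 'rV[cplx R]_n -> cplx R ;
  mero_den : 'rV[cplx R]_n -> cplx R ;
  mero_num_holo : holomorphic_germ mero_num ;
  mero_den_holo : holomorphic_germ mero_den ;
  mero_den_neq0 : ~ (\forall x \near (0 : 'rV[cplx R]_n), mero_den x = 0)
}.

(* The values at the zeros of the denominator are meaningless. *)
Definition mero_fun (R : realType) (n : nat) (F : mero_germ R n) :
    'rV[cplx R]_n -> cplx R :=
  fun x => mero_num F x / mero_den F x.

Definition tangent_germ (R : realType) (n : nat)
    (D : 'rV[cplx R]_n -> set 'rV[cplx R]_n) (Z : 'rV[cplx R]_n -> 'rV[cplx R]_n) :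
    Prop :=
  \forall p \near (0 : 'rV[cplx R]_n), D p (Z p).

(* The sets below are saturated for equality of meromorphic germs, so equality
   of two of them is equality of the corresponding subfields of the field of
   meromorphic germs. *)
Definition first_integrals_distribution (R : realType) (n : nat)
    (D : 'rV[cplx R]_n -> set 'rV[cplx R]_n) : set (mero_germ R n) :=
  [set F | \forall p \near (0 : 'rV[cplx R]_n), mero_den F p != 0 ->
     forall v, D p v -> 'd (mero_fun F) p v = 0].

Definition first_integrals_vector_field (R : realType) (n : nat)
    (Z : 'rV[cplx R]_n -> 'rV[cplx R]_n) : set (mero_germ R n) :=
  [set F | \forall p \near (0 : 'rV[cplx R]_n), mero_den F p != 0 ->
     'd (mero_fun F) p (Z p) = 0].

(* Main.v *)
Require Import Defs.
From HB Require Import structures.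
From mathcomp Require Import all_boot all_order all_algebra.
From mathcomp Require Import complex.
From mathcomp Require Import boolp classical_sets reals topology normedtype derive.
From mathcomp Require Import functions landau sequences exp.
From mathcomp Require Import ring lra zify.
Set Implicit Arguments.
Unset Strict Implicit.
Unset Printing Implicit Defensive.
Import Order.TTheory GRing.Theory Num.Theory.
Import numFieldNormedType.Exports.
Local Open Scope ring_scope.
Local Open Scope classical_set_scope.

(* Let nu_1, ..., nu_M >= 1 be linearly independent over Q. Solving
   sum_j nu_j x_j d_j h = sum_j nu_j x_j omega_j and replacing z by z - h(x), we may
   assume that omega = sum_j w_j dx_j, with w_j in C^N and sum_j nu_j x_j w_j = 0.
   Choose coefficients of x^(g_i) in w_(j_i), i <= S, which form a basis of the span of
   all Taylor coefficients of the w_j. In the coordinates y with respect to this basis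
   the field has the component
     f_j = x^B nu_j x_j + psi(y) sum_(i : j_i = j) nu_i y_i x^(B - g_i)
   in the direction of x_j, with psi(y) = y_1. Let P/Q be a first integral. Replace y by
   t y and let t tend to 0: P/Q tends to the quotient P0/Q0 of the leading parts, and the
   equation becomes, at orders 1 and t on a torus where Q0 does not vanish, a linear
   system for the Laurent coefficients. By independence of the nu_j the x-derivation
   sum_j nu_j x_j d_j kills all coefficients with a nontrivial x-exponent, then the order
   t kills those with a nontrivial y-exponent. So P0 = c Q0, and applying this to P - c Q
   gives P = c Q on every slice: P/Q is constant along the distribution.
   Integrals over circles and tori are replaced throughout by finite sums. *)

(** * Real-valued norms, limits and differentials *)

(** Two obstacles shape the proof. A meromorphic first integral has no expansion at 0; on a torus
    avoiding the zeros of Q0, however, the rescaled quotients are bounded and can be tested against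
    Laurent monomials. And a single vector field tends to have more first integrals than the
    distribution, so each term of f_j has a precise task. The term x^B nu_j x_j must act on x alone:
    the relation sum_j nu_j x_j w_j = 0 cancels its y-component, which the rescaling would multiply
    by 1/t. The factor psi(y) y_i is of degree 2 in y, so that after rescaling the y-derivatives of
    the second term appear at order t and its x-derivatives only at order t^2. Once x^B is divided
    out, the only part of x^(-g_i) w_(j_i) of x-weight 0 is its coefficient of x^(g_i), the i-th
    basis vector; what survives at order t is therefore psi times the diagonal derivation sum_i nu_i
    y_i d/dy_i. The exponent B only clears denominators. The basis may span a proper subspace of
    C^N; the missing directions are the parameters of the slices, and the constant c depends on the
    slice. *)

Section RealNorm.
Variable R : realType.
Local Notation C := (cplx R).

Definition rC (x : R) : C := real_complex R x.

Lemma rC_is_additive : additive rC.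
Proof. by move=> x y; rewrite /rC; exact: (rmorphB (real_complex R)). Qed.
Lemma rC_is_multiplicative : multiplicative rC.
Proof. by split => [x y|]; rewrite /rC; [exact: (rmorphM (real_complex R))|exact: (rmorph1 (real_complex R))]. Qed.
HB.instance Definition _ := GRing.isAdditive.Build R C rC rC_is_additive.
HB.instance Definition _ := GRing.isMultiplicative.Build R C rC rC_is_multiplicative.

Lemma rC0 : rC 0 = 0. Proof. exact: rmorph0. Qed.
Lemma rC1 : rC 1 = 1. Proof. exact: rmorph1. Qed.
Lemma rCD x y : rC (x + y) = rC x + rC y. Proof. exact: rmorphD. Qed.
Lemma rCB x y : rC (x - y) = rC x - rC y. Proof. exact: rmorphB. Qed.
Lemma rCM x y : rC (x * y) = rC x * rC y. Proof. exact: rmorphM. Qed.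
Lemma rCV x : rC (x^-1) = (rC x)^-1. Proof. exact: fmorphV. Qed.
Lemma rCX x n : rC (x ^+ n) = rC x ^+ n. Proof. exact: rmorphXn. Qed.
Lemma rCn n : rC n%:R = n%:R. Proof. exact: rmorph_nat. Qed.
Lemma rC_inj : injective rC. Proof. exact: complexI. Qed.

Lemma ler_rC (x y : R) : (rC x <= rC y) = (x <= y).
Proof. exact: lecR. Qed.
Lemma ltr_rC (x y : R) : (rC x < rC y) = (x < y).
Proof. exact: ltcR. Qed.

(* The norm of a module over [cplx R] takes its values in [cplx R]; [nr] is the same number in [R]. *)
Definition nr (V : normedModType C) (v : V) : R := complex.Re (`|v| : R[i]).

Lemma rC_nr (V : normedModType C) (v : V) : `|v| = rC (nr v).
Proof. by rewrite /rC /nr RRe_real // ger0_real. Qed.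

(** Positivity in the order of [C] forces a zero imaginary part, so the epsilons of neighbourhoods
    and of little-o are real. *)
Lemma pos_rC (e : C) : 0 < e -> exists2 d : R, 0 < d & e = rC d.
Proof.
case: e => a b; rewrite ltcE /= => /andP[/eqP -> h].
by exists a.
Qed.

Section V.
Variable V : normedModType C.
Implicit Types u v w : V.
Lemma nr_ge0 v : 0 <= nr v.
Proof. by rewrite -ler_rC -rC_nr rC0. Qed.
Lemma nr0 : nr (0 : V) = 0.
Proof. by apply: complexI; rewrite -[LHS]rC_nr normr0. Qed.
Lemma nrD u v : nr (u + v) <= nr u + nr v.
Proof. by rewrite -ler_rC rCD -!rC_nr ler_normD. Qed.
Lemma nrN v : nr (- v) = nr v.
Proof. by rewrite /nr normrN. Qed.
Lemma nrB u v : nr (u - v) <= nr u + nr v.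
Proof. by rewrite -(nrN v) nrD. Qed.
Lemma nrBC u v : nr (u - v) = nr (v - u).
Proof. by rewrite -nrN opprB. Qed.
Lemma nrZ (a : C) v : nr (a *: v) = nr a * nr v.
Proof. by apply: complexI; rewrite -[LHS]rC_nr normrZ !rC_nr -rCM. Qed.
Lemma nr_eq0 v : (nr v == 0) = (v == 0).
Proof. by rewrite -[RHS]normr_eq0 rC_nr -(inj_eq (@complexI R)). Qed.
Lemma nr_gt0 v : (0 < nr v) = (v != 0).
Proof. by rewrite lt_neqAle nr_ge0 andbT eq_sym nr_eq0. Qed.
Lemma nr_dist u v w : nr (u - w) <= nr (u - v) + nr (v - w).
Proof. by rewrite -(subrK v u) -addrA (le_trans (nrD _ _)) // subrK. Qed.
Lemma nr_leB u v : nr u <= nr v + nr (u - v).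
Proof. by rewrite -{1}(subrK v u) addrC nrD. Qed.
Lemma nr_sum (I : Type) (s : seq I) (P : pred I) (F : I -> V) :
  nr (\sum_(i <- s | P i) F i) <= \sum_(i <- s | P i) nr (F i).
Proof.
elim/big_ind2 : _ => [|x a y b xa yb|//]; first by rewrite nr0.
exact: le_trans (nrD _ _) (lerD xa yb).
Qed.
Lemma nbhs_nrP (p : V) (A : set V) :
  nbhs p A <-> exists2 e : R, 0 < e & forall q, nr (q - p) < e -> A q.
Proof.
split=> [/nbhs_ballP[e e0 eA]|[e e0 eA]].
  have [d d0 de] := pos_rC e0; exists d => // q qp; apply: eA.
  by rewrite -ball_normE /= distrC rC_nr de ltr_rC.
apply/nbhs_ballP; exists (rC e); first by rewrite /= -(rC0) ltr_rC.
by move=> q; rewrite -ball_normE /= distrC rC_nr ltr_rC => /eA.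
Qed.
End V.

Lemma nrM (a b : C) : nr (a * b) = nr a * nr b.
Proof. exact: (@nrZ C a b). Qed.
Lemma nr1 : nr (1 : C) = 1.
Proof. by apply: complexI; rewrite -[LHS]rC_nr normr1. Qed.
Lemma nrX (a : C) n : nr (a ^+ n) = nr a ^+ n.
Proof. by elim: n => [|n ih]; rewrite ?nr1 // !exprS nrM ih. Qed.
Lemma nrV (a : C) : nr (a^-1) = (nr a)^-1.
Proof. by apply: complexI; rewrite -[LHS]rC_nr normfV !rC_nr -rCV. Qed.
Lemma nr_rC (x : R) : nr (rC x) = `|x|.
Proof. by apply: complexI; rewrite -[LHS]rC_nr /rC normc_def /= expr0n /= addr0 sqrtr_sqr. Qed.
Lemma nr_Re (z : C) : `|complex.Re (z : R[i])| <= nr z.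
Proof. by rewrite /nr (normc_def (z : R[i])) /= -[leLHS]sqrtr_sqr ler_wsqrtr // lerDl sqr_ge0. Qed.
Lemma nr_Im (z : C) : `|complex.Im (z : R[i])| <= nr z.
Proof. by rewrite /nr (normc_def (z : R[i])) /= -[leLHS]sqrtr_sqr ler_wsqrtr // lerDr sqr_ge0. Qed.

Definition ic : C := Complex 0 1.
Lemma nr_ic : nr ic = 1.
Proof. by rewrite /nr /ic (normc_def (Complex 0 1)) /= expr0n add0r expr1n sqrtr1. Qed.
Lemma ic2 : ic * ic = -1.
Proof. by rewrite -expr2; exact: sqr_i. Qed.
Lemma C_decomp (z : C) : z = rC (complex.Re (z : R[i])) + ic * rC (complex.Im (z : R[i])).
Proof. exact: complexE. Qed.
Lemma nr_decomp (a b : R) : nr (rC a + ic * rC b) <= `|a| + `|b|.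
Proof. by apply: le_trans (nrD _ _) _; rewrite nrM nr_ic mul1r !nr_rC. Qed.
End RealNorm.

(** The strict case of a sum only treats [A + 1] with [A] nonnegative, the shape given to many
    denominators below to keep them nonzero. *)
Ltac pos :=
  lazymatch goal with
  | |- is_true (@Order.le _ _ _ (@Algebra.add _ _ _)) => apply: addr_ge0; pos
  | |- is_true (@Order.le _ _ _ (@GRing.mul _ _ _)) => apply: mulr_ge0; pos
  | |- is_true (@Order.le _ _ _ (@GRing.exp _ _ _)) => apply: exprn_ge0; pos
  | |- is_true (@Order.le _ _ _ (@GRing.inv _ _)) => rewrite invr_ge0; pos
  | |- is_true (@Order.le _ _ _ (@nr _ _ _)) => exact: nr_ge0
  | |- is_true (@Order.lt _ _ _ (@Algebra.add _ _ (GRing.one _))) => apply: ltr_wpDl; [pos | exact: ltr01]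
  | |- is_true (@Order.lt _ _ _ (@GRing.mul _ _ _)) => apply: mulr_gt0; pos
  | |- is_true (@Order.lt _ _ _ (@GRing.exp _ _ _)) => apply: exprn_gt0; pos
  | |- is_true (@Order.lt _ _ _ (@GRing.inv _ _)) => rewrite invr_gt0; pos
  | |- _ => try first [assumption | apply: ltW; assumption | exact: ler0n | exact: ltr0Sn | by []]
  end.

Section Cauchy.
Variable R : realType.
Local Notation C := (cplx R).

Definition tendsto (V : normedModType C) (u : nat -> V) (z : V) :=
  forall e : R, 0 < e -> exists K, forall k, (K <= k)%N -> nr (u k - z) <= e.

Lemma R_cauchy (u : nat -> R) :
  (forall e : R, 0 < e -> exists K, forall k l, (K <= k)%N -> (K <= l)%N -> `|u k - u l| <= e) ->
  exists z, forall e : R, 0 < e -> exists K, forall k, (K <= k)%N -> `|u k - z| <= e.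
Proof.
move=> h.
have /cauchy_cvgP/cvg_ex[z /cvgrPdist_le uz] : cauchy (u @ \oo).
  apply/cauchy_exP => e e0.
  have [K hK] := h (e / 2) ltac:(lra).
  exists (u K); exists K => // k /= Kk; rewrite -ball_normE /=.
  by have := hK K k (leqnn _) Kk; lra.
exists z => e /uz[K _ hK]; exists K => k Kk; rewrite distrC; exact: hK.
Qed.

Lemma C_cauchy (u : nat -> C) :
  (forall e : R, 0 < e -> exists K, forall k l, (K <= k)%N -> (K <= l)%N -> nr (u k - u l) <= e) ->
  exists z, tendsto u z.
Proof.
move=> h.
have [a ha] : exists z, forall e : R, 0 < e -> exists K, forall k, (K <= k)%N ->
    `|complex.Re (u k : R[i]) - z| <= e.
  apply: R_cauchy => e /h[K hK]; exists K => k l Kk Kl.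
  apply: le_trans (hK k l Kk Kl); apply: le_trans (nr_Re _).
  by rewrite -raddfB.
have [b hb] : exists z, forall e : R, 0 < e -> exists K, forall k, (K <= k)%N ->
    `|complex.Im (u k : R[i]) - z| <= e.
  apply: R_cauchy => e /h[K hK]; exists K => k l Kk Kl.
  apply: le_trans (hK k l Kk Kl); apply: le_trans (nr_Im _).
  by rewrite -raddfB.
exists (rC a + ic R * rC b) => e e0.
have [K hK] := ha (e / 2) ltac:(lra).
have [K' hK'] := hb (e / 2) ltac:(lra).
exists (maxn K K') => k; rewrite geq_max => /andP[/hK hk /hK' hk'].
rewrite {1}[u k]C_decomp.
have -> : rC (complex.Re (u k : R[i])) + ic R * rC (complex.Im (u k : R[i])) - (rC a + ic R * rC b)
  = rC (complex.Re (u k : R[i]) - a) + ic R * rC (complex.Im (u k : R[i]) - b).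
  by rewrite !rCB; ring.
by apply: le_trans (nr_decomp _ _) _; lra.
Qed.

Lemma pow_small (q e : R) : 0 <= q < 1 -> 0 < e -> exists K, forall k, (K <= k)%N -> q ^+ k <= e.
Proof.
move=> /andP[q0 q1] e0.
have /cvgrPdist_le /(_ e e0)[K _ hK] : (fun k => q ^+ k) @ \oo --> (0 : R).
  by apply: cvg_expr; rewrite ger0_norm.
exists K => k /hK /=; rewrite sub0r normrN ger0_norm // exprn_ge0 //.
Qed.

Lemma tendsto_uniq (V : normedModType C) (u : nat -> V) z z' :
  tendsto u z -> tendsto u z' -> z = z'.
Proof.
move=> h h'; apply/eqP; rewrite -subr_eq0 -nr_eq0 eq_le nr_ge0 andbT.
apply/ler_addgt0Pr => e e0; rewrite add0r.
have [K hK] := h (e / 2) ltac:(lra); have [K' hK'] := h' (e / 2) ltac:(lra).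
have := hK (maxn K K') (leq_maxl _ _); have := hK' (maxn K K') (leq_maxr _ _).
have := nr_dist z (u (maxn K K')) z'; rewrite (nrBC z (u _)); lra.
Qed.

Lemma tendsto_le (V : normedModType C) (u : nat -> V) z (w : V) (c : R) K :
  tendsto u z -> (forall k, (K <= k)%N -> nr (u k - w) <= c) -> nr (z - w) <= c.
Proof.
move=> h hc; apply/ler_addgt0Pr => e /h[K' hK'].
have := hK' (maxn K K') (leq_maxr _ _); have := hc (maxn K K') (leq_maxl _ _).
by have := nr_dist z (u (maxn K K')) w; rewrite (nrBC z (u _)); lra.
Qed.
End Cauchy.

Section Diff.
Variable R : realType.
Local Notation C := (cplx R).
Variables V W : normedModType C.
Implicit Types (f : V -> W) (p : V).

Lemma bounded_linear_continuous (L : {linear V -> W}) (K : R) :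
  (forall v, nr (L v) <= K * nr v) -> continuous L.
Proof.
move=> hL p; apply/cvgrPdist_le => e e0.
have [d d0 ->] := pos_rC e0.
apply/nbhs_nrP; exists (d / (`|K| + 1)); first by rewrite divr_gt0 // ltr_wpDl.
move=> q; rewrite ltr_pdivlMr ?ltr_wpDl // => hq.
rewrite -linearB rC_nr ler_rC; apply: le_trans (hL _) _.
rewrite nrBC; have := nr_ge0 (q - p); have := ler_norm K; nra.
Qed.

Lemma diff_elim f p : differentiable f p -> forall e : R, 0 < e ->
  exists2 d : R, 0 < d & forall v, nr v < d -> nr (f (p + v) - f p - 'd f p v) <= e * nr v.
Proof.
move=> /diff_locally /eqaddoP h e e0.
have := h (rC e); rewrite -rC0 ltr_rC => /(_ e0) /nbhs_nrP[d d0 hd].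
exists d => // v vd; have := hd v; rewrite subr0 => /(_ vd).
by rewrite !rC_nr -rCM ler_rC /= !fctE /= [p + v]addrC opprD addrA.
Qed.

(** The bound [K] supplies the continuity of [L], without which an affine approximation does not
    determine the differential. *)
Lemma diff_intro f p (L : {linear V -> W}) (K : R) :
  (forall v, nr (L v) <= K * nr v) ->
  (forall e : R, 0 < e -> exists2 d : R, 0 < d &
     forall v, nr v < d -> nr (f (p + v) - f p - L v) <= e * nr v) ->
  differentiable f p /\ 'd f p = L :> (V -> W).
Proof.
move=> /bounded_linear_continuous cL h.
have E : f \o shift p = cst (f p) + L +o_ 0 id.
  apply/eqaddoP => e e0; have [d d0 ->] := pos_rC e0.
  have [r r0 hr] := h d d0.
  apply/nbhs_nrP; exists r => // v; rewrite subr0 => /hr.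
  by rewrite !rC_nr -rCM ler_rC /= [p + v]addrC !fctE opprD addrA.
have dE := diff_unique cL E.
by split => //; apply/diff_locallyP; rewrite dE.
Qed.

Lemma diff_bound f p : differentiable f p -> exists2 K : R, 0 < K & forall v, nr ('d f p v) <= K * nr v.
Proof.
move=> df; have [k k0 hk] := linear_lipschitz (diff_continuous df).
have [d d0 dk] := pos_rC k0; exists d => // v.
by have := hk v; rewrite dk !rC_nr -rCM ler_rC.
Qed.

Lemma diff_cont f p : differentiable f p -> forall e : R, 0 < e ->
  exists2 d : R, 0 < d & forall v, nr v < d -> nr (f (p + v) - f p) <= e.
Proof.
move=> df e e0; have [K K0 hK] := diff_bound df.
have [d d0 hd] := diff_elim df ltr01.
exists (Num.min d (e / (K + 1))); first by rewrite lt_min d0 divr_gt0 //; lra.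
move=> v; rewrite lt_min => /andP[/hd vd]; rewrite ltr_pdivlMr; last lra.
have := hK v; have := nrD (f (p + v) - f p - 'd f p v) ('d f p v); rewrite subrK; lra.
Qed.

End Diff.

(** * Cauchy's theorem with finite sums *)

Section Square.
Variable R : realType.
Local Notation C := (cplx R).
Local Notation ii := (ic R).
Local Notation ReC z := (complex.Re (z : R[i])).
Local Notation ImC z := (complex.Im (z : R[i])).

Definition pt (z : C) (s : R) (p q : nat) : C := z + rC (s * p%:R) + ii * rC (s * q%:R).

(* Left Riemann sum, with [N] nodes on each side, of the contour integral of [f]
   around the square with lower left corner [z] and side [s * N]. *)
Definition mu (N : nat) (f : C -> C) (z : C) (s : R) : C :=
  rC s * \sum_(p < N) (f (pt z s p 0) + ii * f (pt z s N p) - f (pt z s p N) - ii * f (pt z s 0 p)).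

Lemma pt_pt z s p q p' q' : pt (pt z s p q) s p' q' = pt z s (p + p') (q + q').
Proof. by rewrite /pt !natrD !mulrDr !rCD; ring. Qed.

Lemma ReD (a b : C) : ReC (a + b) = ReC a + ReC b. Proof. by case: a b => [? ?] [? ?]. Qed.
Lemma ImD (a b : C) : ImC (a + b) = ImC a + ImC b. Proof. by case: a b => [? ?] [? ?]. Qed.
Lemma ReN (a : C) : ReC (- a) = - ReC a. Proof. by case: a => [? ?]. Qed.
Lemma ImN (a : C) : ImC (- a) = - ImC a. Proof. by case: a => [? ?]. Qed.
Lemma Re_rC (x : R) : ReC (rC x) = x. Proof. by []. Qed.
Lemma Im_rC (x : R) : ImC (rC x) = 0. Proof. by []. Qed.
Lemma ReM (a b : C) : ReC (a * b) = ReC a * ReC b - ImC a * ImC b. Proof. by case: a b => [? ?] [? ?]. Qed.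
Lemma ImM (a b : C) : ImC (a * b) = ReC a * ImC b + ImC a * ReC b. Proof. by case: a b => [? ?] [? ?]. Qed.
Lemma Re_ic : ReC ii = 0. Proof. by []. Qed.
Lemma Im_ic : ImC ii = 1. Proof. by []. Qed.
Definition ReImE := (ReD, ImD, ReN, ImN, ReM, ImM, Re_rC, Im_rC, Re_ic, Im_ic).

Lemma Re_pt z s p q : ReC (pt z s p q) = ReC z + s * p%:R.
Proof. by rewrite /pt !ReImE; ring. Qed.
Lemma Im_pt z s p q : ImC (pt z s p q) = ImC z + s * q%:R.
Proof. by rewrite /pt !ReImE; ring. Qed.

Lemma block_sum (V : zmodType) (F : nat -> V) (J N : nat) :
  \sum_(p < J * N) F p = \sum_(a < J) \sum_(b < N) F (a * N + b)%N.
Proof.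
elim: J => [|J ih]; first by rewrite mul0n !big_ord0.
rewrite big_ord_recr /= -ih -!(big_mkord xpredT) mulSn addnC.
rewrite (big_cat_nat (n := (J * N)%N)) ?leq_addr //=; congr (_ + _).
rewrite -{1}[(J * N)%N]add0n big_addn addKn.
by rewrite -(big_mkord xpredT (fun b => F (J * N + b)%N)); apply: eq_bigr => b _; rewrite addnC.
Qed.

(** Adjacent subsquares traverse their common side in opposite directions and on the same nodes, so
    the interior contributions cancel exactly, not just in the limit. *)
Lemma mu_split (J N : nat) f z s :
  mu (J * N) f z s = \sum_(a < J) \sum_(b < J) mu N f (pt z s (a * N) (b * N)) s.
Proof.
rewrite /mu; under [RHS]eq_bigr => a _ do rewrite -mulr_sumr.
rewrite -mulr_sumr; apply: (congr1 (fun t => rC s * t)).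
(* [T] and [U] are the sums over one horizontal and one vertical edge of the coarse grid; the
   differences telescope in each direction. *)
pose T := fun c d : nat => \sum_(p < N) f (pt z s (c * N + p) (d * N)).
pose U := fun c d : nat => \sum_(p < N) ii * f (pt z s (c * N) (d * N + p)).
have -> : \sum_(a < J) \sum_(b < J) \sum_(p < N)
   (f (pt (pt z s (a * N) (b * N)) s p 0) + ii * f (pt (pt z s (a * N) (b * N)) s N p)
    - f (pt (pt z s (a * N) (b * N)) s p N) - ii * f (pt (pt z s (a * N) (b * N)) s 0 p)) =
   \sum_(a < J) (T a 0%N - T a J) + \sum_(b < J) (U J b - U 0%N b).
  have -> : \sum_(b < J) (U J b - U 0%N b) = \sum_(a < J) \sum_(b < J) (U a.+1 b - U a b).
    rewrite exchange_big; apply: eq_bigr => b _ /=.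
    rewrite -(big_mkord xpredT (fun a => U a.+1 b - U a b)) telescope_sumr //.
  rewrite -big_split; apply: eq_bigr => a _ /=.
  have -> : T a 0%N - T a J = \sum_(b < J) (T a b - T a b.+1).
    rewrite -(big_mkord xpredT (fun b => T a b - T a b.+1)) (eq_bigr (fun b => - (T a b.+1 - T a b))).
      by rewrite sumrN telescope_sumr // opprB.
    by move=> b _; rewrite opprB.
  rewrite -big_split; apply: eq_bigr => b _ /=.
  rewrite /T /U -!sumrB -big_split; apply: eq_bigr => p _ /=.
  rewrite !pt_pt !addn0 ![(_.+1 * N)%N]mulSn ![(N + _)%N]addnC; ring.
rewrite !big_split /= !sumrN.
rewrite (block_sum (fun p => f (pt z s p 0))) (block_sum (fun p => ii * f (pt z s (J * N) p))).
rewrite (block_sum (fun p => f (pt z s p (J * N)))) (block_sum (fun p => ii * f (pt z s 0 p))).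
by rewrite /T /U; ring.
Qed.

Lemma mu_eq N f g z s :
  (forall p q, (p <= N)%N -> (q <= N)%N -> (p == 0)%N || (p == N) || (q == 0)%N || (q == N) ->
     f (pt z s p q) = g (pt z s p q)) -> mu N f z s = mu N g z s.
Proof.
move=> h; rewrite /mu; apply: (congr1 (fun t => rC s * t)); apply: eq_bigr => p _.
by rewrite !h ?eqxx ?orbT // ltnW.
Qed.

Lemma muD N f g z s : mu N (fun w => f w + g w) z s = mu N f z s + mu N g z s.
Proof.
rewrite /mu -mulrDr -big_split; apply: (congr1 (fun t => rC s * t)); apply: eq_bigr => p _ /=; ring.
Qed.
Lemma muZ N c f z s : mu N (fun w => c * f w) z s = c * mu N f z s.
Proof.
rewrite /mu mulrCA [c * _]mulr_sumr; apply: (congr1 (fun t => rC s * t)); apply: eq_bigr => p _ /=; ring.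
Qed.
Lemma mu_sum N (I : Type) (r : seq I) (F : I -> C -> C) z s :
  mu N (fun w => \sum_(j <- r) F j w) z s = \sum_(j <- r) mu N (F j) z s.
Proof.
elim: r => [|j r ih].
  rewrite big_nil (_ : (fun w => _) = fun w => 0 * 0); first by rewrite muZ mul0r.
  by rewrite funeqE => w; rewrite big_nil mul0r.
rewrite big_cons -ih -muD; congr mu; rewrite funeqE => w; by rewrite big_cons.
Qed.

(** For an affine function the difference between opposite sides is constant, so every summand is
    already 0 and no limit is involved. *)
Lemma mu_affine N a b z s : mu N (fun w => a * w + b) z s = 0.
Proof.
rewrite /mu big1 ?mulr0 // => p _; rewrite /pt.
have := ic2 R; move: (ic R) => j j2; rewrite !mulr0 rC0.
set x := rC _; set y := rC _.
transitivity (- (j * j + 1) * 0 * a + (j * j + 1) * a * (- y) + (j * j + 1) * a * y : C); first by ring.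
by rewrite j2; ring.
Qed.

Lemma mu_bound N f z s B : 0 <= s ->
  (forall p q, (p <= N)%N -> (q <= N)%N -> (p == 0)%N || (p == N) || (q == 0)%N || (q == N) ->
     nr (f (pt z s p q)) <= B) -> nr (mu N f z s) <= 4 * (s * N%:R) * B.
Proof.
move=> s0 h; rewrite /mu nrM nr_rC (ger0_norm s0).
have -> : 4 * (s * N%:R) * B = s * (\sum_(p < N) (4 * B)).
  rewrite sumr_const card_ord -[_ *+ N]mulr_natr; ring.
rewrite ler_wpM2l //; apply: le_trans (nr_sum _ _ _) _; apply: ler_sum => p _.
have h1 := h p 0%N; have h2 := h N p; have h3 := h p N; have h4 := h 0%N p.
rewrite !leqnn !eqxx !orbT /= (ltnW (ltn_ord p)) in h1 h2 h3 h4.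
have {}h1 := h1 isT isT isT. have {}h2 := h2 isT isT isT.
have {}h3 := h3 isT isT isT. have {}h4 := h4 isT isT isT.
set a := f _; set b := f _; set c := f _; set d := f _.
have e1 := nrB (a + ii * b - c) (ii * d); have e2 := nrB (a + ii * b) c; have e3 := nrD a (ii * b).
rewrite !nrM !nr_ic in e1 e2 e3; rewrite -/a in h1; rewrite -/b in h2; rewrite -/c in h3; rewrite -/d in h4.
lra.
Qed.

End Square.

Section Goursat.
Variable R : realType.
Local Notation C := (cplx R).
Local Notation ii := (ic R).
Local Notation ReC z := (complex.Re (z : R[i])).
Local Notation ImC z := (complex.Im (z : R[i])).

Definition in_square (z : C) (h : R) (w : C) :=
  [/\ ReC z <= ReC w, ReC w <= ReC z + h, ImC z <= ImC w & ImC w <= ImC z + h].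

Lemma in_square_pt z s N p q : 0 <= s -> (p <= N)%N -> (q <= N)%N -> in_square z (s * N%:R) (pt z s p q).
Proof.
move=> s0 pN qN; rewrite /in_square !Re_pt !Im_pt.
by split; rewrite ?lerDl ?lerD2l ?mulr_ge0 ?ler0n // ler_wpM2l // ler_nat.
Qed.

Lemma in_square_diam z h w w' : in_square z h w -> in_square z h w' -> nr (w - w') <= 2 * h.
Proof.
move=> [a b c d] [a' b' c' d']; rewrite [w - w']C_decomp; apply: le_trans (nr_decomp _ _) _.
rewrite !ReImE.
have : `|ReC w - ReC w'| <= h by rewrite ler_norml; lra.
have : `|ImC w - ImC w'| <= h by rewrite ler_norml; lra.
lra.
Qed.

Lemma in_square_trans z h z' h' w : in_square z h z' -> in_square z h (z' + (rC h' + ii * rC h')) -> in_square z' h' w -> in_square z h w.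
Proof.
move=> [a b c d] []; rewrite !ReImE => a' b' c' d' [? ? ? ?]; split; lra.
Qed.

Lemma in_square_lim z h (u : nat -> C) c K : tendsto u c -> (forall k, (K <= k)%N -> in_square z h (u k)) -> in_square z h c.
Proof.
move=> uc uz.
have key e : 0 < e -> exists k, [/\ (K <= k)%N, `|ReC (u k) - ReC c| <= e & `|ImC (u k) - ImC c| <= e].
  move=> /uc[K' hK']; exists (maxn K K'); split; first exact: leq_maxl.
  - have := nr_Re (u (maxn K K') - c); rewrite !ReImE => /le_trans; apply.
    by apply: hK'; exact: leq_maxr.
  - have := nr_Im (u (maxn K K') - c); rewrite !ReImE => /le_trans; apply.
    by apply: hK'; exact: leq_maxr.
by split; apply/ler_addgt0Pr => e /key[k [/uz[? ? ? ?]]]; rewrite !ler_norml; lra.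
Qed.

(** By [mu_affine] the first-order part of [f] at [c] contributes nothing. On a square of side h the
    remainder is at most e/8 times the diameter bound 2h, and the perimeter is 4h: together e
    h^2. *)
Lemma mu_small_near (f : C -> C) (c : C) (e : R) : 0 < e -> differentiable f c ->
  exists2 d : R, 0 < d & forall z N s, 0 <= s -> in_square z (s * N%:R) c -> 2 * (s * N%:R) < d ->
    nr (mu N f z s) <= e * (s * N%:R) ^+ 2.
Proof.
move=> e0 df; have [d d0 hd] := diff_elim df (ltac:(lra) : 0 < e / 8).
exists d => // z' N s s0 zc sd.
have hs : 0 <= s * N%:R by rewrite mulr_ge0.
have dlin v : 'd f c v = 'd f c 1 * v.
  by rewrite -{1}[v]mulr1 -[v * 1]/(v *: (1 : C)) linearZ /= mulrC.
pose g w := f w - f c - 'd f c (w - c).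
have -> : mu N f z' s = mu N g z' s.
  rewrite -[LHS]addr0 -(mu_affine N (- 'd f c 1) (- f c + 'd f c 1 * c) z' s) -muD.
  by congr (mu N _ z' s); rewrite funeqE => w; rewrite /g (dlin (w - c)); ring.
apply: le_trans (mu_bound (B := e / 8 * (2 * (s * N%:R))) s0 _) _; last nra.
move=> p q pN qN _.
have hdm := in_square_diam (in_square_pt z' s0 pN qN) zc.
have := hd (pt z' s p q - c) (le_lt_trans hdm sd).
rewrite [c + _]addrC subrK /g => /le_trans; apply.
by apply: ler_wpM2l => //; lra.
Qed.

(* Goursat's bisection: a square which is not [good] has a quarter which is not [good]. *)
Let good f (e : R) z h := exists K, forall k, (K <= k)%N ->
   nr (mu (2 ^ k) f z (h / (2 ^ k)%:R)) <= e * h ^+ 2.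

Lemma good_split f e z h :
  (forall a b : 'I_2, good f e (pt z (h / 2) a b) (h / 2)) -> good f e z h.
Proof.
move=> H.
have [K hK] := choice (fun ab : 'I_2 * 'I_2 => H ab.1 ab.2).
exists (\max_ab K ab).+1 => k; case: k => // k; rewrite ltnS => kK.
rewrite expnS mu_split.
have E a b : pt z (h / (2 * 2 ^ k)%:R) (a * 2 ^ k) (b * 2 ^ k) = pt z (h / 2) a b.
  have k0 : (2 ^ k)%:R != 0 :> R by rewrite pnatr_eq0 expn_eq0.
  by rewrite /pt; congr (_ + rC _ + ii * rC _); rewrite !natrM; field.
have E2 : h / (2 * 2 ^ k)%:R = h / 2 / (2 ^ k)%:R.
  by rewrite natrM invfM mulrA.
apply: le_trans (nr_sum _ _ _) _.
have -> : e * h ^+ 2 = \sum_(a < 2) \sum_(b < 2) e * (h / 2) ^+ 2.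
  by rewrite !big_ord_recr !big_ord0 /=; field.
apply: ler_sum => a _; apply: le_trans (nr_sum _ _ _) _; apply: ler_sum => b _.
rewrite E E2; apply: (hK (a, b)); apply: leq_trans kK.
exact: (leq_bigmax (a, b)).
Qed.

(** Otherwise bisection yields nested squares, none of them [good], shrinking to a point [c];
    differentiability at [c] makes a small one [good] by [mu_small_near]. Dyadic grids are used
    because a square and its quarters then share their nodes. *)
Lemma goursat f z h : 0 < h -> (forall w, in_square z h w -> differentiable f w) ->
  forall e : R, 0 < e -> exists K, forall k, (K <= k)%N -> nr (mu (2 ^ k) f z (h / (2 ^ k)%:R)) <= e.
Proof.
move=> h0 df.
suff G e : 0 < e -> good f e z h.
  move=> e e0; have [K hK] := G (e / h ^+ 2) (divr_gt0 e0 (exprn_gt0 2 h0)).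
  exists K => k /hK; rewrite divfK //; apply: lt0r_neq0; exact: exprn_gt0.
move=> e0; apply: contrapT => bad.
pose hn n : R := h / 2 ^+ n.
have hn0 n : 0 < hn n by rewrite divr_gt0 // exprn_gt0.
have hnS n : hn n / 2 = hn n.+1 by rewrite /hn exprSr invfM mulrA.
(* The implication sits under the existential so that [choice] gives a total function; on a good
   square the value 0 is arbitrary. *)
have step (nz : nat * C) : exists z', ~ good f e nz.2 (hn nz.1) ->
    (exists a b : 'I_2, z' = pt nz.2 (hn nz.1.+1) a b) /\ ~ good f e z' (hn nz.1.+1).
  have [gd|nb] := pselect (good f e nz.2 (hn nz.1)); first by exists 0.
  have /existsNP[a /existsNP[b hab]] : ~ forall a b : 'I_2, good f e (pt nz.2 (hn nz.1 / 2) a b) (hn nz.1 / 2).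
    by move=> hh; apply: nb; exact: good_split.
  rewrite hnS in hab.
  by exists (pt nz.2 (hn nz.1.+1) a b) => _; split => //; exists a, b.
have [F hF] := choice step.
pose zn := fix zn n := if n is n'.+1 then F (n', zn n') else z.
have zbad n : ~ good f e (zn n) (hn n).
  elim: n => [|n ih]; first by rewrite /= /hn expr0 divr1.
  by have [] := hF (n, zn n) ih.
have znS n : in_square (zn n) (hn n) (zn n.+1) /\
     in_square (zn n) (hn n) (zn n.+1 + (rC (hn n.+1) + ii * rC (hn n.+1))).
  have [[a [b hz]] _] := hF (n, zn n) (zbad n).
  have -> : zn n.+1 = pt (zn n) (hn n.+1) a b by rewrite -hz.
  have h2 : hn n = hn n.+1 * 2%:R by rewrite -hnS divfK // pnatr_eq0.
  have al := ltn_ord a; have bl := ltn_ord b.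
  rewrite h2; split; first exact: in_square_pt (ltW (hn0 _)) (ltnW al) (ltnW bl).
  have -> : pt (zn n) (hn n.+1) a b + (rC (hn n.+1) + ii * rC (hn n.+1)) =
     pt (zn n) (hn n.+1) (a.+1) (b.+1).
    rewrite /pt -[a.+1%:R]natr1 -[b.+1%:R]natr1 !mulrDr !mulr1 !rCD; ring.
  exact: in_square_pt (ltW (hn0 _)) al bl.
have nest n w : in_square (zn n.+1) (hn n.+1) w -> in_square (zn n) (hn n) w.
  by have [a b] := znS n; exact: in_square_trans a b.
have nestk n k : in_square (zn n) (hn n) (zn (n + k)%N).
  have : in_square (zn (n + k)%N) (hn (n + k)%N) (zn (n + k)%N).
    by have := hn0 (n + k)%N; split; lra.
  move: {2 3}(zn (n + k)%N) => w; elim: k => [|k ih]; first by rewrite addn0.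
  by rewrite addnS => /nest/ih.
have hsmall (d : R) : 0 < d -> exists n, 2 * hn n < d.
  move=> d0; have dh0 : 0 < d / (4 * h) by rewrite divr_gt0 // mulr_gt0.
  have q1 : 0 <= (1 / 2 : R) < 1 by apply/andP; split; lra.
  have [K hK] := pow_small q1 dh0.
  exists K; have := hK K (leqnn _).
  rewrite ler_pdivlMr ?mulr_gt0 //.
  have -> : 2 * hn K = (1 / 2) ^+ K * (4 * h) / 2.
    by rewrite /hn expr_div_n expr1n; field; rewrite expf_neq0 // pnatr_eq0.
  by move=> hh; lra.
have [c hc] : exists c, tendsto zn c.
  apply: C_cauchy => d /hsmall[n hn2]; exists n => k l nk nl.
  have := in_square_diam (nestk n (k - n)%N) (nestk n (l - n)%N).
  by rewrite !subnKC //; lra.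
have cin n : in_square (zn n) (hn n) c.
  by apply: (in_square_lim (K := n) hc) => k nk; have := nestk n (k - n)%N; rewrite subnKC.
have dc : differentiable f c by apply: df; have := cin 0%N; rewrite /= /hn expr0 divr1.
have [d d0 hd] := mu_small_near e0 dc.
have [n hnd] := hsmall d d0.
apply: (zbad n); exists 0%N => k _.
have E : hn n / (2 ^ k)%:R * (2 ^ k)%:R = hn n by rewrite divfK // pnatr_eq0 expn_eq0.
have := hd (zn n) (2 ^ k)%N (hn n / (2 ^ k)%:R); rewrite E; apply => //.
by rewrite divr_ge0 // ltW.
Qed.
End Goursat.

Section Cauchy.
Variable R : realType.
Local Notation C := (cplx R).
Local Notation ii := (ic R).
Local Notation ReC z := (complex.Re (z : R[i])).
Local Notation ImC z := (complex.Im (z : R[i])).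

Lemma nr_sq (z : C) : nr z ^+ 2 = ReC z ^+ 2 + ImC z ^+ 2.
Proof. by rewrite /nr (normc_def (z : R[i])) /= sqr_sqrtr // addr_ge0 // sqr_ge0. Qed.

(* [u] is a substitute for the indicator of the intervals [[a, a+1]] containing [x]. *)
Lemma interval_weight (x : R) : exists u : nat -> R,
  [/\ forall a, 0 <= u a, forall a, a%:R <= x <= a%:R + 1 -> 1 <= u a &
      forall J, \sum_(a < J) u a <= 2].
Proof.
(* Clipping a - x to [-1, 1] gives a nondecreasing function of total variation at most 2 which is
   not clipped at a and a + 1 when x lies between them; its increments are the weights. *)
pose phi (a : nat) : R := Num.max (-1) (Num.min 1 (a%:R - x)).
exists (fun a => phi a.+1 - phi a); split=> [a|a|J].
- rewrite /phi -natr1; case: (leP 1 (a%:R + 1 - x)); case: (leP 1 (a%:R - x)) => ? ?.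
  + by rewrite subrr.
  + case: (leP (-1) (a%:R - x)); case: (leP (-1) 1) => ? ?; lra.
  + lra.
  + case: (leP (-1) (a%:R - x)); case: (leP (-1) (a%:R + 1 - x)) => ? ?; lra.
- rewrite /phi -natr1; case: (leP 1 (a%:R + 1 - x)); case: (leP 1 (a%:R - x)) => ? ? ?.
  + lra.
  + case: (leP (-1) (a%:R - x)); case: (leP (-1) 1) => ? ?; lra.
  + lra.
  + case: (leP (-1) (a%:R - x)); case: (leP (-1) (a%:R + 1 - x)) => ? ?; lra.
- rewrite -(big_mkord xpredT (fun a => phi a.+1 - phi a)) telescope_sumr //.
  have P b : -1 <= phi b <= 1.
    by rewrite /phi; case: (leP 1 (b%:R - x)) => ?; [case: (leP (-1) 1)|case: (leP (-1) (b%:R - x))] => ?; lra.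
  have /andP[? ?] := P J; have /andP[? ?] := P 0%N; lra.
Qed.

Variables (f : C -> C) (r B : R).
Hypothesis r0 : 0 < r.
Hypothesis df : forall z, nr z < r -> differentiable f z.
Hypothesis fB : forall z, nr z < r -> nr (f z) <= B.

(** Lower left corner of the square of side [r] centred at 0: the square lies in the open disc of
    radius [r], and its boundary outside that of radius r/2. *)
Let z0 : C := - (rC (r / 2) + ii * rC (r / 2)).
Local Notation "'cmu' k g" := (mu (2 ^ k) g z0 (r / (2 ^ k)%:R)) (at level 10, k, g at next level).

Let B0 : 0 <= B.
Proof. by apply: le_trans (fB (z := 0) _); rewrite ?nr_ge0 // nr0. Qed.

Lemma in_square_disc w : in_square z0 r w -> nr w < r.
Proof.
rewrite /in_square /z0 !ReImE => -[a b c d].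
rewrite -(ltr_pXn2r (n := 2)) ?nnegrE ?nr_ge0 ?(ltW r0) // nr_sq.
have : ReC w ^+ 2 <= (r / 2) ^+ 2 by nra.
have : ImC w ^+ 2 <= (r / 2) ^+ 2 by nra.
by have := exprn_gt0 2 r0; lra.
Qed.

Lemma pow2_neq0 k : (2 ^ k)%:R != 0 :> R.
Proof. by rewrite pnatr_eq0 expn_eq0. Qed.

Lemma pow2_gt0 k : 0 < (2 ^ k)%:R :> R.
Proof. by rewrite ltr0n expn_gt0. Qed.

Lemma boundary_ge k p q : (p <= 2 ^ k)%N -> (q <= 2 ^ k)%N ->
  (p == 0)%N || (p == 2 ^ k)%N || (q == 0)%N || (q == 2 ^ k)%N ->
  r / 2 <= nr (pt z0 (r / (2 ^ k)%:R) p q).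
Proof.
move=> _ _ H.
have [E|E] : `|ReC (pt z0 (r / (2 ^ k)%:R) p q)| = r / 2 \/ `|ImC (pt z0 (r / (2 ^ k)%:R) p q)| = r / 2.
- rewrite Re_pt Im_pt /z0 !ReImE !(mul0r, mulr0, mul1r, subr0, addr0, add0r).
  have h2 : 0 < r / 2 by rewrite divr_gt0.
  case/orP: H => [/orP[/orP[]|]|] /eqP ->; [left|left|right|right].
  + by rewrite mulr0 addr0 normrN gtr0_norm.
  + by rewrite divfK ?pow2_neq0 // (_ : _ + r = r / 2) ?gtr0_norm //; field.
  + by rewrite mulr0 addr0 normrN gtr0_norm.
  + by rewrite divfK ?pow2_neq0 // (_ : _ + r = r / 2) ?gtr0_norm //; field.
- by rewrite -E; exact: nr_Re.
- by rewrite -E; exact: nr_Im.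
Qed.

Lemma boundary_lt k p q : (p <= 2 ^ k)%N -> (q <= 2 ^ k)%N -> nr (pt z0 (r / (2 ^ k)%:R) p q) < r.
Proof.
move=> pk qk; apply: in_square_disc.
rewrite -{1}(divfK (pow2_neq0 k) r); apply: in_square_pt => //.
by rewrite divr_ge0 // ltW.
Qed.

(** Near [w] the differential bounds the quotient, at distance at least [d] the bound is 2B/d, and
    at [w] itself the value is 0 by the convention on division. *)
Lemma quotient_bound w : nr w < r -> exists2 Bg : R, 0 < Bg &
  forall z, nr z < r -> nr ((f z - f w) / (z - w)) <= Bg.
Proof.
move=> wr; have [K K0 hK] := diff_bound (df wr).
have [d d0 hd] := diff_elim (df wr) ltr01.
exists (K + 1 + 2 * B / d); first by rewrite ltr_wpDr ?addr_gt0 // divr_ge0 ?mulr_ge0 // ltW.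
move=> z zr; have Bd : 0 <= 2 * B / d by rewrite divr_ge0 ?mulr_ge0 // ltW.
have [->|zw] := eqVneq z w; first by rewrite subrr mul0r nr0; lra.
have zw0 : 0 < nr (z - w) by rewrite nr_gt0 subr_eq0.
rewrite nrM nrV ler_pdivrMr //.
have [/hd|dz] := ltP (nr (z - w)) d.
  rewrite [w + _]addrC subrK mul1r => h; have := hK (z - w).
  have := nrD (f z - f w - 'd f w (z - w)) ('d f w (z - w)); rewrite subrK; nra.
have := nrB (f z) (f w); have := fB zr; have := fB wr => b1 b2 b3.
apply: (@le_trans _ _ (2 * B)); first lra.
apply: (@le_trans _ _ (2 * B / d * nr (z - w))); last by nra.
by rewrite mulrAC ler_pdivlMr // ler_wpM2l // mulr_ge0.
Qed.

(* Goursat's lemma controls the small squares which miss [w]; the others are at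
   most four, and the quotient is bounded on them. *)
Lemma cauchy_quotient w : nr w < r -> forall e : R, 0 < e -> exists K, forall k, (K <= k)%N ->
  nr (cmu k (fun z => (f z - f w) / (z - w))) <= e.
Proof.
move=> wr e e0; pose g (z : C) := (f z - f w) / (z - w); rewrite -/g.
have [Bg Bg0 hB] := quotient_bound wr.
(* The squares containing [w] have total weight at most 4 and contribute at most 4 h Bg each, with h
   = r / 2^j; so 16 h Bg should be at most e/2. *)
have q0 : 0 < e / (32 * r * Bg) by rewrite divr_gt0 // !mulr_gt0.
have q1 : 0 <= (1 / 2 : R) < 1 by apply/andP; split; lra.
have [j hj] := pow_small q1 q0.
have {hj} := hj j (leqnn _); rewrite ler_pdivlMr ?mulr_gt0 // => hj.
pose J := (2 ^ j)%N; pose h := r / J%:R.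
have J0 : 0 < J%:R :> R by exact: pow2_gt0.
have h0 : 0 < h by rewrite divr_gt0.
have hb : 0 < 4 * h * Bg by apply: mulr_gt0 => //; apply: mulr_gt0.
have [u [u0 u1 u2]] := interval_weight ((ReC w - ReC z0) / h).
have [v [v0 v1 v2]] := interval_weight ((ImC w - ImC z0) / h).
have sub (a b : 'I_J) z : in_square (pt z0 h a b) h z -> in_square z0 r z.
  have rE : r = h * J%:R by rewrite /h divfK // lt0r_neq0.
  rewrite rE; apply: in_square_trans; first exact: in_square_pt (ltW h0) (ltnW (ltn_ord a)) (ltnW (ltn_ord b)).
  have -> : pt z0 h a b + (rC h + ii * rC h) = pt z0 h a.+1 b.+1.
    by rewrite /pt -[a.+1%:R]natr1 -[b.+1%:R]natr1 !mulrDr !mulr1 !rCD; ring.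
  exact: in_square_pt (ltW h0) (ltn_ord a) (ltn_ord b).
(* One bound for both kinds of squares: a square missing [w] gets its share of e/2 by Goursat, one
   containing [w] has weight [u a * v b] at least 1. *)
have key (ab : 'I_J * 'I_J) : exists K, forall k, (K <= k)%N ->
    nr (mu (2 ^ k) g (pt z0 h ab.1 ab.2) (h / (2 ^ k)%:R)) <=
      e / 2 / J%:R ^+ 2 + u ab.1 * v ab.2 * (4 * h * Bg).
  have P0 : 0 < e / 2 / J%:R ^+ 2 by rewrite !divr_gt0 // exprn_gt0.
  case: ab => a b /=.
  have [iw|niw] := pselect (in_square (pt z0 h a b) h w).
    exists 0%N => k _.
    have sN : h / (2 ^ k)%:R * (2 ^ k)%:R = h by rewrite divfK // pow2_neq0.
    have s0 : 0 <= h / (2 ^ k)%:R by rewrite divr_ge0 // ltW.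
    apply: (@le_trans _ _ (4 * h * Bg)).
      rewrite -{3}sN; apply: mu_bound => // p q pk qk _; apply: hB; apply: in_square_disc.
      by apply: (sub a b); rewrite -{2}sN; exact: in_square_pt.
    have [i1 i2 i3 i4] := iw; rewrite Re_pt Im_pt in i1 i2 i3 i4.
    have ua : 1 <= u a.
      by apply: u1; rewrite ler_pdivlMr // ler_pdivrMr //; apply/andP; split; lra.
    have vb : 1 <= v b.
      by apply: v1; rewrite ler_pdivlMr // ler_pdivrMr //; apply/andP; split; lra.
    have uv : 1 <= u a * v b by nra.
    nra.
  have [|K hK] := goursat h0 _ P0 (f := g) (z := pt z0 h a b).
    move=> z iz; have zw : z - w != 0.
      by rewrite subr_eq0; apply/eqP => zw; apply: niw; rewrite -zw.
    have dz := df (in_square_disc (sub _ _ _ iz)).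
    apply: differentiableM; first exact: differentiableB.
    by apply: differentiableV => //; exact: differentiableB.
  exists K => k /hK /le_trans; apply; rewrite lerDl.
  exact: mulr_ge0 (mulr_ge0 (u0 _) (v0 _)) (ltW hb).
have [K hK] := choice key.
exists (j + \max_ab K ab)%N => k kK.
have -> : k = (j + (k - j))%N by rewrite subnKC // (leq_trans (leq_addr _ _) kK).
set k' := (k - j)%N; have k'K : (\max_ab K ab <= k')%N by rewrite leq_subRL // (leq_trans (leq_addr _ _) kK).
rewrite expnD mu_split.
have E a b : pt z0 (r / (2 ^ j * 2 ^ k')%:R) (a * 2 ^ k') (b * 2 ^ k') = pt z0 h a b.
  have k0 := pow2_neq0 k'; have J1 := lt0r_neq0 J0; rewrite /J in J1.
  by rewrite /pt /h /J; congr (_ + rC _ + ii * rC _); rewrite !natrM; field; rewrite k0 J1.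
have E2 : r / (2 ^ j * 2 ^ k')%:R = h / (2 ^ k')%:R.
  by rewrite natrM invfM mulrA.
apply: le_trans (nr_sum _ _ _) _.
apply: (@le_trans _ _ (\sum_(a < J) \sum_(b < J) (e / 2 / J%:R ^+ 2 + u a * v b * (4 * h * Bg)))).
  apply: ler_sum => a _; apply: le_trans (nr_sum _ _ _) _; apply: ler_sum => b _.
  rewrite E E2; apply: (hK (a, b)); apply: leq_trans k'K.
  exact: (leq_bigmax (a, b)).
rewrite (eq_bigr (fun a : 'I_J => e / 2 / J%:R + u a * (\sum_(b < J) v b) * (4 * h * Bg))); last first.
  move=> a _; rewrite big_split /= sumr_const card_ord -mulr_suml -mulr_sumr; congr (_ + _).
  by rewrite -mulr_natr; field; rewrite lt0r_neq0.
rewrite big_split /= sumr_const card_ord -!mulr_suml.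
have -> : e / 2 / J%:R *+ J = e / 2 by rewrite -mulr_natr divfK // lt0r_neq0.
have hE : h = r * (1 / 2) ^+ j by rewrite /h /J natrX expr_div_n expr1n mul1r.
have su : 0 <= \sum_(a < J) u a by apply: sumr_ge0.
have sv : 0 <= \sum_(b < J) v b by apply: sumr_ge0.
have ss : (\sum_(a < J) u a) * (\sum_(b < J) v b) <= 4 by have := u2 J; have := v2 J; nra.
have : (\sum_(a < J) u a) * (\sum_(b < J) v b) * (4 * h * Bg) <= 4 * (4 * h * Bg).
  exact: ler_wpM2r (ltW hb) _ _ ss.
by rewrite hE; lra.
Qed.
End Cauchy.

Section InvPow.
Variable R : realType.
Local Notation C := (cplx R).
Local Notation ii := (ic R).
Local Notation ReC z := (complex.Re (z : R[i])).
Local Notation ImC z := (complex.Im (z : R[i])).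

(** Second-order Taylor bound for z^(-l), uniform away from 0 so that it can be summed along the
    boundary. The induction uses only the exact increment of 1/z. *)
Lemma inv_pow_taylor (rho : R) l : 0 < rho -> exists2 K : R, 0 <= K &
  forall z v : C, rho <= nr z -> rho <= nr (z + v) ->
    nr ((z + v)^-1 ^+ l - z^-1 ^+ l + l%:R * v * z^-1 ^+ l.+1) <= K * nr v ^+ 2.
Proof.
move=> r0; elim: l => [|l [K K0 hK]].
  by exists 0 => // z v _ _; rewrite !expr0 subrr !mul0r addr0 nr0.
exists (K / rho + l.+1%:R * (rho^-1 ^+ l.+3)).
  have ri := ltW r0.
  by apply: addr_ge0; [exact: divr_ge0|apply: mulr_ge0 => //; rewrite exprn_ge0 // invr_ge0].
move=> z v zr zvr.
have z0 : z != 0 by rewrite -nr_gt0 (lt_le_trans r0).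
have zv0 : z + v != 0 by rewrite -nr_gt0 (lt_le_trans r0).
have -> : (z + v)^-1 ^+ l.+1 - z^-1 ^+ l.+1 + l.+1%:R * v * z^-1 ^+ l.+2 =
  (z + v)^-1 * ((z + v)^-1 ^+ l - z^-1 ^+ l + l%:R * v * z^-1 ^+ l.+1) +
  l.+1%:R * v ^+ 2 * (z^-1 ^+ l.+2 * (z + v)^-1).
  have E : v * z^-1 * (z + v)^-1 - (z^-1 - (z + v)^-1) = 0 by field; rewrite z0 zv0.
  rewrite -[l.+1%:R]natr1 !exprS expr0 mulr1.
  move: (z^-1 ^+ l) ((z + v)^-1 ^+ l) => a b.
  (* The last summand is a multiple of the relation [E], the only fact on inverses that is used; the
     rest is a polynomial identity. *)
  transitivity ((z + v)^-1 * (b - a + l%:R * v * (z^-1 * a)) +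
    (l%:R + 1) * (v * v) * (z^-1 * (z^-1 * a) * (z + v)^-1) +
    (v * z^-1 * (z + v)^-1 - (z^-1 - (z + v)^-1)) * (a * (1 - (l%:R + 1) * v * z^-1)) : C); first by ring.
  by rewrite E mul0r addr0.
apply: le_trans (nrD _ _) _; rewrite mulrDl; apply: lerD.
  rewrite nrM nrV mulrC [leRHS]mulrAC; apply: ler_pM; rewrite ?invr_ge0 ?nr_ge0 //; first exact: hK.
  by rewrite lef_pV2 // posrE (lt_le_trans r0).
rewrite (nrM (l.+1%:R * v ^+ 2)) (nrM l.+1%:R) (nrM (z^-1 ^+ l.+2)) !nrX !nrV -rCn nr_rC ger0_norm //.
rewrite [leRHS]mulrAC; apply: ler_wpM2l; first by rewrite mulr_ge0 ?sqr_ge0.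
have h1 : (nr z)^-1 <= rho^-1 by rewrite lef_pV2 // posrE (lt_le_trans r0).
have h2 : (nr (z + v))^-1 <= rho^-1 by rewrite lef_pV2 // posrE (lt_le_trans r0).
rewrite [leRHS]exprSr; apply: ler_pM; rewrite ?exprn_ge0 ?invr_ge0 ?nr_ge0 //.
by rewrite lerXn2r // nnegrE invr_ge0 ?nr_ge0 // ltW.
Qed.

Variable r : R.
Hypothesis r0 : 0 < r.
Let z0 : C := - (rC (r / 2) + ii * rC (r / 2)).
Local Notation "'cmu' k g" := (mu (2 ^ k) g z0 (r / (2 ^ k)%:R)) (at level 10, k, g at next level).

(* Up to second order terms, [l / z ^ l.+1] is the increment of [- 1 / z ^ l], which telescopes. *)
Lemma mu_inv_pow l : (0 < l)%N -> forall e : R, 0 < e -> exists K, forall k, (K <= k)%N ->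
  nr (cmu k (fun z => z^-1 ^+ l.+1)) <= e.
Proof.
move=> l0 e e0.
have [D D0 hD] := inv_pow_taylor l (divr_gt0 r0 (ltr0n _ 2)).
(* N summands of size 4 D s^2 with s N = r add up to 4 D r s = 4 D r^2 / 2^k. *)
have P0 : 0 < 4 * D * r ^+ 2 + 1 by rewrite ltr_wpDl // mulr_ge0 ?sqr_ge0 // mulr_ge0.
have q0 : 0 < e / (4 * D * r ^+ 2 + 1) by rewrite divr_gt0.
have q1 : 0 <= (1 / 2 : R) < 1 by apply/andP; split; lra.
have [K hK] := pow_small q1 q0; exists K => k /hK {hK}.
rewrite ler_pdivlMr //.
move=> hk; set N := (2 ^ k)%N; set s := r / N%:R.
have N0 : 0 < N%:R :> R by exact: pow2_gt0.
have s0 : 0 <= s by rewrite divr_ge0 // ltW.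
have sE : s = r * (1 / 2) ^+ k by rewrite /s /N natrX expr_div_n expr1n mul1r.
have sN : s * N%:R = r by rewrite /s divfK // lt0r_neq0.
have bd := @boundary_ge R r r0 k; rewrite -/z0 -/N -/s in bd.
clearbody s N.
pose F (z : C) := z^-1 ^+ l.
pose E (z v : C) := (z + v)^-1 ^+ l - z^-1 ^+ l + l%:R * v * z^-1 ^+ l.+1.
have tel (G : nat -> C) : \sum_(p < N) (G p.+1 - G p) = G N - G 0%N.
  by rewrite -(big_mkord xpredT (fun p => G p.+1 - G p)) telescope_sumr.
have H p : pt z0 s p.+1 0 = pt z0 s p 0 + rC s.
  by rewrite /pt -[p.+1%:R]natr1 mulrDr mulr1 rCD; ring.
have H' p : pt z0 s p.+1 N = pt z0 s p N + rC s.
  by rewrite /pt -[p.+1%:R]natr1 mulrDr mulr1 rCD; ring.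
have V p : pt z0 s 0 p.+1 = pt z0 s 0 p + ii * rC s.
  by rewrite /pt -[p.+1%:R]natr1 mulrDr mulr1 rCD; ring.
have V' p : pt z0 s N p.+1 = pt z0 s N p + ii * rC s.
  by rewrite /pt -[p.+1%:R]natr1 mulrDr mulr1 rCD; ring.
have key : l%:R * mu N (fun z => z^-1 ^+ l.+1) z0 s =
    \sum_(p < N) (E (pt z0 s p 0) (rC s) + E (pt z0 s N p) (ii * rC s) - E (pt z0 s p N) (rC s) - E (pt z0 s 0 p) (ii * rC s)).
  pose G p := F (pt z0 s p 0) + F (pt z0 s N p) - F (pt z0 s p N) - F (pt z0 s 0 p).
  have T : \sum_(p < N) (G p.+1 - G p) = 0 by rewrite tel /G; ring.
  transitivity (l%:R * mu N (fun z => z^-1 ^+ l.+1) z0 s + \sum_(p < N) (G p.+1 - G p)); first by rewrite T addr0.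
  rewrite /mu mulrA mulr_sumr -big_split; apply: eq_bigr => p _ /=.
  by rewrite /G H H' V V' /E /F; ring.
have Eb z v : r / 2 <= nr z -> r / 2 <= nr (z + v) -> nr v = s -> nr (E z v) <= D * s ^+ 2.
  by move=> h1 h2 hv; apply: le_trans (hD _ _ h1 h2) _; rewrite hv.
have nis : nr (ii * rC s) = s by rewrite nrM nr_ic nr_rC mul1r ger0_norm.
have ns : nr (rC s) = s by rewrite nr_rC ger0_norm.
have hl : nr (l%:R * mu N (fun z => z^-1 ^+ l.+1) z0 s) <= e.
  rewrite key; apply: le_trans (nr_sum _ _ _) _.
  apply: (@le_trans _ _ (\sum_(p < N) 4 * (D * s ^+ 2))).
    apply: ler_sum => p _.
    have e1 : nr (E (pt z0 s p 0) (rC s)) <= D * s ^+ 2.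
      by apply: Eb => //; rewrite -?H; apply: bd => //; rewrite ?eqxx ?orbT // ltnW.
    have e2 : nr (E (pt z0 s N p) (ii * rC s)) <= D * s ^+ 2.
      by apply: Eb => //; rewrite -?V'; apply: bd => //; rewrite ?eqxx ?orbT // ltnW.
    have e3 : nr (E (pt z0 s p N) (rC s)) <= D * s ^+ 2.
      by apply: Eb => //; rewrite -?H'; apply: bd => //; rewrite ?eqxx ?orbT // ltnW.
    have e4 : nr (E (pt z0 s 0 p) (ii * rC s)) <= D * s ^+ 2.
      by apply: Eb => //; rewrite -?V; apply: bd => //; rewrite ?eqxx ?orbT // ltnW.
    move: e1 e2 e3 e4; set a := E _ _; set b := E _ _; set c := E _ _; set d := E _ _.
    clearbody a b c d; have := nrB (a + b - c) d; have := nrB (a + b) c; have := nrD a b; lra.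
  rewrite sumr_const card_ord -[_ *+ N]mulr_natr.
  have -> : 4 * (D * s ^+ 2) * N%:R = 4 * D * r * s by rewrite -sN; ring.
  rewrite sE; have := exprn_ge0 k (ltac:(lra) : 0 <= 1 / 2 :> R) => h2; nra.
apply: le_trans hl; rewrite nrM -rCn nr_rC ger0_norm //.
by rewrite ler_peMl ?nr_ge0 // ler1n.
Qed.

Lemma Re_inv (z : C) : ReC z^-1 = ReC z / nr z ^+ 2.
Proof. by rewrite nr_sq; case: z. Qed.
Lemma Im_inv (z : C) : ImC z^-1 = - (ImC z / nr z ^+ 2).
Proof. by rewrite nr_sq; case: z. Qed.

(** The limit is 2 pi i, but a lower bound is enough. On the boundary |z|^2 is at most r^2/2, so
    each side contributes at least 1/r per node to the imaginary part. *)
Lemma mu_inv k : 4 <= nr (cmu k (fun z => z^-1 ^+ 1)).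
Proof.
apply: le_trans (nr_Im _); apply: le_trans (ler_norm _).
set N := (2 ^ k)%N; set s := r / N%:R.
have N0 : 0 < N%:R :> R by exact: pow2_gt0.
have s0 : 0 <= s by rewrite divr_ge0 // ltW.
have sN : s * N%:R = r by rewrite /s divfK // lt0r_neq0.
rewrite /mu ImM Re_rC Im_rC mul0r addr0.
have -> : 4 = s * \sum_(p < N) (4 / r).
  by rewrite sumr_const card_ord -[_ *+ N]mulr_natr mulrA mulrAC sN mulrC divfK // lt0r_neq0.
rewrite ler_wpM2l // (_ : ImC (\sum_(p < N) _) = \sum_(p < N) ImC ((pt z0 s p 0)^-1 ^+ 1 + ii * (pt z0 s N p)^-1 ^+ 1 -
  (pt z0 s p N)^-1 ^+ 1 - ii * (pt z0 s 0 p)^-1 ^+ 1)); last first.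
  by apply: (big_morph (fun z : C => ImC z)) => // x y; exact: ImD.
have Im4 (a b c d : C) : ImC (a + ii * b - c - ii * d) = ImC a + ReC b - ImC c - ReC d.
  by rewrite !ReImE; ring.
apply: ler_sum => p _; rewrite Im4 !expr1 !Re_inv !Im_inv.
have q (z : C) : ReC z ^+ 2 <= (r / 2) ^+ 2 -> ImC z ^+ 2 <= (r / 2) ^+ 2 -> r / 2 <= nr z -> r^-1 <= r / 2 / nr z ^+ 2.
  move=> a b c; have n0 : 0 < nr z ^+ 2 by rewrite exprn_gt0 // (lt_le_trans _ c) // divr_gt0.
  rewrite ler_pdivlMr // ler_pdivrMl // nr_sq; nra.
have zr : ReC z0 = - (r / 2) by rewrite /z0 !ReImE; ring.
have zi : ImC z0 = - (r / 2) by rewrite /z0 !ReImE; ring.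
have in_sq u v : (u <= N)%N -> (v <= N)%N -> [/\ ReC (pt z0 s u v) ^+ 2 <= (r / 2) ^+ 2 & ImC (pt z0 s u v) ^+ 2 <= (r / 2) ^+ 2].
  move=> uN vN; have [] := in_square_pt z0 s0 uN vN; rewrite sN zr zi.
  move: (ReC (pt z0 s u v)) (ImC (pt z0 s u v)) => x y ? ? ? ?; split; nra.
have bd := boundary_ge r0; rewrite -/z0 in bd.
have pN := ltnW (ltn_ord p).
have [a1 b1] := in_sq p 0%N pN (leq0n _). have [a2 b2] := in_sq N p (leqnn _) pN.
have [a3 b3] := in_sq p N pN (leqnn _). have [a4 b4] := in_sq 0%N p (leq0n _) pN.
have q1 := q _ a1 b1 (bd k p 0%N pN (leq0n _) ltac:(by rewrite eqxx !orbT)).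
have q2 := q _ a2 b2 (bd k N p (leqnn _) pN ltac:(by rewrite eqxx !orbT)).
have q3 := q _ a3 b3 (bd k p N pN (leqnn _) ltac:(by rewrite eqxx !orbT)).
have q4 := q _ a4 b4 (bd k 0%N p (leq0n _) pN ltac:(by rewrite eqxx)).
have i1 : ImC (pt z0 s p 0) = - (r / 2) by rewrite Im_pt zi; ring.
have i3 : ImC (pt z0 s p N) = r / 2.
  by rewrite Im_pt sN zi; field.
have r4 : ReC (pt z0 s 0 p) = - (r / 2) by rewrite Re_pt zr; ring.
have r2 : ReC (pt z0 s N p) = r / 2.
  by rewrite Re_pt sN zr; field.
rewrite i1 i3 r4 r2 !mulNr; lra.
Qed.
End InvPow.

(** * Limits of sequences and Taylor expansion in one variable *)

Section Tendsto.
Variable R : realType.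
Local Notation C := (cplx R).

Lemma tendsto_cst (V : normedModType C) (z : V) : tendsto (fun=> z) z.
Proof. by move=> e e0; exists 0%N => k _; rewrite subrr nr0 ltW. Qed.
Lemma tendstoD (V : normedModType C) (u v : nat -> V) a b :
  tendsto u a -> tendsto v b -> tendsto (fun k => u k + v k) (a + b).
Proof.
move=> ha hb e e0; have [K hK] := ha (e / 2) ltac:(lra); have [K' hK'] := hb (e / 2) ltac:(lra).
exists (maxn K K') => k; rewrite geq_max => /andP[/hK h /hK' h'].
by rewrite opprD addrACA; apply: le_trans (nrD _ _) _; lra.
Qed.
Lemma tendstoZ (V : normedModType C) (u : nat -> V) a (c : C) :
  tendsto u a -> tendsto (fun k => c *: u k) (c *: a).
Proof.
move=> ha e e0; have c0 := nr_ge0 c.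
have [K hK] := ha (e / (nr c + 1)) ltac:(by rewrite divr_gt0 // ltr_wpDl).
exists K => k /hK; rewrite -scalerBr nrZ ler_pdivlMr ?ltr_wpDl // => h.
by have := nr_ge0 (u k - a); nra.
Qed.
Lemma tendsto_sum (V : normedModType C) (I : Type) (s : seq I) (u : I -> nat -> V) (a : I -> V) :
  (forall j, tendsto (u j) (a j)) -> tendsto (fun k => \sum_(j <- s) u j k) (\sum_(j <- s) a j).
Proof.
move=> h; elim: s => [|j s ih].
  rewrite big_nil (_ : (fun k => _) = fun=> 0); first exact: tendsto_cst.
  by rewrite funeqE => k; rewrite big_nil.
rewrite big_cons (_ : (fun k => _) = fun k => u j k + \sum_(j <- s) u j k); first exact: tendstoD.
by rewrite funeqE => k; rewrite big_cons.
Qed.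
Lemma eventually_all (I : finType) (P : I -> nat -> Prop) :
  (forall j, exists K, forall k, (K <= k)%N -> P j k) -> exists K, forall k, (K <= k)%N -> forall j, P j k.
Proof.
move=> /choice[K hK]; exists (\max_j K j)%N => k kK j; apply: hK; apply: leq_trans kK.
exact: (leq_bigmax j).
Qed.

(* The approximate Taylor coefficients given by finite Riemann sums converge,
   because an expansion with such remainders determines its coefficients. *)
Lemma taylor_cauchy (F : C -> C) (c : nat -> nat -> C) (rho A sig : R) :
  0 < rho -> 0 <= A -> 0 <= sig ->
  (forall m w, nr w <= rho -> forall e : R, 0 < e -> exists K, forall k, (K <= k)%N ->
     nr (F w - \sum_(l < m) c k l * w ^+ l) <= A * (nr w * sig) ^+ m + e) ->
  forall l, exists z, tendsto (fun k => c k l) z.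
Proof.
move=> r0 A0 s0 H l; apply: C_cauchy; move: l.
elim/ltn_ind => l ih e e0.
pose D := 2 * A * sig ^+ l.+1 + 1.
have D0 : 0 < D by rewrite /D ltr_wpDl // !mulr_ge0 // exprn_ge0.
(* Compare two expansions at the point [x] after division by x^l: the remainders cost e/2, the lower
   coefficients e/4 by induction, and the two errors e/8 each. *)
pose x := Num.min rho (e / 2 / D).
have x0 : 0 < x by rewrite lt_min r0 !divr_gt0.
have xr : x <= rho by rewrite ge_min lexx.
have xD : x * D <= e / 2 by rewrite -ler_pdivlMr // ge_min lexx orbT.
have xl : 0 < x ^+ l by exact: exprn_gt0.
clearbody x.
have nx : nr (rC x) = x by rewrite nr_rC gtr0_norm.
have [||K hK] := H l.+1 (rC x) _ (e * x ^+ l / 8); first by rewrite nx.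
  by rewrite divr_gt0 // mulr_gt0.
have [K' hK'] : exists K', forall k k', (K' <= k)%N -> (K' <= k')%N -> forall i : 'I_l,
   nr (c k i - c k' i) <= e * x ^+ l / 4 / (\sum_(i < l) x ^+ i + 1).
  have S0 : 0 < \sum_(i < l) x ^+ i + 1.
    by rewrite ltr_wpDl // sumr_ge0 // => i _; rewrite exprn_ge0 // ltW.
  have P0 : 0 < e * x ^+ l / 4 / (\sum_(i < l) x ^+ i + 1) by rewrite !divr_gt0 // mulr_gt0.
  have [K' hK'] := choice (fun i : 'I_l => ih i (ltn_ord i) _ P0).
  exists (\max_i K' i)%N => k k' kK kK' i; apply: hK'.
    by apply: leq_trans kK; exact: (leq_bigmax i).
  by apply: leq_trans kK'; exact: (leq_bigmax i).
exists (maxn K K') => k k'; rewrite !geq_max => /andP[k1 k2] /andP[k1' k2'].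
have h1 := hK k k1; have h2 := hK k' k1'.
rewrite nx !big_ord_recr /= in h1 h2.
pose S1 : C := \sum_(i < l) c k i * rC x ^+ i; pose S2 : C := \sum_(i < l) c k' i * rC x ^+ i.
rewrite -/S1 in h1; rewrite -/S2 in h2.
have hS : nr (S1 - S2) <= e * x ^+ l / 4.
  rewrite /S1 /S2 -sumrB.
  have S0 : 0 < \sum_(i < l) x ^+ i + 1.
    by rewrite ltr_wpDl // sumr_ge0 // => i _; rewrite exprn_ge0 // ltW.
  apply: le_trans (nr_sum _ _ _) _.
  apply: (@le_trans _ _ (\sum_(i < l) e * x ^+ l / 4 / (\sum_(i < l) x ^+ i + 1) * x ^+ i)).
    apply: ler_sum => i _; rewrite -mulrBl nrM nrX nx.
    by rewrite ler_wpM2r ?exprn_ge0 ?(ltW x0) // hK'.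
  rewrite -mulr_sumr mulrAC ler_pdivrMr // ler_wpM2l ?lerDl //.
  by rewrite divr_ge0 // mulr_ge0 // ltW.
have hb : x ^+ l * nr (c k l - c k' l) <= x ^+ l * e.
  have -> : x ^+ l * nr (c k l - c k' l) = nr ((c k l - c k' l) * rC x ^+ l).
    by rewrite nrM nrX nx mulrC.
  have -> : (c k l - c k' l) * rC x ^+ l = (F (rC x) - (S2 + c k' l * rC x ^+ l)) -
     (F (rC x) - (S1 + c k l * rC x ^+ l)) - (S1 - S2) by ring.
  apply: le_trans (nrB _ _) _.
  have := nrB (F (rC x) - (S2 + c k' l * rC x ^+ l)) (F (rC x) - (S1 + c k l * rC x ^+ l)).
  have : 2 * (A * (x * sig) ^+ l.+1) <= x ^+ l * (e / 2).
    have -> : 2 * (A * (x * sig) ^+ l.+1) = x ^+ l * (x * (2 * A * sig ^+ l.+1)).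
      by rewrite exprMn [x ^+ l.+1]exprSr; ring.
    by rewrite ler_pM2l //; move: xD; rewrite /D; nra.
  lra.
by rewrite ler_pM2l in hb.
Qed.
End Tendsto.

Section Taylor.
Variable R : realType.
Local Notation C := (cplx R).
Local Notation ii := (ic R).
Variables (f : C -> C) (r B : R).
Hypothesis r0 : 0 < r.
Hypothesis df : forall z, nr z < r -> differentiable f z.
Hypothesis fB : forall z, nr z < r -> nr (f z) <= B.
Let z0 : C := - (rC (r / 2) + ii * rC (r / 2)).
Local Notation "'cmu' k g" := (mu (2 ^ k) g z0 (r / (2 ^ k)%:R)) (at level 10, k, g at next level).
Let J k := cmu k (fun z => z^-1 ^+ 1).
Let cf k l := cmu k (fun z => f z * z^-1 ^+ l.+1) / J k.

Let B0 : 0 <= B.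
Proof. by apply: le_trans (fB (z := 0) _); rewrite ?nr_ge0 // nr0. Qed.

Lemma geom_inv (z w : C) m : z != 0 -> z - w != 0 ->
  (z - w)^-1 = \sum_(l < m) w ^+ l * z^-1 ^+ l.+1 + w ^+ m * (z^-1 ^+ m / (z - w)).
Proof.
move=> z1 zw; elim: m => [|m ih]; first by rewrite big_ord0 !expr0 add0r !mul1r.
rewrite {1}ih big_ord_recr /= -addrA; congr (_ + _).
rewrite !exprSr; move: (w ^+ m) (z^-1 ^+ m) => a b; field; by rewrite zw z1.
Qed.

Lemma mu_le (k : nat) (g : C -> C) (D : R) :
  (forall z, nr z < r -> r / 2 <= nr z -> nr (g z) <= D) -> nr (cmu k g) <= 4 * r * D.
Proof.
move=> h; rewrite -{2}(divfK (pow2_neq0 R k) r); apply: mu_bound; first by rewrite divr_ge0 // ltW.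
by move=> p q pk qk pq; apply: h; [exact: boundary_lt|exact: boundary_ge].
Qed.

(** Cauchy's theorem for the difference quotient at [w], with 1/(z - w) expanded in powers of w/z.
    The pure powers z^(-l) with l at least 2 are negligible by [mu_inv_pow]; the remainder is
    geometric since |z| is at least r/2 on the contour. *)
Lemma cauchy_approx m w : nr w <= r / 4 -> forall e : R, 0 < e -> exists K, forall k, (K <= k)%N ->
  nr (f w - \sum_(l < m) cf k l * w ^+ l) <= 8 * B * (nr w * (2 / r)) ^+ m + e.
Proof.
move=> wr e e0; have r1 := r0; have B1 := B0; have wr' : nr w < r by lra.
case: m => [|m].
  by exists 0%N => k _; rewrite big_ord0 subr0 expr0 mulr1; have := fB wr'; lra.
pose S := \sum_(l < m) nr w ^+ l.+1.
have S0 : 0 <= S by apply: sumr_ge0 => i _; rewrite exprn_ge0 // nr_ge0.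
have BS : 0 < B * S + 1 by rewrite ltr_wpDl // mulr_ge0.
have [K1 h1] := cauchy_quotient r0 df fB wr' e0.
have [K2 h2] := eventually_all (fun l : 'I_m => mu_inv_pow r0 (ltn0Sn l) (divr_gt0 e0 BS)).
exists (maxn K1 K2) => k; rewrite geq_max => /andP[/h1 {}h1 /h2 {}h2].
rewrite -/z0 in h1 h2.
have J4 : 4 <= nr (J k) by exact: mu_inv.
have Jn0 : J k != 0 by rewrite -nr_gt0; lra.
pose rem z := (f z - f w) * (z^-1 ^+ m.+1 / (z - w)).
have E : cmu k (fun z => (f z - f w) / (z - w)) =
   \sum_(l < m.+1) (w ^+ l * (cf k l * J k) - f w * w ^+ l * cmu k (fun z => z^-1 ^+ l.+1)) + w ^+ m.+1 * cmu k rem.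
  transitivity (cmu k (fun z => \sum_(l < m.+1) (w ^+ l * (f z * z^-1 ^+ l.+1) + (- (f w * w ^+ l)) * z^-1 ^+ l.+1) + w ^+ m.+1 * rem z)).
    apply: mu_eq => p q pk qk pq.
    have z1 := boundary_ge r0 pk qk pq; rewrite -/z0 in z1.
    move: (pt _ _ _ _) z1 => z z1.
    have zn : z != 0 by rewrite -nr_gt0; lra.
    have zw : z - w != 0.
      by rewrite subr_eq0; apply/eqP => zw; rewrite zw in z1; lra.
    rewrite {1}(geom_inv m.+1 zn zw) mulrDr mulr_sumr; congr (_ + _); last by rewrite /rem; ring.
    by apply: eq_bigr => l _; ring.
  rewrite muD muZ mu_sum; congr (_ + _); apply: eq_bigr => l _.
  by rewrite muD !muZ mulNr /cf divfK.
have E2 : (f w - \sum_(l < m.+1) cf k l * w ^+ l) * J k =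
   w ^+ m.+1 * cmu k rem - f w * (\sum_(l < m) w ^+ l.+1 * cmu k (fun z => z^-1 ^+ l.+2)) -
   cmu k (fun z => (f z - f w) / (z - w)).
  rewrite E sumrB [X in _ - (_ - X + _)]big_ord_recl /= expr0 mulr1.
  have -> : \sum_(i < m) f w * w ^+ bump 0 i * cmu k (fun z => z^-1 ^+ (bump 0 i).+1) =
     f w * (\sum_(l < m) w ^+ l.+1 * cmu k (fun z => z^-1 ^+ l.+2)).
    by rewrite mulr_sumr; apply: eq_bigr => l _; rewrite mulrA.
  have -> : \sum_(i < m.+1) w ^+ i * (cf k i * J k) = (\sum_(l < m.+1) cf k l * w ^+ l) * J k.
    by rewrite mulr_suml; apply: eq_bigr => l _; ring.
  rewrite -/(J k).
  move: (\sum_(l < m.+1) _) (\sum_(l < m) _) (cmu k rem) (J k) => a b c d; ring.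
have b1 : nr (cmu k rem) <= 4 * r * (2 * B * ((2 / r) ^+ m.+1 * (4 / r))).
  apply: mu_le => z zr zr2; rewrite /rem nrM; apply: ler_pM; rewrite ?nr_ge0 //.
    by apply: le_trans (nrB _ _) _; have := fB zr; have := fB wr'; lra.
  rewrite nrM nrX !nrV; apply: ler_pM; rewrite ?invr_ge0 ?exprn_ge0 ?invr_ge0 ?nr_ge0 //.
    rewrite lerXn2r ?nnegrE ?invr_ge0 ?nr_ge0 // ?divr_ge0 // ?(ltW r0) //.
    rewrite -[2 / r]invf_div lef_pV2 // posrE; last by rewrite divr_gt0.
    by apply: lt_le_trans zr2; rewrite divr_gt0.
  have zw : r / 4 <= nr (z - w).
    have := nr_leB z w; lra.
  rewrite -[4 / r]invf_div lef_pV2 // posrE; last by rewrite divr_gt0.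
  by apply: lt_le_trans zw; rewrite divr_gt0.
have b2 : nr (f w * (\sum_(l < m) w ^+ l.+1 * cmu k (fun z => z^-1 ^+ l.+2))) <= e.
  rewrite nrM; apply: (@le_trans _ _ (B * (S * (e / (B * S + 1))))).
    apply: ler_pM; rewrite ?nr_ge0 //; first exact: fB.
    apply: le_trans (nr_sum _ _ _) _; rewrite /S mulr_suml; apply: ler_sum => l _.
    by rewrite nrM nrX ler_wpM2l ?exprn_ge0 ?nr_ge0 //; exact: h2.
  rewrite mulrA mulrA ler_pdivrMr // mulrC ler_wpM2l ?(ltW e0) // lerDl //.
set T := f w - _ in E2 *.
have hT : nr T * nr (J k) <= 4 * (8 * B * (nr w * (2 / r)) ^+ m.+1) + 2 * e.
  rewrite -nrM E2; apply: le_trans (nrB _ _) _.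
  have := nrB (w ^+ m.+1 * cmu k rem) (f w * (\sum_(l < m) w ^+ l.+1 * cmu k (fun z => z^-1 ^+ l.+2))).
  have : nr (w ^+ m.+1 * cmu k rem) <= 4 * (8 * B * (nr w * (2 / r)) ^+ m.+1).
    rewrite (nrM (w ^+ m.+1)) nrX.
    have -> : 4 * (8 * B * (nr w * (2 / r)) ^+ m.+1) = nr w ^+ m.+1 * (4 * r * (2 * B * ((2 / r) ^+ m.+1 * (4 / r)))).
      by rewrite exprMn; field; rewrite lt0r_neq0.
    by rewrite ler_wpM2l ?exprn_ge0 ?nr_ge0.
  lra.
have := nr_ge0 T; have : 0 <= 8 * B * (nr w * (2 / r)) ^+ m.+1.
  by rewrite mulr_ge0 ?mulr_ge0 // exprn_ge0 // mulr_ge0 ?nr_ge0 // divr_ge0 // ltW.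
nra.
Qed.

(** The coefficients are the limits of [cf k l], to which the bounds pass. For |w| at most r/4 the
    ratio |w| (2/r) is at most 1/2. *)
Theorem taylor_disc : exists c : nat -> C, (forall l, nr (c l) <= 2 * B * (2 / r) ^+ l) /\
  forall m w, nr w <= r / 4 -> nr (f w - \sum_(l < m) c l * w ^+ l) <= 8 * B * (nr w * (2 / r)) ^+ m.
Proof.
have s0 : 0 <= 2 / r by rewrite divr_ge0 // ltW.
have r4 : 0 < r / 4 by rewrite divr_gt0.
have B8 : 0 <= 8 * B by rewrite mulr_ge0.
have [c hc] := choice (taylor_cauchy r4 B8 s0 cauchy_approx).
exists c; split=> [l|m w wr].
  rewrite -[c l]subr0; apply: (tendsto_le (K := 0%N) (hc l)) => k _; rewrite subr0.
  have J4 : 4 <= nr (J k) by exact: mu_inv.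
  rewrite /cf nrM nrV ler_pdivrMr; last lra.
  apply: (@le_trans _ _ (4 * r * (B * (2 / r) ^+ l.+1))).
    apply: mu_le => z zr zr2; rewrite nrM nrX nrV ler_pM ?nr_ge0 ?exprn_ge0 ?invr_ge0 ?nr_ge0 ?fB //.
    rewrite lerXn2r ?nnegrE ?invr_ge0 ?nr_ge0 //.
    rewrite -[2 / r]invf_div lef_pV2 // posrE; last by rewrite divr_gt0.
    by apply: lt_le_trans zr2; rewrite divr_gt0.
  have -> : 4 * r * (B * (2 / r) ^+ l.+1) = 2 * B * (2 / r) ^+ l * 4.
    by rewrite exprSr; field; rewrite lt0r_neq0.
  by rewrite ler_wpM2l // mulr_ge0 ?exprn_ge0 // mulr_ge0.
apply/ler_addgt0Pr => e e0; have [K hK] := cauchy_approx m wr e0.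
have ht : tendsto (fun k => \sum_(l < m) cf k l * w ^+ l) (\sum_(l < m) c l * w ^+ l).
  apply: (@tendsto_sum R C) => l.
  have := tendstoZ (w ^+ l) (hc l).
  rewrite (_ : (fun k => _ *: _) = (fun k => cf k l * w ^+ l)); first by rewrite [_ *: _]mulrC.
  by rewrite funeqE => k; rewrite [_ *: _]mulrC.
rewrite nrBC; apply: (tendsto_le (K := K) ht) => k /hK; by rewrite nrBC.
Qed.
End Taylor.

(** * Holomorphic functions of several variables *)

Section DiffRules.
Variable R : realType.
Local Notation C := (cplx R).
Variable V : normedModType C.
Implicit Types (f g : V -> C) (p v : V).

Definition dd f p v : C := 'd f p v.

Lemma diff_sub f g p : differentiable f p -> differentiable g p ->
  differentiable (fun q => f q - g q) p /\ forall v, dd (fun q => f q - g q) p v = dd f p v - dd g p v.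
Proof.
move=> df dg; split; first exact: (differentiableB df dg).
move=> v. have E := diffB df dg.
exact: (congr1 (fun F : V -> C => F v) E).
Qed.
Lemma diff_add f g p : differentiable f p -> differentiable g p ->
  differentiable (fun q => f q + g q) p /\ forall v, dd (fun q => f q + g q) p v = dd f p v + dd g p v.
Proof.
move=> df dg; split; first exact: (differentiableD df dg).
by move=> v; exact: (congr1 (fun F : V -> C => F v) (diffD df dg)).
Qed.
Lemma diff_mul f g p : differentiable f p -> differentiable g p ->
  differentiable (fun q => f q * g q) p /\
  forall v, dd (fun q => f q * g q) p v = f p * dd g p v + g p * dd f p v.
Proof.
move=> df dg; split; first exact: (differentiableM df dg).
by move=> v; exact: (congr1 (fun F : V -> C => F v) (diffM df dg)).
Qed.
Lemma diff_const (c : C) p : differentiable (fun _ : V => c) p /\ forall v, dd (fun _ : V => c) p v = 0.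
Proof.
split; first exact: differentiable_cst.
by move=> v; exact: (congr1 (fun F : V -> C => F v) (diff_cst (c : C) p)).
Qed.
Lemma diff_scal (c : C) f p : differentiable f p ->
  differentiable (fun q => c * f q) p /\ forall v, dd (fun q => c * f q) p v = c * dd f p v.
Proof.
move=> df; have [dc cE] := diff_const c p.
have [h1 h2] := diff_mul dc df; split; first exact: h1.
by move=> v; rewrite h2 cE mulr0 addr0.
Qed.
Lemma diff_inv f p : differentiable f p -> f p != 0 ->
  differentiable (fun q => (f q)^-1) p /\ forall v, dd (fun q => (f q)^-1) p v = - (f p)^-2 * dd f p v.
Proof.
move=> df f0; split; first exact: (differentiableV df f0).
by move=> v; have := congr1 (fun F : V -> C => F v) (diffV df f0).
Qed.
Lemma diff_big (I : Type) (s : seq I) (f : I -> V -> C) p : (forall j, differentiable (f j) p) ->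
  differentiable (fun q => \sum_(j <- s) f j q) p /\
  forall v, dd (fun q => \sum_(j <- s) f j q) p v = \sum_(j <- s) dd (f j) p v.
Proof.
move=> df; elim: s => [|j s [ih1 ih2]].
  rewrite (_ : (fun q => _) = fun=> 0); last by rewrite funeqE => q; rewrite big_nil.
  by have [h1 h2] := diff_const 0 p; split; [exact: h1|move=> v; rewrite h2 big_nil].
rewrite (_ : (fun q => _) = fun q => f j q + \sum_(j <- s) f j q); last by rewrite funeqE => q; rewrite big_cons.
by have [h1 h2] := diff_add (df j) ih1; split; [exact: h1|move=> v; rewrite h2 ih2 big_cons].
Qed.
End DiffRules.

Section Multi.
Variable R : realType.
Local Notation C := (cplx R).
Variable V : normedModType C.
Implicit Types (f : V -> C) (p q u v : V).

Lemma diff_line f p u (t : C) : differentiable f (p + t *: u) ->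
  differentiable (fun s : C => f (p + s *: u)) t /\ 'd (fun s : C => f (p + s *: u)) t 1 = 'd f (p + t *: u) u.
Proof.
move=> df.
have dl : is_diff t (fun s : C => p + s *: u) ( *:%R^~ u).
  have h : is_diff t (cst p + (fun s : C => s *: u)) (0 + *:%R^~ u) by exact: is_diffD.
  by apply: is_diff_eq h _; rewrite add0r.
have df' : differentiable f ((fun s : C => p + s *: u) t) by [].
split; first exact: (differentiable_comp (ex_diff (is_diff_def := dl)) df').
rewrite (_ : (fun s : C => f (p + s *: u)) = f \o (fun s : C => p + s *: u)) //.
rewrite (diff_comp (ex_diff (is_diff_def := dl)) df') /=.
by rewrite (diff_val (is_diff_def := dl)) scale1r.
Qed.

(** [taylor_disc] on the complex line through [p] in the direction [u]. The coefficient of order 1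
    is found by comparing the expansion with the differential at a small real point [x]. *)
Lemma line_taylor f p u (r B : R) : 0 < r -> nr u <= 1 ->
  (forall q, nr (q - p) < r -> differentiable f q) ->
  (forall q, nr (q - p) < r -> nr (f q) <= B) ->
  exists c : nat -> C, [/\ forall l, nr (c l) <= 2 * B * (2 / r) ^+ l, c 0%N = f p, c 1%N = 'd f p u &
   forall m (t : C), nr t <= r / 4 -> nr (f (p + t *: u) - \sum_(l < m) c l * t ^+ l) <= 8 * B * (nr t * (2 / r)) ^+ m].
Proof.
move=> r0 u1 df fB.
have inb (t : C) : nr t < r -> nr (p + t *: u - p) < r.
  move=> tr; rewrite addrC addKr nrZ; apply: le_lt_trans tr.
  by rewrite ler_piMr ?nr_ge0.
have dphi (t : C) : nr t < r -> differentiable (fun s : C => f (p + s *: u)) t.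
  by move=> /inb/df/diff_line[].
have Bphi (t : C) : nr t < r -> nr (f (p + t *: u)) <= B by move=> /inb/fB.
have [c [hc1 hc2]] := taylor_disc r0 dphi Bphi.
have r4 : 0 <= r / 4 by rewrite divr_ge0 // ltW.
have c0 : c 0%N = f p.
  apply/eqP; rewrite -subr_eq0 -nr_eq0 eq_le nr_ge0 andbT nrBC.
  have := hc2 1%N 0; rewrite nr0 => /(_ r4).
  by rewrite mul0r expr1 mulr0 scale0r addr0 big_ord_recl big_ord0 expr0 mulr1 addr0.
have c1 : c 1%N = 'd f p u.
  have dp : differentiable f (p + 0 *: u) by apply: df; rewrite scale0r addr0 subrr nr0.
  have [dphi0 dE] := diff_line dp; rewrite scale0r addr0 in dE; rewrite -dE.
  apply/eqP; rewrite -subr_eq0 -nr_eq0 eq_le nr_ge0 andbT.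
  apply/ler_addgt0Pr => e e0; rewrite add0r.
  have [d d0 hd] := diff_elim dphi0 (ltac:(lra) : 0 < e / 2).
  have B0 : 0 <= B by apply: le_trans (fB p _); rewrite ?nr_ge0 // subrr nr0.
  pose D := 8 * B * (2 / r) ^+ 2 + 1.
  have D0 : 0 < D by rewrite /D; pos.
  pose x := Num.min (r / 4) (Num.min (d / 2) (e / 2 / D)).
  have x0 : 0 < x by rewrite !lt_min !divr_gt0.
  have [xr xd xD] : [/\ x <= r / 4, x <= d / 2 & x * D <= e / 2].
    by rewrite -ler_pdivlMr // /x !ge_min !lexx !orbT.
  clearbody x; have nx : nr (rC x) = x by rewrite nr_rC gtr0_norm.
  have := hd (rC x); rewrite nx add0r scale0r addr0 => /(_ ltac:(lra)) h1.
  have := hc2 2%N (rC x); rewrite nx => /(_ xr); rewrite !big_ord_recr big_ord0 /= expr0 add0r mulr1 expr1 c0 => h2.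
  have dl : 'd (fun s : C => f (p + s *: u)) 0 (rC x) = 'd (fun s : C => f (p + s *: u)) 0 1 * rC x.
    by rewrite -{1}(mulr1 (rC x)) -[rC x * 1]/(rC x *: (1 : C)) linearZ /= mulrC.
  rewrite dl in h1; pose d1 : C := 'd (fun s : C => f (p + s *: u)) 0 1; rewrite -/d1 in h1 *.
  have : nr (c 1%N - d1) * x <= e * x.
    rewrite -nx -nrM mulrBl nx; move: h1 h2.
    move: (f (p + rC x *: u)) (f p) (c 1%N * rC x) (d1 * rC x) => a b k l h1 h2.
    have -> : k - l = (a - b - l) - (a - (b + k)) by ring.
    apply: le_trans (nrB _ _) _.
    have : 8 * B * (x * (2 / r)) ^+ 2 <= e / 2 * x.
      have -> : 8 * B * (x * (2 / r)) ^+ 2 = x * (x * (8 * B * (2 / r) ^+ 2)) by ring.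
      by rewrite [leRHS]mulrC ler_pM2l //; move: xD; rewrite /D; lra.
    lra.
  by rewrite ler_pM2r.
by exists c.
Qed.

(** This bound and the next depend on [f] only through [r] and [B], hence hold uniformly over
    families of functions. *)
Lemma cauchy_deriv f p (r B : R) : 0 < r ->
  (forall q, nr (q - p) < r -> differentiable f q) ->
  (forall q, nr (q - p) < r -> nr (f q) <= B) ->
  forall v, nr ('d f p v) <= 4 * B / r * nr v.
Proof.
move=> r0 df fB v.
have [->|v0] := eqVneq v 0; first by rewrite linear0 !nr0 mulr0.
have n0 : 0 < nr v by rewrite nr_gt0.
have u1 : nr ((rC (nr v))^-1 *: v) <= 1.
  by rewrite nrZ nrV nr_rC gtr0_norm // mulVf // lt0r_neq0.
have [c [hc _ c1 _]] := line_taylor r0 u1 df fB.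
have := hc 1%N; rewrite c1 linearZ /= nrZ nrV nr_rC gtr0_norm // ler_pdivrMl // expr1.
by move=> /le_trans; apply; rewrite le_eqVlt; apply/orP; left; apply/eqP; field; rewrite lt0r_neq0.
Qed.

Lemma cauchy_quad f p (r B : R) : 0 < r ->
  (forall q, nr (q - p) < r -> differentiable f q) ->
  (forall q, nr (q - p) < r -> nr (f q) <= B) ->
  forall v, nr v <= r / 4 -> nr (f (p + v) - f p - 'd f p v) <= 32 * B / r ^+ 2 * nr v ^+ 2.
Proof.
move=> r0 df fB v vr.
have [->|v0] := eqVneq v 0.
  by rewrite linear0 addr0 subrr subr0 !nr0 expr0n mulr0.
have n0 : 0 < nr v by rewrite nr_gt0.
have nn : nr (rC (nr v)) = nr v by rewrite nr_rC gtr0_norm.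
have nz : rC (nr v) != 0 by rewrite -nr_gt0 nn.
have u1 : nr ((rC (nr v))^-1 *: v) <= 1.
  by rewrite nrZ nrV nn mulVf // lt0r_neq0.
have [c [_ c0 c1 hc]] := line_taylor r0 u1 df fB.
have := hc 2%N (rC (nr v)); rewrite nn scalerA divff // scale1r => /(_ vr).
rewrite !big_ord_recr big_ord0 /= expr0 add0r mulr1 expr1 c0 c1 linearZ /=.
have -> : (rC (nr v))^-1 *: 'd f p v * rC (nr v) = 'd f p v by rewrite mulrC mulVKf.
rewrite opprD addrA => /le_trans; apply.
by rewrite le_eqVlt; apply/orP; left; apply/eqP; field; rewrite lt0r_neq0.
Qed.

Lemma linear_pack (L : V -> C) : linear L -> exists g : {linear V -> C}, forall v, g v = L v.
Proof.
move=> H; pose m := GRing.isLinear.Build C V C _ L H.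
pose g : {linear V -> C} := HB.pack L m.
by exists g.
Qed.

(** Weierstrass's theorem. [cauchy_deriv] on differences makes the differentials converge at each
    vector, and the bound of [cauchy_quad], uniform in [k], passes to the limit and gives
    differentiability. *)
Lemma diff_uniform_limit (fk : nat -> V -> C) f p (r : R) : 0 < r ->
  (forall k q, nr (q - p) < r -> differentiable (fk k) q) ->
  (forall e : R, 0 < e -> exists K, forall k, (K <= k)%N -> forall q, nr (q - p) < r -> nr (fk k q - f q) <= e) ->
  differentiable f p /\ forall v, tendsto (fun k => dd (fk k) p v) (dd f p v).
Proof.
move=> r0 dfk uc.
have pp : nr (p - p) < r by rewrite subrr nr0.
have /choice[L hL] : forall v, exists z, tendsto (fun k => 'd (fk k) p v) z.
  move=> v; apply: C_cauchy => e e0.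
  pose D := 8 / r * nr v + 1.
  have D0 : 0 < D by rewrite /D; pos.
  have [K hK] := uc (e / D) (divr_gt0 e0 D0).
  exists K => k l Kk Kl.
  have -> : 'd (fk k) p v - 'd (fk l) p v = dd (fun q => fk k q - fk l q) p v :> C.
    by rewrite (diff_sub (dfk k p pp) (dfk l p pp)).2.
  apply: le_trans (@cauchy_deriv _ p r (2 * (e / D)) r0 _ _ v) _.
  - by move=> q qr; exact: (diff_sub (dfk k q qr) (dfk l q qr)).1.
  - move=> q qr; have h1 := hK k Kk q qr; have h2 := hK l Kl q qr.
    have -> : fk k q - fk l q = (fk k q - f q) - (fk l q - f q) by rewrite opprB addrA subrK.
    by apply: le_trans (nrB _ _) _; lra.
  - have -> : 4 * (2 * (e / D)) / r * nr v = (e / D) * (8 / r * nr v) by ring.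
    by rewrite mulrAC ler_pdivrMr // ler_wpM2l ?(ltW e0) // /D lerDl.
have lL : linear L.
  move=> a u v; apply: (tendsto_uniq (hL _)).
  rewrite (_ : (fun k => _) = fun k => a *: 'd (fk k) p u + 'd (fk k) p v).
    by apply: tendstoD => //; exact: tendstoZ.
  by rewrite funeqE => k; rewrite linearP.
have [g hg] := linear_pack lL.
have [K hK] := uc 1 ltr01.
have [d d0 hd] := diff_cont (dfk K p pp) ltr01.
pose s := Num.min d r; have s0 : 0 < s by rewrite lt_min d0.
have [sd sr] : s <= d /\ s <= r by rewrite !ge_min !lexx orbT.
clearbody s.
pose B := nr (fk K p) + 3.
have Bk k : (K <= k)%N -> forall q, nr (q - p) < s -> nr (fk k q) <= B.
  move=> Kk q qs; have qr := lt_le_trans qs sr; have qd := lt_le_trans qs sd.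
  have h1 := hK k Kk q qr; have h2 := hK K (leqnn _) q qr.
  have := hd (q - p) qd; rewrite [p + _]addrC subrK => h3.
  have := nr_leB (fk k q) (fk K p); have := nr_dist (fk k q) (fk K q) (fk K p).
  have := nr_dist (fk k q) (f q) (fk K q); rewrite (nrBC (f q)) /B; lra.
have dk k q : nr (q - p) < s -> differentiable (fk k) q by move=> /lt_le_trans qs; apply: dfk; exact: qs.
have Lb v : nr (g v) <= 4 * B / s * nr v.
  rewrite -[g v]subr0 hg; apply: (tendsto_le (K := K) (hL v)) => k Kk; rewrite subr0.
  by apply: cauchy_deriv => //; [exact: dk|exact: Bk].
have tf q : nr (q - p) < r -> tendsto (fun k => fk k q) (f q).
  by move=> qr e e0; have [K' hK'] := uc e e0; exists K' => k Kk; exact: hK'.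
have Q v : nr v <= s / 4 -> nr (f (p + v) - f p - g v) <= 32 * B / s ^+ 2 * nr v ^+ 2.
  move=> vs; have vr : nr (p + v - p) < r by rewrite addrC addKr; lra.
  have T : tendsto (fun k => fk k (p + v) + (-1) *: fk k p + (-1) *: 'd (fk k) p v) (f (p + v) + (-1) *: f p + (-1) *: g v).
    apply: tendstoD; last by rewrite hg; exact: tendstoZ.
    by apply: tendstoD; [exact: tf|apply: tendstoZ; exact: tf].
  rewrite !scaleN1r in T; rewrite -[X in nr X]subr0; apply: (tendsto_le (K := K) T) => k Kk.
  rewrite subr0 !scaleN1r; apply: cauchy_quad => //; [exact: dk|exact: Bk].
have B0 : 0 <= B by rewrite /B; have := nr_ge0 (fk K p); lra.
have [|df dE] := @diff_intro R V C f p g _ Lb.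
  move=> e e0; pose D := 32 * B / s ^+ 2 + 1.
  have D0 : 0 < D by rewrite /D; pos.
  exists (Num.min (s / 4) (e / D)); first by rewrite lt_min !divr_gt0.
  move=> v; rewrite lt_min => /andP[vs ve]; apply: le_trans (Q v (ltW vs)) _.
  rewrite ltr_pdivlMr // in ve; have := nr_ge0 v => v0.
  have -> : 32 * B / s ^+ 2 * nr v ^+ 2 = (nr v * (D - 1)) * nr v by rewrite /D; ring.
  by rewrite ler_wpM2r //; move: ve; rewrite mulrBr; lra.
split; first exact: df.
move=> v; have E : L v = dd f p v.
  exact: etrans (esym (hg v)) (congr1 (fun F : V -> C => F v) (esym dE)).
by rewrite -E; exact: hL.
Qed.

(** Taylor coefficients in a parameter are holomorphic in the other variable: by induction, the k-th
    one is the locally uniform limit, as t tends to 0, of t^(-k) times [Phi t p] minus its Taylor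
    polynomial of lower order. *)
Lemma coef_family (Phi : C -> V -> C) (U : V -> Prop) (tau B : R) : 0 < tau -> 0 <= B ->
  (forall p, U p -> exists2 r : R, 0 < r & forall q, nr (q - p) < r -> U q) ->
  (forall t p, nr t < tau -> U p -> differentiable (Phi t) p) ->
  (forall t p, nr t < tau -> U p -> differentiable (fun s => Phi s p) t) ->
  (forall t p, nr t < tau -> U p -> nr (Phi t p) <= B) ->
  exists c : nat -> V -> C, [/\ forall k p, U p -> nr (c k p) <= 2 * B * (2 / tau) ^+ k,
    forall k p, U p -> differentiable (c k) p &
    forall p m t, U p -> nr t <= tau / 4 ->
      nr (Phi t p - \sum_(l < m) c l p * t ^+ l) <= 8 * B * (nr t * (2 / tau)) ^+ m].
Proof.
move=> t0 B0 oU dp dt bd.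
have /choice[c0 hc0] : forall p, exists c : nat -> C, U p ->
   (forall l, nr (c l) <= 2 * B * (2 / tau) ^+ l) /\
   forall m w, nr w <= tau / 4 -> nr (Phi w p - \sum_(l < m) c l * w ^+ l) <= 8 * B * (nr w * (2 / tau)) ^+ m.
  move=> p; have [Up|nUp] := pselect (U p); last by exists (fun=> 0).
  have [c hc] := taylor_disc t0 (fun z zt => dt z p zt Up) (fun z zt => bd z p zt Up).
  by exists c.
exists (fun k p => c0 p k); split=> [k p Up||p m t Up]; first by have [h _] := hc0 p Up; exact: h.
  elim/ltn_ind => k ih p Up; have [r r0 hr] := oU p Up.
  pose x j : R := tau / 4 * (1 / 2) ^+ j.
  have x0 j : 0 < x j by rewrite /x; pos.
  have xt j : x j <= tau / 4.
    by rewrite /x ler_piMr ?divr_ge0 // ?(ltW t0) // exprn_ile1 //; lra.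
  pose g j q := (rC (x j) ^+ k)^-1 * (Phi (rC (x j)) q - \sum_(l < k) c0 q l * rC (x j) ^+ l).
  have nx j : nr (rC (x j)) = x j by rewrite nr_rC gtr0_norm.
  have gE j q : U q -> nr (g j q - c0 q k) <= 8 * B * (2 / tau) ^+ k.+1 * x j.
    move=> Uq; have [_ h2] := hc0 q Uq.
    have := h2 k.+1 (rC (x j)); rewrite nx => /(_ (xt j)).
    rewrite big_ord_recr /= opprD addrA => h.
    have -> : g j q - c0 q k = (rC (x j) ^+ k)^-1 * (Phi (rC (x j)) q - \sum_(l < k) c0 q l * rC (x j) ^+ l - c0 q k * rC (x j) ^+ k).
      have xn : rC (x j) ^+ k != 0 by rewrite expf_neq0 // -nr_gt0 nx.
      rewrite /g [RHS]mulrBr [c0 q k * _]mulrC mulKf //.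
    rewrite nrM nrV nrX nx ler_pdivrMl ?exprn_gt0 //.
    apply: le_trans h _; rewrite le_eqVlt; apply/orP; left; apply/eqP.
    by rewrite exprMn [x j ^+ k.+1]exprSr; ring.
  apply: (@diff_uniform_limit g (c0^~ k) p r r0 _ _).1.
    move=> j q qr; have Uq := hr q qr.
    have xjt : nr (rC (x j)) < tau by rewrite nx; have := xt j; lra.
    have ds (l : 'I_k) : differentiable (fun q => c0 q l * rC (x j) ^+ l) q.
      exact: (diff_mul (ih l (ltn_ord l) q Uq) (diff_const _ _).1).1.
    exact: (diff_scal _ (diff_sub (dp _ _ xjt Uq) (diff_big _ ds).1).1).1.
  move=> e e0; pose D := 8 * B * (2 / tau) ^+ k.+1 * (tau / 4) + 1.
  have D0 : 0 < D by rewrite /D; pos.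
  have q1 : 0 <= (1 / 2 : R) < 1 by apply/andP; split; lra.
  have [K hK] := pow_small q1 (divr_gt0 e0 D0).
  exists K => j /hK; rewrite ler_pdivlMr // => hj q /hr/gE /le_trans; apply.
  have := exprn_ge0 j (ltac:(lra) : 0 <= 1 / 2 :> R) => h2.
  apply: le_trans hj; rewrite /D /x mulrDr mulr1.
  have -> : 8 * B * (2 / tau) ^+ k.+1 * (tau / 4 * (1 / 2) ^+ j) = (1 / 2) ^+ j * (8 * B * (2 / tau) ^+ k.+1 * (tau / 4)) by ring.
  by rewrite lerDl.
by have [_ h] := hc0 p Up; exact: h.
Qed.
End Multi.

Section Mx.
Variable R : realType.
Local Notation C := (cplx R).

Lemma finite_radius (I : finType) (V : normedModType C) (Q : I -> V -> Prop) :
  (forall j, exists2 d : R, 0 < d & forall v, nr v < d -> Q j v) ->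
  exists2 d : R, 0 < d & forall v, nr v < d -> forall j, Q j v.
Proof.
move=> H.
have /nbhs_nrP[d d0 hd] : \forall v \near (0 : V), forall j, Q j v.
  apply: filter_forall => j; apply/nbhs_nrP; have [d d0 hd] := H j.
  by exists d => // v; rewrite subr0 => /hd.
by exists d => // v vd; apply: hd; rewrite subr0.
Qed.

Lemma nr_lt_mx m n (x : 'M[C]_(m, n)) (e : R) : 0 < e -> (forall i j, nr (x i j) < e) -> nr x < e.
Proof.
move=> e0 h; suff : `|x| < rC e by rewrite rC_nr ltr_rC.
have : ball (0 : 'M[C]_(m, n)) (rC e) x.
  split=> [|i j]; first by rewrite -rC0 ltr_rC.
  by rewrite -ball_normE /= mxE sub0r normrN rC_nr ltr_rC.
by rewrite -ball_normE /= sub0r normrN.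
Qed.

Lemma nr_coord m n (x : 'M[C]_(m, n)) i j : nr (x i j) <= nr x.
Proof.
apply/ler_addgt0Pr => e e0; apply: ltW.
have : ball (0 : 'M[C]_(m, n)) (rC (nr x + e)) x.
  by rewrite -ball_normE /= sub0r normrN rC_nr ltr_rC ltrDl.
by case=> _ /(_ i j); rewrite -ball_normE /= mxE sub0r normrN rC_nr ltr_rC.
Qed.

Lemma nr_le_mx m n (x : 'M[C]_(m, n)) (e : R) : 0 <= e -> (forall i j, nr (x i j) <= e) -> nr x <= e.
Proof.
move=> e0 h; apply/ler_addgt0Pr => d d0; apply/ltW/nr_lt_mx; first exact: ltr_wpDl.
by move=> i j; apply: le_lt_trans (h i j) _; rewrite ltrDl.
Qed.

Variable V : normedModType C.

Lemma diff_mx m n (F : V -> 'M[C]_(m, n)) (p : V) :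
  (forall i j, differentiable (fun q => F q i j) p) ->
  differentiable F p /\ forall v i j, ('d F p v : 'M[C]_(m, n)) i j = dd (fun q => F q i j) p v.
Proof.
move=> df; pose L v : 'M[C]_(m, n) := \matrix_(i, j) dd (fun q => F q i j) p v.
have lL : linear L.
  by move=> a u v; apply/matrixP => i j; rewrite !mxE /dd linearP.
pose gm := GRing.isLinear.Build C V 'M[C]_(m, n) _ L lL.
pose g : {linear V -> 'M[C]_(m, n)} := HB.pack L gm.
have /choice[K hK] : forall ij : 'I_m * 'I_n, exists K : R, 0 < K /\ forall v, nr (dd (fun q => F q ij.1 ij.2) p v) <= K * nr v.
  by move=> [i j]; have [K K0 h] := diff_bound (df i j); exists K.
have Kb v : nr (g v) <= (\sum_ij K ij) * nr v.
  have K0 : 0 <= \sum_ij K ij by apply: sumr_ge0 => ij _; rewrite ltW //; have [] := hK ij.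
  apply: nr_le_mx => [|i j]; first by pos.
  rewrite /g /= mxE; have [_ h] := hK (i, j); apply: le_trans (h v) _.
  rewrite ler_wpM2r ?nr_ge0 // (bigD1 (i, j)) //= lerDl; apply: sumr_ge0 => ij _.
  by rewrite ltW //; have [] := hK ij.
have [|h1 h2] := @diff_intro R V 'M[C]_(m, n) F p g _ Kb.
  move=> e e0.
  have [ij|d d0 hd] := @finite_radius ('I_m * 'I_n)%type V (fun ij v => nr (F (p + v) ij.1 ij.2 - F p ij.1 ij.2 - dd (fun q => F q ij.1 ij.2) p v) <= e * nr v).
    by have [d d0 hd] := diff_elim (df ij.1 ij.2) e0; exists d.
  exists d => // v vd; apply: nr_le_mx => [|i j]; first by pos.
  by have := hd v vd (i, j); rewrite /g /= !mxE.
split; first exact: h1.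
move=> v i j; have E : 'd F p v = L v by exact: (congr1 (fun f : V -> 'M[C]_(m, n) => f v) h2).
by rewrite E mxE.
Qed.

Lemma diff_comp_dd (W : normedModType C) (f : W -> C) (g : V -> W) p :
  differentiable g p -> differentiable f (g p) ->
  differentiable (fun q => f (g q)) p /\ forall v, dd (fun q => f (g q)) p v = dd f (g p) ('d g p v).
Proof.
move=> dg df; split; first exact: (differentiable_comp dg df).
by move=> v; exact: (congr1 (fun h : V -> C => h v) (diff_comp dg df)).
Qed.
End Mx.

Section Mulmx.
Variable R : realType.
Local Notation C := (cplx R).

Lemma diff_coord m n (x : 'M[C]_(m, n)) i j :
  differentiable (fun y : 'M[C]_(m, n) => y i j) x /\ forall v, dd (fun y : 'M[C]_(m, n) => y i j) x v = v i j.
Proof.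
pose L (v : 'M[C]_(m, n)) : C := v i j.
have lL : linear L by move=> a u v; rewrite /L !mxE.
have [g hg] := linear_pack lL.
have [||h1 h2] := @diff_intro R 'M[C]_(m, n) C L x g 1.
- by move=> v; rewrite hg mul1r nr_coord.
- move=> e e0; exists 1 => // v _; rewrite hg /L mxE [x i j + _]addrC addrK subrr nr0.
  by pos.
split; first exact: h1.
by move=> v; apply: etrans (congr1 (fun f : 'M[C]_(m, n) -> C => f v) h2) (hg v).
Qed.

Lemma diff_affine m n (A : 'M[C]_(m, n)) (b : 'rV[C]_n) (x : 'rV[C]_m) :
  differentiable (fun y : 'rV[C]_m => y *m A + b) x /\ forall v, 'd (fun y : 'rV[C]_m => y *m A + b) x v = v *m A.
Proof.
have H i j : differentiable (fun y : 'rV[C]_m => (y *m A + b) i j) x /\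
   forall v, dd (fun y : 'rV[C]_m => (y *m A + b) i j) x v = (v *m A) i j.
  have -> : (fun y : 'rV[C]_m => (y *m A + b) i j) = (fun y => (\sum_k y i k * A k j) + b i j).
    by rewrite funeqE => y; rewrite !mxE.
  have ds k : differentiable (fun y : 'rV[C]_m => y i k * A k j) x /\
      forall v, dd (fun y : 'rV[C]_m => y i k * A k j) x v = v i k * A k j.
    have [h1 h2] := diff_mul (diff_coord x i k).1 (diff_const (A k j) x).1.
    split; first exact: h1.
    by move=> v; rewrite h2 (diff_const _ _).2 (diff_coord x i k).2 mulr0 add0r mulrC.
  have [s1 s2] := diff_big (index_enum 'I_m) (fun k => (ds k).1).
  have [h1 h2] := diff_add s1 (diff_const (b i j) x).1.
  split; first exact: h1.
  move=> v; rewrite h2 (diff_const _ _).2 addr0 s2 mxE.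
  by apply: eq_bigr => k _; rewrite (ds k).2.
have [h1 h2] := diff_mx (fun i j => (H i j).1).
split; first exact: h1.
by move=> v; apply/matrixP => i j; rewrite h2 (H i j).2.
Qed.
End Mulmx.

(** * Power series in several variables *)

Section PowerSeries.
Variable R : realType.
Local Notation C := (cplx R).

Definition mon n (a : 'I_n -> nat) (x : 'rV[C]_n) : C := \prod_i x 0 i ^+ a i.

(** Truncation keeps the exponents that are all less than [m], rather than bounding the total
    degree: a box is a product, so one variable can be split off. *)
Definition boxsum n m (c : ('I_n -> nat) -> C) (x : 'rV[C]_n) : C :=
  \sum_(a : {ffun 'I_n -> 'I_m}) c (fun i => val (a i)) * mon (fun i => val (a i)) x.

Definition fcons T n (k : T) (a : 'I_n -> T) (i : 'I_n.+1) : T :=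
  if unlift ord0 i is Some j then a j else k.
Definition vcons n (t : C) (x : 'rV[C]_n) : 'rV[C]_n.+1 := \row_i fcons t (fun j => x 0 j) i.
Definition vtail n (x : 'rV[C]_n.+1) : 'rV[C]_n := \row_j x 0 (lift ord0 j).

Lemma fcons0 T n (k : T) (a : 'I_n -> T) : fcons k a ord0 = k.
Proof. by rewrite /fcons unlift_none. Qed.
Lemma fconsS T n (k : T) (a : 'I_n -> T) j : fcons k a (lift ord0 j) = a j.
Proof. by rewrite /fcons liftK. Qed.
Lemma fcons_eta T n (a : 'I_n.+1 -> T) : fcons (a ord0) (fun j => a (lift ord0 j)) = a.
Proof. by rewrite funeqE => i; rewrite /fcons; case: unliftP => [j|] ->. Qed.
Lemma vcons_eta n (x : 'rV[C]_n.+1) : vcons (x 0 0) (vtail x) = x.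
Proof.
by apply/rowP => i; rewrite mxE /fcons; case: unliftP => [j|] -> //; rewrite mxE.
Qed.

Lemma mon_vcons n k (a : 'I_n -> nat) t x : mon (fcons k a) (vcons t x) = t ^+ k * mon a x.
Proof.
rewrite /mon big_ord_recl !mxE !fcons0; congr (_ * _); apply: eq_bigr => j _.
by rewrite !mxE !fconsS.
Qed.

Lemma sum_ffun_recl (W : nmodType) n m (F : ('I_n.+1 -> 'I_m) -> W) :
  \sum_(a : {ffun 'I_n.+1 -> 'I_m}) F a = \sum_(k < m) \sum_(a : {ffun 'I_n -> 'I_m}) F (fcons k a).
Proof.
rewrite pair_big (reindex (fun ka : 'I_m * {ffun 'I_n -> 'I_m} => [ffun i => fcons ka.1 ka.2 i])) /=.
  by apply: eq_bigr => -[k a] _ /=; congr F; rewrite funeqE => i; rewrite ffunE.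
exists (fun a : {ffun 'I_n.+1 -> 'I_m} => (a ord0, [ffun j => a (lift ord0 j)])) => [[k a] _|a _].
  by congr pair; [rewrite ffunE /= fcons0|apply/ffunP => j; rewrite !ffunE /= fconsS].
apply/ffunP => i; rewrite ffunE /= -[RHS](congr1 (fun g => g i) (fcons_eta a)).
by congr fcons; rewrite funeqE => j; rewrite ffunE.
Qed.

Lemma boxsum_vcons n m (c : ('I_n.+1 -> nat) -> C) t x :
  boxsum m c (vcons t x) = \sum_(k < m) boxsum m (fun a => c (fcons (val k) a)) x * t ^+ k.
Proof.
rewrite /boxsum (sum_ffun_recl (fun g : 'I_n.+1 -> 'I_m => c (fun i => val (g i)) * mon (fun i => val (g i)) (vcons t x))).
apply: eq_bigr => k _; rewrite mulr_suml; apply: eq_bigr => a _.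
have E : (fun i => val (fcons k a i)) = fcons (val k) (fun j => val (a j)).
  by rewrite funeqE => i; rewrite /fcons; case: unlift.
by rewrite E mon_vcons; ring.
Qed.

Lemma nr_vcons n (t : C) (x : 'rV[C]_n) r : 0 < r -> nr t < r -> nr x < r -> nr (vcons t x) < r.
Proof.
move=> r0 tr xr; apply: nr_lt_mx => // i j; rewrite !mxE /fcons; case: unlift => // k.
by apply: le_lt_trans xr; exact: nr_coord.
Qed.

Lemma nr_vtail n (x : 'rV[C]_n.+1) : nr (vtail x) <= nr x.
Proof. by apply: nr_le_mx => [|i j]; [exact: nr_ge0|rewrite mxE; exact: nr_coord]. Qed.

Lemma vcons_affine n : exists (A : 'M[C]_(n, n.+1)) (e : 'rV[C]_n.+1),
  forall t x, vcons t x = x *m A + t *: e.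
Proof.
exists (\matrix_(j, i) (i == lift ord0 j)%:R), (\row_i (i == ord0)%:R) => t x.
apply/rowP => i; rewrite !mxE /fcons; case: unliftP => [j|] ->.
  rewrite (bigD1 j) //= mxE eqxx mulr1 big1 ?addr0 ?mulr0 ?addr0 // => k kj.
  by rewrite mxE (inj_eq lift_inj) eq_sym (negbTE kj) mulr0.
rewrite eqxx mulr1 big1 ?add0r // => k _; rewrite mxE.
by rewrite (negbTE (neq_lift _ _)) mulr0.
Qed.

Lemma geo_le2 (th : R) m : 0 <= th -> th <= 1 / 2 -> \sum_(k < m) th ^+ k <= 2.
Proof.
move=> t0 t1; suff : \sum_(k < m) th ^+ k <= 2 - 2 * th ^+ m by have := exprn_ge0 m t0; lra.
elim: m => [|m ih]; first by rewrite big_ord0 expr0; lra.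
by rewrite big_ord_recr /= exprS; have := exprn_ge0 m t0; nra.
Qed.

Lemma first_var n (f : 'rV[C]_n.+1 -> C) (r B : R) : 0 < r -> 0 <= B ->
  (forall x, nr x < r -> differentiable f x) -> (forall x, nr x < r -> nr (f x) <= B) ->
  exists c : nat -> 'rV[C]_n -> C, [/\ forall k y, nr y < r -> nr (c k y) <= 2 * B * (2 / r) ^+ k,
    forall k y, nr y < r -> differentiable (c k) y &
    forall y m t, nr y < r -> nr t <= r / 4 ->
      nr (f (vcons t y) - \sum_(l < m) c l y * t ^+ l) <= 8 * B * (nr t * (2 / r)) ^+ m].
Proof.
move=> r0 B0 df fB; have [A [e0 hA]] := vcons_affine n.
apply: (@coef_family R _ (fun t x => f (vcons t x)) (fun y => nr y < r) r B r0 B0).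
- move=> p Up; exists (r - nr p); first by rewrite subr_gt0.
  by move=> q qp; have := nr_leB q p; lra.
- move=> t p tr Up.
  have -> : (fun x => f (vcons t x)) = (fun x => f (x *m A + t *: e0)) by rewrite funeqE => x; rewrite hA.
  apply: (diff_comp_dd (diff_affine A (t *: e0) p).1 _).1.
  by rewrite -hA; apply: df; exact: nr_vcons.
- move=> t p tr Up.
  have -> : (fun s => f (vcons s p)) = (fun s => f (p *m A + s *: e0)) by rewrite funeqE => x; rewrite hA.
  by apply: (diff_line _).1; rewrite -hA; apply: df; exact: nr_vcons.
- by move=> t p tr Up; apply: fB; exact: nr_vcons.
Qed.

(** Induction on the number of variables: expand in the first one by [first_var], then each
    coefficient in the others. The constant 16 leaves room for 8 from the first expansion plus 4 *
    16^n from the coefficients. *)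
Theorem power_series n (f : 'rV[C]_n -> C) (r B : R) : 0 < r -> 0 <= B ->
  (forall x, nr x < r -> differentiable f x) -> (forall x, nr x < r -> nr (f x) <= B) ->
  exists c : ('I_n -> nat) -> C,
    (forall a, nr (c a) <= 2 ^+ n * B * \prod_i (2 / r) ^+ a i) /\
    forall m x, nr x <= r / 4 -> nr (f x - boxsum m c x) <= 16 ^+ n * B * (nr x * (2 / r)) ^+ m.
Proof.
move=> r0; elim: n f B => [|n ih] f B B0 df fB.
  exists (fun=> f 0); split=> [a|m x _].
    by rewrite big_ord0 !mulr1 expr0 mul1r fB // nr0.
  rewrite /boxsum (big_pred1 (ffun0 (card_ord 0))) ?/mon ?big_ord0.
  - rewrite mulr1 (_ : x = 0) ?subrr ?nr0; first by pos.
    by apply/rowP => -[].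
  - by move=> a; apply/esym/eqP/ffunP => -[].
have [c [cB cd cE]] := first_var r0 B0 df fB.
pose U (x : 'rV[C]_n) := nr x < r.
have rr : 0 <= 2 / r by pos.
have Bk k : 0 <= 2 * B * (2 / r) ^+ k by pos.
have /choice[d hd] := fun k => ih (c k) _ (Bk k) (cd k) (cB k).
exists (fun a => d (a ord0) (fun j => a (lift ord0 j))); split=> [a|m x xr].
  have [h _] := hd (a ord0); apply: le_trans (h _) _.
  by rewrite big_ord_recl exprSr le_eqVlt; apply/orP; left; apply/eqP; ring.
(* [th] dominates the ratios of the head and of the tail, so that the norm of the whole row can be
   used for both. *)
have H (t : C) (y : 'rV[C]_n) th : nr t <= r / 4 -> nr y <= r / 4 -> nr t * (2 / r) <= th ->
    nr y * (2 / r) <= th -> th <= 1 / 2 ->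
    nr (f (vcons t y) - \sum_(k < m) boxsum m (d k) y * t ^+ k) <= 16 ^+ n.+1 * B * th ^+ m.
  move=> tr yr tth yth th2; have Uy : U y by rewrite /U; lra.
  have t0 : 0 <= nr t * (2 / r) by pos.
  have y0 : 0 <= nr y * (2 / r) by pos.
  have th0 : 0 <= th by exact: le_trans tth.
  have E : f (vcons t y) - \sum_(k < m) boxsum m (d k) y * t ^+ k =
    (f (vcons t y) - \sum_(k < m) c k y * t ^+ k) + \sum_(k < m) (c k y - boxsum m (d k) y) * t ^+ k.
    have -> : \sum_(k < m) (c k y - boxsum m (d k) y) * t ^+ k =
      \sum_(k < m) c k y * t ^+ k - \sum_(k < m) boxsum m (d k) y * t ^+ k.
      by rewrite -sumrB; apply: eq_bigr => k _; rewrite mulrBl.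
    by rewrite addrA subrK.
  rewrite E; apply: le_trans (nrD _ _) _.
  have h1 : nr (f (vcons t y) - \sum_(k < m) c k y * t ^+ k) <= 8 * B * th ^+ m.
    apply: le_trans (cE y m t Uy tr) _; apply: ler_wpM2l; first by pos.
    by rewrite lerXn2r // nnegrE.
  have h2 : nr (\sum_(k < m) (c k y - boxsum m (d k) y) * t ^+ k) <= 16 ^+ n * (2 * B) * th ^+ m * 2.
    apply: le_trans (nr_sum _ _ _) _.
    apply: (@le_trans _ _ (\sum_(k < m) 16 ^+ n * (2 * B) * th ^+ m * th ^+ k)); last first.
      by rewrite -mulr_sumr; apply: ler_wpM2l; [by pos|exact: geo_le2].
    apply: ler_sum => k _; rewrite (nrM (c k y - _)) nrX.
    have [_ hk] := hd k; have {}hk := hk m y yr.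
    apply: (@le_trans _ _ (16 ^+ n * (2 * B * (2 / r) ^+ k) * th ^+ m * nr t ^+ k)).
      rewrite ler_wpM2r ?exprn_ge0 ?nr_ge0 //; apply: le_trans hk _.
      by apply: ler_wpM2l; [by pos|rewrite lerXn2r // nnegrE].
    have -> : 16 ^+ n * (2 * B * (2 / r) ^+ k) * th ^+ m * nr t ^+ k = 16 ^+ n * (2 * B) * th ^+ m * (nr t * (2 / r)) ^+ k.
      by rewrite (exprMn _ (nr t)); ring.
    by apply: ler_wpM2l; [by pos|rewrite lerXn2r // nnegrE].
  have p1 : 1 <= (16 : R) ^+ n by rewrite exprn_ege1 //; lra.
  have p2 : 0 <= B * th ^+ m by pos.
  rewrite exprS; nra.
have xx := nr_coord x 0 0; have xt := nr_vtail x.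
rewrite -{1 2}(vcons_eta x) boxsum_vcons.
have -> : \sum_(k < m) boxsum m (fun a => d (fcons (val k) a ord0) (fun j => fcons (val k) a (lift ord0 j))) (vtail x) * x 0 0 ^+ k =
   \sum_(k < m) boxsum m (d k) (vtail x) * x 0 0 ^+ k.
  apply: eq_bigr => k _; congr (boxsum m _ _ * _); rewrite funeqE => a; rewrite fcons0.
  by congr (d _ _); rewrite funeqE => j; rewrite fconsS.
apply: H.
- exact: le_trans xr.
- exact: le_trans xr.
- by rewrite ler_wpM2r.
- by rewrite ler_wpM2r.
- apply: (@le_trans _ _ (r / 4 * (2 / r))); first by rewrite ler_wpM2r.
  by rewrite le_eqVlt; apply/orP; left; apply/eqP; field; rewrite lt0r_neq0.
Qed.
End PowerSeries.

(** * The identity theorem *)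

Section Identity.
Variable R : realType.
Local Notation C := (cplx R).

Lemma small_const (z : C) (A q : R) (k0 : nat) : 0 <= q < 1 ->
  (forall m, (k0 <= m)%N -> nr z <= A * q ^+ m) -> z = 0.
Proof.
move=> q1 h; apply/eqP; rewrite -nr_eq0 eq_le nr_ge0 andbT; apply/ler_addgt0Pr => e e0; rewrite add0r.
have D0 : 0 < `|A| + 1 by rewrite ltr_wpDl.
have [K hK] := pow_small q1 (divr_gt0 e0 D0).
have := hK (maxn K k0) (leq_maxl _ _); rewrite ler_pdivlMr // => h2.
apply: le_trans (h (maxn K k0) (leq_maxr _ _)) _; apply: le_trans h2.
have q0 : 0 <= q ^+ maxn K k0 by apply: exprn_ge0; case/andP: q1.
by have := ler_norm A; nra.
Qed.

(** The first nonzero coefficient would dominate the remainder for small [t]. *)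
Lemma coef_zero (c : nat -> C) (A rho d : R) (F : C -> C) : 0 < d -> 0 < rho -> 0 <= A ->
  (forall m t, nr t <= rho -> nr (F t - \sum_(l < m) c l * t ^+ l) <= A * (nr t * d) ^+ m) ->
  (exists2 e : R, 0 < e & forall t, nr t < e -> F t = 0) -> forall l, c l = 0.
Proof.
move=> d0 r0 A0 H [e e0 F0]; elim/ltn_ind => l ih.
apply/eqP; rewrite -nr_eq0 eq_le nr_ge0 andbT; apply/ler_addgt0Pr => b b0; rewrite add0r.
pose D := A * d ^+ l.+1 + 1.
have D0 : 0 < D by rewrite /D; pos.
pose x := Num.min rho (Num.min (e / 2) (b / D)).
have x0 : 0 < x by rewrite !lt_min; repeat (apply/andP; split); pos.
have [xr xe xD] : [/\ x <= rho, x <= e / 2 & x * D <= b].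
  by rewrite -ler_pdivlMr // /x !ge_min !lexx !orbT.
clearbody x; have nx : nr (rC x) = x by rewrite nr_rC gtr0_norm.
have := H l.+1 (rC x); rewrite nx => /(_ xr).
rewrite F0; last by rewrite nx; lra.
rewrite big_ord_recr /= big1 => [|i _]; last by rewrite ih // mul0r.
rewrite !add0r nrN (nrM (c l)) nrX nx => h.
have xl : 0 < x ^+ l by exact: exprn_gt0.
rewrite -(ler_pM2r xl); apply: le_trans h _.
have -> : A * (x * d) ^+ l.+1 = x * (A * d ^+ l.+1) * x ^+ l by rewrite exprMn [x ^+ l.+1]exprSr; ring.
by rewrite ler_wpM2r ?(ltW xl) //; move: xD; rewrite /D mulrDr; lra.
Qed.

Variable V : normedModType C.

Lemma vanish_step (g : V -> C) p (d B : R) : 0 < d ->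
  (forall q, nr (q - p) < d -> differentiable g q) -> (forall q, nr (q - p) < d -> nr (g q) <= B) ->
  (exists2 e : R, 0 < e & forall q, nr (q - p) < e -> g q = 0) ->
  forall q, nr (q - p) < d / 4 -> g q = 0.
Proof.
move=> d0 dg gB [e e0 ge] q qd.
have B0 : 0 <= B by apply: le_trans (gB p _); rewrite ?nr_ge0 // subrr nr0.
have [->|qp] := eqVneq q p; first by apply: ge; rewrite subrr nr0.
have n0 : 0 < nr (q - p) by rewrite nr_gt0 subr_eq0.
set v := q - p in qd n0; pose t := rC (nr v); have nt : nr t = nr v by rewrite nr_rC gtr0_norm.
have t0 : t != 0 by rewrite -nr_gt0 nt.
have u1 : nr (t^-1 *: v) <= 1 by rewrite nrZ nrV nt mulVf // lt0r_neq0.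
have [c [_ _ _ hc]] := line_taylor d0 u1 dg gB.
have d2 : 0 < 2 / d by pos.
have d4 : 0 < d / 4 by pos.
have B8 : 0 <= 8 * B by pos.
have c0 := coef_zero d2 d4 B8 hc.
have {}c0 : forall l, c l = 0.
  apply: c0; exists e => // s se; apply: ge; rewrite addrC addKr nrZ; apply: le_lt_trans se.
  by rewrite ler_piMr ?nr_ge0.
have q1 : 0 <= nr v * (2 / d) < 1.
  apply/andP; split; first by pos.
  rewrite mulrA ltr_pdivrMr // mul1r; lra.
apply: (small_const (A := 8 * B) (k0 := 0%N) q1) => m _.
have := hc m t; rewrite nt scalerA divff // scale1r => /(_ (ltW qd)).
by rewrite big1 => [|l _]; [rewrite subr0 /v addrC subrK|rewrite c0 mul0r].
Qed.

Lemma identity (g : V -> C) (r B : R) :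
  (forall q, nr q < r -> differentiable g q) -> (forall q, nr q < r -> nr (g q) <= B) ->
  forall p, nr p < r -> (exists2 e : R, 0 < e & forall q, nr (q - p) < e -> g q = 0) ->
  forall q, nr q < r -> g q = 0.
Proof.
move=> dg gB p pr gp q qr.
(* By convexity of the norm every point of the segment from [p] to [q] is at distance at least [d]
   from the boundary. *)
pose d := r - Num.max (nr p) (nr q).
have d0 : 0 < d by rewrite subr_gt0 gt_max pr qr.
have dpq s : 0 <= s <= 1 -> nr (p + rC s *: (q - p)) <= r - d.
  move=> /andP[s0 s1]; have -> : p + rC s *: (q - p) = rC (1 - s) *: p + rC s *: q.
    by rewrite rCB rC1 scalerBl scale1r scalerBr addrA addrAC.
  apply: le_trans (nrD _ _) _; rewrite !nrZ !nr_rC !ger0_norm ?subr_ge0 //.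
  have -> : r - d = Num.max (nr p) (nr q) by rewrite /d; ring.
  have h1 : nr p <= Num.max (nr p) (nr q) by rewrite le_max lexx.
  have h2 : nr q <= Num.max (nr p) (nr q) by rewrite le_max lexx orbT.
  by move: h1 h2; move: (Num.max _ _) => M h1 h2; nra.
clearbody d.
(* With this [N] consecutive centres are less than d/8 apart, so the ball of radius d/8 about the
   next one lies in the ball of radius d/4 given by [vanish_step]. *)
have [N hN] : exists N : nat, 8 * nr (q - p) / d < N%:R.
  exists (Num.bound (8 * nr (q - p) / d)); apply: archi_boundP; pos.
have N0 : 0 < N%:R :> R by apply: le_lt_trans hN; pos.
suff H j : (j <= N)%N -> exists2 e : R, 0 < e & forall x, nr (x - (p + rC (j%:R / N%:R) *: (q - p))) < e -> g x = 0.
  have [e e0 he] := H N (leqnn _); apply: he.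
  by rewrite divff ?lt0r_neq0 // rC1 scale1r [p + _]addrC subrK subrr nr0.
elim: j => [_|j ih jN].
  have [e e0 he] := gp; exists e => // x; rewrite mul0r rC0 scale0r addr0; exact: he.
have s01 : 0 <= (j%:R / N%:R : R) <= 1.
  by apply/andP; split; [pos|rewrite ler_pdivrMr // mul1r ler_nat ltnW].
have inb x : nr (x - (p + rC (j%:R / N%:R) *: (q - p))) < d -> nr x < r.
  by move=> xd; have := dpq _ s01; have := nr_leB x (p + rC (j%:R / N%:R) *: (q - p)); lra.
have V0 := vanish_step d0 (fun x xd => dg x (inb x xd)) (fun x xd => gB x (inb x xd)) (ih (ltnW jN)).
exists (d / 8) => [|x xd]; first by pos.
apply: V0.
set a := p + rC (j%:R / N%:R) *: (q - p); set b := p + rC (j.+1%:R / N%:R) *: (q - p) in xd.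
have -> : x - a = (x - b) + rC (N%:R^-1) *: (q - p).
  rewrite /a /b -[j.+1%:R]natr1 mulrDl mul1r rCD scalerDl !opprD !addrA subrK //.
apply: le_lt_trans (nrD _ _) _; rewrite nrZ nr_rC ger0_norm ?invr_ge0 //.
have : N%:R^-1 * nr (q - p) <= d / 8.
  rewrite ler_pdivrMl //; move: hN; rewrite ltr_pdivrMr //; lra.
lra.
Qed.

(** Holomorphic functions on a ball have no zero divisors: by continuity [g] is nonzero near [p], so
    [f] vanishes there and then everywhere. *)
Lemma zero_product (f g : V -> C) (r B : R) :
  (forall q, nr q < r -> differentiable f q) -> (forall q, nr q < r -> nr (f q) <= B) ->
  (forall q, nr q < r -> differentiable g q) ->
  (forall q, nr q < r -> f q * g q = 0) ->
  forall p, nr p < r -> g p != 0 -> forall q, nr q < r -> f q = 0.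
Proof.
move=> df fB dg fg p pr gp; apply: (identity df fB pr).
have gp0 : 0 < nr (g p) / 2 by rewrite divr_gt0 // nr_gt0.
have [d d0 hd] := diff_cont (dg p pr) gp0.
exists (Num.min d (r - nr p)); first by rewrite lt_min d0 subr_gt0.
move=> q; rewrite lt_min => /andP[qd qr].
have qr' : nr q < r by have := nr_leB q p; lra.
have := hd (q - p) qd; rewrite [p + _]addrC subrK => h.
have gq : g q != 0.
  by rewrite -nr_gt0; have := nr_leB (g p) (g q); rewrite nrBC; lra.
by have /eqP := fg q qr'; rewrite mulf_eq0 (negbTE gq) orbF => /eqP.
Qed.
End Identity.

Section Torus.
Variable R : realType.
Local Notation C := (cplx R).

(** The radii are chosen from the last variable to the first: take the first coefficient in x_0 that
    is not identically 0, a torus for it in the other variables, and then a radius in x_0 so small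
    that this term dominates. *)
Lemma torus_nonzero n (f : 'rV[C]_n -> C) (r B : R) : 0 < r -> 0 <= B ->
  (forall x, nr x < r -> differentiable f x) -> (forall x, nr x < r -> nr (f x) <= B) ->
  (exists2 x, nr x < r & f x != 0) -> forall e : R, 0 < e ->
  exists s : 'I_n -> R, (forall i, 0 < s i < e) /\
    exists2 d : R, 0 < d & forall x : 'rV[C]_n, (forall i, nr (x 0 i) = s i) -> d <= nr (f x).
Proof.
move=> r0; elim: n f B => [|n ih] f B B0 df fB [x xr fx] e e0.
  exists (fun=> e / 2); split=> [[]//|]; exists (nr (f x)); first by rewrite nr_gt0.
  by move=> y _; rewrite (_ : y = x) //; apply/rowP => -[].
have [c [cB cd cE]] := first_var r0 B0 df fB.
have [k [ck ckm]] : exists k, (exists2 y, nr y < r & c k y != 0) /\ forall l, (l < k)%N -> forall y, nr y < r -> c l y = 0.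
  apply: contrapT => nk.
  have c0 l : forall y, nr y < r -> c l y = 0.
    elim/ltn_ind: l => l ihl y yr; apply: contrapT => cy; apply: nk.
    by exists l; split; [exists y => //; apply/eqP|].
  move/eqP: fx; apply; apply: (identity df fB (p := 0)) => //; first by rewrite nr0.
  exists (r / 8); first by pos.
  move=> q; rewrite subr0 => qr; rewrite -(vcons_eta q).
  have tq : nr (vtail q) < r by apply: le_lt_trans (nr_vtail q) _; lra.
  have q1 : 0 <= nr (q 0 0) * (2 / r) < 1.
    apply/andP; split; first by pos.
    by rewrite mulrA ltr_pdivrMr // mul1r; have := nr_coord q 0 0; lra.
  apply: (small_const (A := 8 * B) (k0 := 0%N) q1) => m _.
  have := cE (vtail q) m (q 0 0) tq; have h : nr (q 0 0) <= r / 4 by have := nr_coord q 0 0; lra.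
  by move=> /(_ h); rewrite big1 ?subr0 // => l _; rewrite c0 // mul0r.
have Bk : 0 <= 2 * B * (2 / r) ^+ k by pos.
have er0 : 0 < Num.min e r by rewrite lt_min e0.
have [s [s0 [d d0 hd]]] := ih (c k) _ Bk (cd k) (cB k) ck _ er0.
pose D := 8 * B * (2 / r) ^+ k.+1 + 1.
have D0 : 0 < D by rewrite /D; pos.
(* The last entry makes the remainder after the k-th term at most half of the lower bound t^k d of
   that term. *)
pose t := Num.min (e / 2) (Num.min (r / 4) (d / 2 / D)).
have t0 : 0 < t by rewrite !lt_min; repeat (apply/andP; split); pos.
have [te tr tD] : [/\ t <= e / 2, t <= r / 4 & t * D <= d / 2].
  by rewrite -ler_pdivlMr // /t !ge_min !lexx !orbT.
clearbody t.
exists (fcons t s); split=> [i|].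
  rewrite /fcons; case: unlift => [j|]; last by rewrite t0; lra.
  by have /andP[-> sj] := s0 j; apply: lt_le_trans sj _; rewrite ge_min lexx.
exists (t ^+ k * (d / 2)); first by pos.
move=> z hz; have nz : nr (z 0 0) = t by have := hz ord0; rewrite fcons0.
have ns j : nr (vtail z 0 j) = s j by rewrite mxE hz fconsS.
have zr : nr (vtail z) < r.
  apply: nr_lt_mx => // i j; rewrite (ord1 i) ns; have /andP[_ sj] := s0 j.
  by apply: lt_le_trans sj _; rewrite ge_min lexx orbT.
have := cE (vtail z) k.+1 (z 0 0) zr; rewrite nz => /(_ tr).
rewrite vcons_eta big_ord_recr /= big1 => [|l _]; last by rewrite ckm // mul0r.
rewrite add0r => h; have := hd (vtail z) ns => h2.
have := nr_leB (c k (vtail z) * z 0 0 ^+ k) (f z); rewrite nrBC (nrM (c k _)) nrX nz.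
have tk : 0 < t ^+ k by exact: exprn_gt0.
have : 8 * B * (t * (2 / r)) ^+ k.+1 <= t ^+ k * (d / 2).
  have -> : 8 * B * (t * (2 / r)) ^+ k.+1 = t ^+ k * (t * (8 * B * (2 / r) ^+ k.+1)).
    by rewrite (exprMn _ t) [t ^+ k.+1]exprSr; ring.
  by rewrite ler_pM2l //; move: tD; rewrite /D mulrDr; lra.
nra.
Qed.
End Torus.

Section DD.
Variable R : realType.
Local Notation C := (cplx R).
Variables (V : normedModType C) (f : V -> C) (p : V).
Lemma ddZ (a : C) v : dd f p (a *: v) = a * dd f p v.
Proof. by rewrite /dd linearZ. Qed.
Lemma ddD u v : dd f p (u + v) = dd f p u + dd f p v.
Proof. by rewrite /dd linearD. Qed.
Lemma dd0 : dd f p 0 = 0.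
Proof. by rewrite /dd linear0. Qed.
Lemma dd_sum (I : Type) (r : seq I) (F : I -> V) :
  dd f p (\sum_(j <- r) F j) = \sum_(j <- r) dd f p (F j).
Proof. by elim: r => [|j r ih]; rewrite ?big_nil ?dd0 // !big_cons ddD ih. Qed.
End DD.

(** * Averages over tori *)

Section Roots.
Variable R : realType.
Local Notation C := (cplx R).
Local Notation ReC z := (complex.Re (z : R[i])).
Local Notation ImC z := (complex.Im (z : R[i])).

Lemma sqrt_right (z : C) : exists w : C, w ^+ 2 = z /\ 0 <= ReC w.
Proof.
pose w : C := sqrtc (z : R[i]).
have w2 : w ^+ 2 = z by exact: sqr_sqrtc.
have [w0|w0] := leP 0 (ReC w); first by exists w.
by exists (- w); rewrite sqrrN ReN oppr_ge0 ltW.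
Qed.

(** Iterated square roots of -1 with nonnegative real part. There |w + 1| is at least 4/3, so (w -
    1)(w + 1) = w^2 - 1 shrinks the distance to 1 by 3/4 at each step. *)
Lemma roots_of_unity : exists z : nat -> C, [/\ forall k, z k ^+ (2 ^ k.+1) = 1, forall k, z k != 1,
  forall k, nr (z k) = 1 & tendsto z 1].
Proof.
have /choice[f hf] := sqrt_right.
pose z := fix z k : C := if k is k'.+1 then f (z k') else -1.
have zS k : z k.+1 ^+ 2 = z k by have [] := hf (z k).
have zR k : 0 <= ReC (z k.+1) by have [] := hf (z k).
have z1 k : nr (z k) = 1.
  elim: k => [|k ih]; first by rewrite /= nrN nr1.
  have : nr (z k.+1) ^+ 2 = 1 by rewrite -nrX zS.
  by move/eqP; rewrite sqrf_eq1 => /orP[/eqP //|/eqP h]; have := nr_ge0 (z k.+1); rewrite h; lra.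
have n1 : (-1 : C) != 1 by rewrite eq_sym -subr_eq0 opprK -mulr2n pnatr_eq0.
have zn k : z k != 1.
  elim: k => [//|k]; apply: contraNneq => h; by rewrite -zS h expr1n.
exists z; split=> // [k|].
  elim: k => [|k ih]; first by rewrite expn1 /= sqrrN expr1n.
  by rewrite expnS exprM zS.
have bd k : nr (z k - 1) <= 2 * (3 / 4) ^+ k.
  elim: k => [|k ih].
    by apply: le_trans (nrB _ _) _; rewrite z1 nr1 expr0; lra.
  have E : nr (z k.+1 - 1) * nr (z k.+1 + 1) = nr (z k - 1).
    by rewrite -nrM -(zS k); congr nr; ring.
  have h : 4 / 3 <= nr (z k.+1 + 1).
    have : 2 <= nr (z k.+1 + 1) ^+ 2.
      have := nr_sq (z k.+1); rewrite z1 nr_sq !ReImE /= => h1.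
      by have := zR k; move: h1; move: (ReC (z k.+1)) (ImC (z k.+1)) => a b; nra.
    by have := nr_ge0 (z k.+1 + 1); nra.
  have := nr_ge0 (z k.+1 - 1); rewrite exprS; nra.
move=> e e0.
have q1 : 0 <= (3 / 4 : R) < 1 by apply/andP; split; lra.
have [K hK] := pow_small q1 (ltac:(lra) : 0 < e / 2).
by exists K => k /hK h; have := bd k; lra.
Qed.
End Roots.

Section Avg.
Variable R : realType.
Local Notation C := (cplx R).
Variable z : nat -> C.
Hypothesis zM : forall k, z k ^+ (2 ^ k.+1) = 1.
Hypothesis zn : forall k, z k != 1.
Hypothesis z1 : forall k, nr (z k) = 1.
Hypothesis zlim : tendsto z 1.
Variable n : nat.
Variable s : 'I_n -> R.
Hypothesis s0 : forall i, 0 < s i.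
Local Notation V := 'rV[C]_n.
Implicit Types (phi psi : V -> C).

Definition torus (x : V) := forall i, nr (x 0 i) = s i.

Definition grid_pt k (g : {ffun 'I_n -> 'I_(2 ^ k.+1)}) : V := \row_i (rC (s i) * z k ^+ g i).

(* The average over the grid [s_i z_k^g_i] stands for the integral over the torus.
   Since [z k] tends to 1, invariance under rotation by [z k] makes the averages of
   [x_j d_j phi] tend to 0. *)
Definition Avg k phi : C := ((2 ^ k.+1)%:R ^+ n)^-1 * \sum_(g : {ffun 'I_n -> 'I_(2 ^ k.+1)}) phi (grid_pt g).

Lemma grid_pt_torus k g : torus (@grid_pt k g).
Proof. by move=> i; rewrite mxE (nrM (rC _)) nrX z1 expr1n mulr1 nr_rC gtr0_norm. Qed.

Lemma Avg_eq k phi psi : (forall x, torus x -> phi x = psi x) -> Avg k phi = Avg k psi.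
Proof. by move=> h; congr (_ * _); apply: eq_bigr => g _; apply: h; exact: grid_pt_torus. Qed.
Lemma AvgD k phi psi : Avg k (fun x => phi x + psi x) = Avg k phi + Avg k psi.
Proof. by rewrite /Avg big_split mulrDr. Qed.
Lemma AvgZ k c phi : Avg k (fun x => c * phi x) = c * Avg k phi.
Proof. by rewrite /Avg -mulr_sumr mulrCA. Qed.

Let N0 k : 0 < (2 ^ k.+1)%:R ^+ n :> R.
Proof. by apply: exprn_gt0; rewrite ltr0n expn_gt0. Qed.

Lemma Avg_bound k phi (B : R) : (forall x, torus x -> nr (phi x) <= B) -> nr (Avg k phi) <= B.
Proof.
move=> h; rewrite /Avg (nrM (_^-1)) nrV nrX -rCn nr_rC ger0_norm // ler_pdivrMl //.
apply: le_trans (nr_sum _ _ _) _.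
apply: (@le_trans _ _ (\sum_(g : {ffun 'I_n -> 'I_(2 ^ k.+1)}) B)).
  by apply: ler_sum => g _; apply: h; exact: grid_pt_torus.
by rewrite sumr_const card_ffun !card_ord -[_ *+ _]mulr_natl natrX.
Qed.

Lemma Avg_const k c : Avg k (fun=> c) = c.
Proof.
rewrite /Avg sumr_const card_ffun !card_ord -[c *+ _]mulr_natl [((2 ^ k.+1) ^ n)%:R]natrX mulKf //.
by rewrite expf_neq0 // pnatr_eq0 expn_eq0.
Qed.

Definition evec (j : 'I_n) : V := \row_i (i == j)%:R.
(** The vector field x_j d_j, generator of the rotations of the j-th coordinate: adding (u - 1)
    times it multiplies x_j by u. *)
Definition euler (x : V) (j : 'I_n) : V := x 0 j *: evec j.

(** The rotation permutes the grid: it adds 1 to the j-th exponent modulo the order of [z k]. *)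
Lemma Avg_rot k phi j : Avg k (fun x => phi (x + (z k - 1) *: euler x j)) = Avg k phi.
Proof.
congr (_ * _); pose h (g : {ffun 'I_n -> 'I_(2 ^ k.+1)}) := [ffun i => if i == j then ordS (g i) else g i].
rewrite [RHS](reindex h) /=.
  apply: eq_bigr => g _; congr phi; apply/rowP => i; rewrite !mxE ffunE.
  have [->|ij] := eqVneq i j; last by rewrite !mulr0 addr0.
  rewrite mulr1 /= expr_mod // exprS; ring.
exists (fun g : {ffun 'I_n -> 'I_(2 ^ k.+1)} => [ffun i => if i == j then ord_pred (g i) else g i]) => g _.
  by apply/ffunP => i; rewrite !ffunE; case: eqP => // _; rewrite ordSK.
by apply/ffunP => i; rewrite !ffunE; case: eqP => // _; rewrite ord_predK.
Qed.

(** A radius and a bound common to all points of the torus; they replace an appeal to its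
    compactness. *)
Definition near_torus phi := exists2 d : R, 0 < d & exists B : R, forall x q, torus x -> nr (q - x) < d ->
  differentiable phi q /\ nr (phi q) <= B.

Lemma nr_euler x j : torus x -> nr (euler x j) <= s j.
Proof.
move=> xt; rewrite nrZ xt ler_piMr ?(ltW (s0 _)) //.
by apply: nr_le_mx => // a b; rewrite mxE; case: eqP; rewrite ?nr1 ?nr0.
Qed.

(** By [Avg_rot] the increments of [phi] under the rotation average to exactly 0. So the average of
    the first-order term equals, up to sign, that of an error of order |z k - 1|^2; divide by z k -
    1. *)
Lemma avg_deriv phi j : near_torus phi -> tendsto (fun k => Avg k (fun x => dd phi x (euler x j))) 0.
Proof.
move=> [d d0 [B hB]] e e0.
have B0 : 0 <= B.
  pose x0 := @grid_pt 0 [ffun=> (ord0 : 'I_2)].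
  have := hB x0 x0 (grid_pt_torus _); rewrite subrr nr0 => /(_ d0)[_].
  by apply: le_trans; exact: nr_ge0.
pose D := 32 * B / d ^+ 2 * s j ^+ 2 + 1.
have sj0 := s0 j; have D0 : 0 < D by rewrite /D; pos.
have m0 : 0 < Num.min (d / 4 / s j) (e / D).
  by rewrite lt_min; apply/andP; split; pos.
have [K hK] := zlim m0; exists K => k /hK; rewrite le_min => /andP[].
rewrite (ler_pdivlMr _ _ sj0) (ler_pdivlMr _ _ D0) => zd ze; rewrite subr0.
have w0 : 0 < nr (z k - 1) by rewrite nr_gt0 subr_eq0.
have E : (z k - 1) * Avg k (fun x => dd phi x (euler x j)) =
   - Avg k (fun x => phi (x + (z k - 1) *: euler x j) - phi x - dd phi x ((z k - 1) *: euler x j)).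
  have L : Avg k (fun x => phi (x + (z k - 1) *: euler x j) - phi x - dd phi x ((z k - 1) *: euler x j)) =
    Avg k (fun x => phi (x + (z k - 1) *: euler x j)) + Avg k (fun x => (-1) * phi x) +
    Avg k (fun x => (- (z k - 1)) * dd phi x (euler x j)).
    rewrite -!AvgD; by apply: Avg_eq => x xt; rewrite ddZ; ring.
  by rewrite L Avg_rot !AvgZ; ring.
have h : nr ((z k - 1) * Avg k (fun x => dd phi x (euler x j))) <= 32 * B / d ^+ 2 * s j ^+ 2 * nr (z k - 1) ^+ 2.
  rewrite E nrN; apply: Avg_bound => x xt.
  have sx := nr_euler j xt.
  have v4 : nr ((z k - 1) *: euler x j) <= d / 4.
    rewrite nrZ; apply: le_trans zd; rewrite ler_wpM2l ?nr_ge0 //.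
  apply: le_trans (@cauchy_quad R V phi x d B d0 _ _ _ v4) _.
  - by move=> q qx; have [] := hB x q xt qx.
  - by move=> q qx; have [] := hB x q xt qx.
  - rewrite -[leRHS]mulrA; apply: ler_wpM2l; first by pos.
    rewrite nrZ exprMn mulrC ler_wpM2r ?exprn_ge0 ?nr_ge0 //.
    by rewrite lerXn2r // nnegrE ?nr_ge0 // ltW.
rewrite (nrM (z k - 1)) in h.
have : nr (z k - 1) * nr (Avg k (fun x => dd phi x (euler x j))) <= nr (z k - 1) * e.
  apply: le_trans h _.
  have -> : 32 * B / d ^+ 2 * s j ^+ 2 * nr (z k - 1) ^+ 2 = nr (z k - 1) * (nr (z k - 1) * (D - 1)) by rewrite /D; ring.
  by rewrite ler_wpM2l ?nr_ge0 //; move: ze; rewrite mulrBr; lra.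
by rewrite ler_pM2l.
Qed.
End Avg.

Section Small.
Variable R : realType.
Local Notation C := (cplx R).
Variable z : nat -> C.
Hypothesis zM : forall k, z k ^+ (2 ^ k.+1) = 1.
Hypothesis zn : forall k, z k != 1.
Hypothesis z1 : forall k, nr (z k) = 1.
Hypothesis zlim : tendsto z 1.
Variable n : nat.
Variable s : 'I_n -> R.
Hypothesis s0 : forall i, 0 < s i.
Local Notation V := 'rV[C]_n.
Local Notation torus := (torus s).
Local Notation Avg := (Avg z s).
Implicit Types (f g : V -> C) (F G : nat -> V -> C).

Lemma near_torus_const (c : C) : near_torus s (fun=> c).
Proof. by exists 1 => //; exists (nr c) => x q _ _; split; first exact: (diff_const c q).1. Qed.

Lemma near_torus_mul f g : near_torus s f -> near_torus s g -> near_torus s (fun x => f x * g x).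
Proof.
move=> [d d0 [B hB]] [d' d0' [B' hB']]; exists (Num.min d d'); first by rewrite lt_min d0.
exists (B * B') => x q xt; rewrite lt_min => /andP[qd qd'].
have [df bf] := hB x q xt qd; have [dg bg] := hB' x q xt qd'.
split; first exact: (diff_mul df dg).1.
by rewrite (nrM (f q)) ler_pM ?nr_ge0.
Qed.

Lemma near_torus_exp f k : near_torus s f -> near_torus s (fun x => f x ^+ k).
Proof.
move=> h; elim: k => [|k ih]; first exact: near_torus_const.
by rewrite (_ : (fun x => _) = fun x => f x * f x ^+ k); [exact: near_torus_mul|rewrite funeqE => x; rewrite exprS].
Qed.

Lemma near_torus_prod (I : Type) (r : seq I) (h : I -> V -> C) :
  (forall i, near_torus s (h i)) -> near_torus s (fun x => \prod_(i <- r) h i x).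
Proof.
move=> hh; elim: r => [|i r ih].
  by rewrite (_ : (fun x => _) = fun=> 1); [exact: near_torus_const|rewrite funeqE => x; rewrite big_nil].
rewrite (_ : (fun x => _) = fun x => h i x * \prod_(i <- r) h i x); first exact: near_torus_mul.
by rewrite funeqE => x; rewrite big_cons.
Qed.

Lemma near_torus_coord i : near_torus s (fun x => x 0 i).
Proof.
exists 1 => //; exists (s i + 1) => x q xt qx; split; first exact: (diff_coord q 0 i).1.
have := nr_leB (q 0 i) (x 0 i); have := nr_coord (q - x) 0 i; rewrite !mxE xt; lra.
Qed.

Lemma torus_coord_near x q i : torus x -> nr (q - x) < s i / 2 -> s i / 2 <= nr (q 0 i).
Proof.
move=> xt qx; have := nr_leB (x 0 i) (q 0 i); have := nr_coord (q - x) 0 i.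
by rewrite !mxE nrBC xt; lra.
Qed.

Lemma near_torus_inv_coord i : near_torus s (fun x => (x 0 i)^-1).
Proof.
exists (s i / 2); first by have := s0 i; lra.
exists (2 / s i) => x q xt /(torus_coord_near xt) h.
have q0 : q 0 i != 0 by rewrite -nr_gt0; have := s0 i; lra.
split; first exact: (diff_inv (diff_coord q 0 i).1 q0).1.
rewrite nrV -[2 / s i]invf_div lef_pV2 // posrE; last by have := s0 i; lra.
by rewrite nr_gt0.
Qed.

Definition invmon (b : 'I_n -> nat) (x : V) : C := \prod_i (x 0 i)^-1 ^+ b i.
(** The Laurent monomial x^(a - b). Numerator and denominator keep natural exponents, so one
    monomial has several names, identified on the torus by [chi_cancel]. *)
Definition chi (a b : 'I_n -> nat) (x : V) : C := mon a x * invmon b x.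

Lemma near_torus_chi a b : near_torus s (chi a b).
Proof.
apply: near_torus_mul; apply: near_torus_prod => i; apply: near_torus_exp; first exact: near_torus_coord.
exact: near_torus_inv_coord.
Qed.

Definition eig f (c : C) x v := differentiable f x /\ dd f x v = c * f x.
Lemma eig_mul f g c c' x v : eig f c x v -> eig g c' x v -> eig (fun x => f x * g x) (c + c') x v.
Proof.
move=> [df ef] [dg eg]; have [h1 h2] := diff_mul df dg; split; first exact: h1.
by rewrite h2 ef eg; ring.
Qed.
Lemma eig_const k x v : eig (fun=> k) 0 x v.
Proof. by have [h1 h2] := diff_const k x; split; [exact: h1|rewrite h2 mul0r]. Qed.
Lemma eig_exp f c x v k : eig f c x v -> eig (fun x => f x ^+ k) (k%:R * c) x v.
Proof.
move=> h; elim: k => [|k ih]; first by rewrite mul0r; exact: eig_const.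
rewrite (_ : (fun x => f x ^+ k.+1) = fun x => f x * f x ^+ k); last by rewrite funeqE => y; rewrite exprS.
by rewrite -natr1 mulrDl mul1r addrC; exact: eig_mul.
Qed.
Lemma eig_prod (I : Type) (r : seq I) (h : I -> V -> C) (c : I -> C) x v :
  (forall i, eig (h i) (c i) x v) -> eig (fun x => \prod_(i <- r) h i x) (\sum_(i <- r) c i) x v.
Proof.
move=> hh; elim: r => [|i r ih].
  by rewrite (_ : (fun x => _) = fun=> 1) ?big_nil; [exact: eig_const|rewrite funeqE => y; rewrite big_nil].
rewrite (_ : (fun x => _) = fun x => h i x * \prod_(i <- r) h i x) ?big_cons; first exact: eig_mul.
by rewrite funeqE => y; rewrite big_cons.
Qed.
Lemma eig_coord x i j : eig (fun x => x 0 i) (i == j)%:R x (euler x j).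
Proof.
have [h1 h2] := diff_coord x 0 i; split; first exact: h1.
rewrite h2 !mxE; case: eqP => [->|]; first by rewrite mulr1 mul1r.
by rewrite mulr0 mul0r.
Qed.
Lemma eig_inv f c x v : f x != 0 -> eig f c x v -> eig (fun x => (f x)^-1) (- c) x v.
Proof.
move=> f0 [df ef]; have [h1 h2] := diff_inv df f0; split; first exact: h1.
by rewrite h2 ef expr2; field.
Qed.

Lemma eig_chi a b x j : torus x -> eig (chi a b) ((a j)%:R - (b j)%:R) x (euler x j).
Proof.
move=> xt.
have sumE (c : 'I_n -> nat) : \sum_i (c i)%:R * (i == j)%:R = (c j)%:R :> C.
  by rewrite (bigD1 j) //= eqxx mulr1 big1 ?addr0 // => i /negbTE ->; rewrite mulr0.
rewrite -(sumE a) -(sumE b) -sumrN.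
apply: eig_mul; apply: eig_prod => i.
  by apply: eig_exp; exact: eig_coord.
rewrite -mulrN; apply: eig_exp; apply: eig_inv; last exact: eig_coord.
by rewrite -nr_gt0 xt.
Qed.

Lemma chiM a b a' b' x : chi a b x * chi a' b' x = chi (fun i => a i + a' i)%N (fun i => b i + b' i)%N x.
Proof.
by rewrite /chi mulrACA; congr (_ * _); rewrite -big_split /=; apply: eq_bigr => i _; rewrite exprD.
Qed.
Lemma chi_cancel a b c x : torus x -> chi (fun i => a i + c i)%N (fun i => b i + c i)%N x = chi a b x.
Proof.
move=> xt; rewrite -(chiM a b c c) [X in _ * X](_ : _ = 1) ?mulr1 //.
rewrite /chi /mon /invmon -big_split big1 //= => i _.
by rewrite -exprMn mulfV ?expr1n // -nr_gt0 xt.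
Qed.

(* [F l] is the first integral at the scale [t = 2^-l]; its torus averages tend
   to 0 when first the mesh of the grid and then the scale tend to 0. *)
Definition small F := forall e : R, 0 < e -> exists L, forall l, (L <= l)%N ->
  exists K, forall k, (K <= k)%N -> nr (Avg k (F l)) <= e.
Definition unif_small F := forall e : R, 0 < e -> exists L, forall l, (L <= l)%N -> forall x, torus x -> nr (F l x) <= e.
Definition bounded_torus F := exists B L, forall l, (L <= l)%N -> forall x, torus x -> nr (F l x) <= B.

Lemma small_ext F G : (exists L, forall l, (L <= l)%N -> forall x, torus x -> F l x = G l x) -> small F -> small G.
Proof.
move=> [L hL] sF e e0; have [L' hL'] := sF e e0; exists (maxn L L') => l; rewrite geq_max => /andP[l1 l2].
have [K hK] := hL' l l2; exists K => k /hK.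
by rewrite (Avg_eq z1 s0 k (hL l l1)).
Qed.
Lemma small_add F G : small F -> small G -> small (fun l x => F l x + G l x).
Proof.
move=> sF sG e e0; have [L hL] := sF (e / 2) ltac:(lra); have [L' hL'] := sG (e / 2) ltac:(lra).
exists (maxn L L') => l; rewrite geq_max => /andP[l1 l2].
have [K hK] := hL l l1; have [K' hK'] := hL' l l2.
exists (maxn K K') => k; rewrite geq_max => /andP[/hK h1 /hK' h2].
by rewrite AvgD; apply: le_trans (nrD _ _) _; lra.
Qed.
Lemma small_scal c F : small F -> small (fun l x => c * F l x).
Proof.
move=> sF e e0; have c0 : 0 < nr c + 1 by pos.
have [L hL] := sF (e / (nr c + 1)) ltac:(by rewrite divr_gt0).
exists L => l /hL[K hK]; exists K => k /hK; rewrite AvgZ (nrM c) ler_pdivlMr // => h.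
by have := nr_ge0 (Avg k (F l)); nra.
Qed.
Lemma small_sum (I : Type) (r : seq I) (F : I -> nat -> V -> C) :
  (forall i, small (F i)) -> small (fun l x => \sum_(i <- r) F i l x).
Proof.
move=> h; elim: r => [|i r ih].
  move=> e e0; exists 0%N => l _; exists 0%N => k _.
  rewrite (_ : (fun x => _) = fun=> 0); first by rewrite Avg_const nr0 ltW.
  by rewrite funeqE => x; rewrite big_nil.
apply: small_ext (small_add (h i) ih); exists 0%N => l _ x _; by rewrite big_cons.
Qed.
Lemma small_unif_small F : unif_small F -> small F.
Proof.
move=> h e /h[L hL]; exists L => l /hL hl; exists 0%N => k _; exact: Avg_bound.
Qed.
Lemma small_null F L : (forall l, (L <= l)%N -> tendsto (fun k => Avg k (F l)) 0) -> small F.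
Proof.
move=> h e e0; exists L => l /h/(_ e e0)[K hK]; exists K => k /hK; by rewrite subr0.
Qed.
(** Used to pass from the truncations of a power series to its sum. *)
Lemma small_approx F : (forall e : R, 0 < e -> exists2 G, small G &
  exists L, forall l, (L <= l)%N -> forall x, torus x -> nr (F l x - G l x) <= e) -> small F.
Proof.
move=> h e e0; have [G sG [L hL]] := h (e / 2) ltac:(lra).
have [L' hL'] := sG (e / 2) ltac:(lra).
exists (maxn L L') => l; rewrite geq_max => /andP[l1 l2].
have [K hK] := hL' l l2; exists K => k /hK h2.
have -> : F l = (fun x => (F l x - G l x) + G l x) by rewrite funeqE => x; rewrite subrK.
rewrite AvgD; apply: le_trans (nrD _ _) _.
have := Avg_bound z1 s0 k (hL l l1); lra.
Qed.
Lemma small_cst (c : C) : small (fun _ _ => c) -> c = 0.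
Proof.
move=> h; apply/eqP; rewrite -nr_eq0 eq_le nr_ge0 andbT; apply/ler_addgt0Pr => e /h[L /(_ L (leqnn _))[K /(_ K (leqnn _))]].
by rewrite Avg_const add0r.
Qed.

Lemma bounded_torus_mul F G : bounded_torus F -> bounded_torus G -> bounded_torus (fun l x => F l x * G l x).
Proof.
move=> [B [L hB]] [B' [L' hB']]; exists (B * B'), (maxn L L') => l; rewrite geq_max => /andP[l1 l2] x xt.
by rewrite (nrM (F l x)) ler_pM ?nr_ge0 // ?hB ?hB'.
Qed.
Lemma bounded_torus_near_torus f : near_torus s f -> bounded_torus (fun=> f).
Proof.
by move=> [d d0 [B hB]]; exists B, 0%N => l _ x xt; have [] := hB x x xt; rewrite ?subrr ?nr0.
Qed.
Lemma bounded_torus_sum (I : Type) (r : seq I) (F : I -> nat -> V -> C) :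
  (forall i, bounded_torus (F i)) -> bounded_torus (fun l x => \sum_(i <- r) F i l x).
Proof.
move=> h; elim: r => [|i r [B [L hB]]].
  by exists 0, 0%N => l _ x _; rewrite big_nil nr0.
have [B' [L' hB']] := h i; exists (B' + B), (maxn L L') => l; rewrite geq_max => /andP[l1 l2] x xt.
by rewrite big_cons; apply: le_trans (nrD _ _) _; apply: lerD; [exact: hB'|exact: hB].
Qed.
Lemma unif_small_bnd F G : unif_small F -> bounded_torus G -> unif_small (fun l x => F l x * G l x).
Proof.
move=> uF [B [L hB]] e e0; have [L' hL'] := uF (e / (`|B| + 1)) ltac:(by rewrite divr_gt0 // ltr_wpDl).
exists (maxn L L') => l; rewrite geq_max => /andP[l1 l2] x xt.
have := hL' l l2 x xt; rewrite ler_pdivlMr ?ltr_wpDl // => h.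
rewrite (nrM (F l x)); have := hB l l1 x xt; have := ler_norm B; have := nr_ge0 (F l x); nra.
Qed.
Lemma unif_small_geo : unif_small (fun l _ => rC ((1 / 2) ^+ l)).
Proof.
have q1 : 0 <= (1 / 2 : R) < 1 by apply/andP; split; lra.
move=> e /(pow_small q1)[K hK]; exists K => l /hK h x _; rewrite nr_rC ger0_norm //.
by apply: exprn_ge0; lra.
Qed.

Definition near_torus_unif F := exists2 d : R, 0 < d & exists B L, forall l, (L <= l)%N -> forall x q, torus x -> nr (q - x) < d ->
  differentiable (F l) q /\ nr (F l q) <= B.

Lemma bounded_torus_near_torus_unif F : near_torus_unif F -> bounded_torus F.
Proof.
by move=> [d d0 [B [L hB]]]; exists B, L => l lL x xt; have [] := hB l lL x x xt; rewrite ?subrr ?nr0.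
Qed.
Lemma bounded_torus_dd F j : near_torus_unif F -> bounded_torus (fun l x => dd (F l) x (euler x j)).
Proof.
move=> [d d0 [B [L hB]]]; exists (4 * B / d * s j), L => l lL x xt.
apply: le_trans (@cauchy_deriv R V (F l) x d B d0 _ _ (euler x j)) _.
- by move=> q qx; have [] := hB l lL x q xt qx.
- by move=> q qx; have [] := hB l lL x q xt qx.
apply: ler_wpM2l; last exact: nr_euler.
have B0 : 0 <= B by have [_] := hB l lL x x xt ltac:(by rewrite subrr nr0); apply: le_trans; exact: nr_ge0.
by pos.
Qed.

(* Averaging kills x_j d_j, so x_j d_j can be moved from F to a Laurent monomial. *)
Lemma by_parts F a b j : near_torus_unif F -> exists L, forall l, (L <= l)%N -> tendsto (fun k => Avg k
  (fun x => chi a b x * dd (F l) x (euler x j) + ((a j)%:R - (b j)%:R) * (chi a b x * F l x))) 0.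
Proof.
move=> [d d0 [B [L hB]]]; exists L => l lL.
have nF : near_torus s (F l) by exists d => //; exists B => x q; exact: hB.
have dF x : torus x -> differentiable (F l) x by move=> xt; have [] := hB l lL x x xt ltac:(by rewrite subrr nr0).
have := avg_deriv zM zn z1 zlim s0 j (near_torus_mul (near_torus_chi a b) nF).
have E k : Avg k (fun x => chi a b x * dd (F l) x (euler x j) + ((a j)%:R - (b j)%:R) * (chi a b x * F l x)) =
   Avg k (fun x => dd (fun x => chi a b x * F l x) x (euler x j)).
  apply: Avg_eq => // x xt; have [d1 e1] := eig_chi a b j xt.
  by rewrite (diff_mul d1 (dF x xt)).2 e1; ring.
by move=> h e /h[K hK]; exists K => k /hK; rewrite E.
Qed.
End Small.

(** * Laurent coefficients of a first integral *)

Section Laurent.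
Variable R : realType.
Local Notation C := (cplx R).
Variable z : nat -> C.
Hypothesis zM : forall k, z k ^+ (2 ^ k.+1) = 1.
Hypothesis zn : forall k, z k != 1.
Hypothesis z1 : forall k, nr (z k) = 1.
Hypothesis zlim : tendsto z 1.
Variables M S : nat.
Variable rad : 'I_(M + S) -> R.
Hypothesis rad0 : forall i, 0 < rad i.
Local Notation V := 'rV[C]_(M + S).
Local Notation torus := (torus rad).
Local Notation small := (small z rad).
Local Notation unif_small := (unif_small rad).
Local Notation bounded_torus := (bounded_torus rad).

Variable nu : nat -> R.
Hypothesis indep : forall m (a b : 'I_m -> nat),
  \sum_(i < m) nu i * (a i)%:R = \sum_(i < m) nu i * (b i)%:R -> forall i, a i = b i.

Definition extl (a : 'I_M -> nat) (i : 'I_(M + S)) : nat :=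
  match fintype.split i with inl j => a j | inr _ => 0%N end.
Definition ey (k : 'I_S) (i : 'I_(M + S)) : nat := (i == rshift M k).
(* Exponents of the monomial psi, the first y-coordinate; psi is 1 when there is none. *)
Definition psie (i : 'I_(M + S)) : nat := (val i == M).

Lemma extl_l a j : extl a (lshift S j) = a j.
Proof. by rewrite /extl (unsplitK (inl _ j)). Qed.
Lemma extl_r a k : extl a (rshift M k) = 0%N.
Proof. by rewrite /extl (unsplitK (inr _ k)). Qed.
Lemma ey_l k j : ey k (lshift S j) = 0%N.
Proof. by rewrite /ey eq_lrshift. Qed.
Lemma psie_l j : psie (lshift S j) = 0%N.
Proof. by rewrite /psie /= ltn_eqF. Qed.

Lemma mon_extl a (x : V) : mon (extl a) x = mon a (lsubmx x).
Proof.
rewrite /mon big_split_ord /= [X in _ * X]big1 ?mulr1 => [|k _]; last by rewrite extl_r expr0.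
by apply: eq_bigr => j _; rewrite extl_l mxE.
Qed.

Definition addf m (a b : 'I_m -> nat) := fun i => (a i + b i)%N.

Variable F : nat -> V -> C.
Hypothesis nF : near_torus_unif rad F.
Variable gam : 'I_S -> 'I_M -> nat.
Variable At : 'I_S -> 'I_S -> V -> C.
Variable cc : 'I_S -> 'I_S -> ('I_M -> nat) -> C.
Hypothesis Atb : forall i k, bounded_torus (fun=> At i k).
Hypothesis Atexp : forall i k (e : R), 0 < e -> exists m0, forall m, (m0 <= m)%N -> forall x, torus x ->
  nr (At i k x - boxsum m (cc i k) (lsubmx x)) <= e.
Hypothesis Atd : forall i k, cc i k (gam i) = (i == k)%:R.

(** The function psi y_i x^(-g_i) At_(i,k) times the derivative of [F l] along y_k; the Euler field
    brings in a factor y_k, removed again by [ey k] in the denominator. *)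
Definition mainterm l (x : V) (i k : 'I_S) : C :=
  chi (addf psie (ey i)) (addf (extl (gam i)) (ey k)) x * At i k x * dd (F l) x (euler x (rshift M k)).

Variable G : nat -> V -> C.
Hypothesis Gs : unif_small G.
Hypothesis main_eq : exists L, forall l, (L <= l)%N -> forall x, torus x ->
  \sum_(j < M) rC (nu j) * dd (F l) x (euler x (lshift S j)) +
  rC ((1 / 2) ^+ l) * (\sum_(i < S) \sum_(k < S) rC (nu i) * mainterm l x i k + G l x) = 0.

Let t0 l : rC ((1 / 2) ^+ l) != 0 :> C.
Proof. by rewrite -(rC0 R) (inj_eq (@rC_inj R)) expf_neq0 // lt0r_neq0 //; lra. Qed.

Let bnd_main i k : bounded_torus (fun l x => mainterm l x i k).
Proof.
apply: bounded_torus_mul => //; last exact: bounded_torus_dd.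
by apply: bounded_torus_mul => //; apply: bounded_torus_near_torus; exact: near_torus_chi.
Qed.

(** [wx] and [wy] are the eigenvalues on [chi a b] of sum_j nu_j x_j d/dx_j and of sum_k nu_k y_k
    d/dy_k. *)
Let wx (a b : 'I_(M + S) -> nat) : C := \sum_(j < M) rC (nu j) * ((a (lshift S j))%:R - (b (lshift S j))%:R).
Let wy (a b : 'I_(M + S) -> nat) : C := \sum_(k < S) rC (nu k) * ((a (rshift M k))%:R - (b (rshift M k))%:R).

Let small_div (c : C) H : c != 0 -> small (fun l x => c * H l x) -> small H.
Proof.
move=> c0 /(small_scal c^-1); apply: small_ext => //.
by exists 0%N => l _ x _; rewrite mulKf.
Qed.

(** The equation at order 1: all that follows the factor t = 2^-l in [main_eq] is bounded on the
    torus, hence uniformly small after multiplication by t. *)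
Let step_x a b : wx a b != 0 -> small (fun l x => chi a b x * F l x).
Proof.
move=> w0; apply: (small_div w0).
have s1 : small (fun l x => \sum_(j < M) rC (nu j) * (chi a b x * dd (F l) x (euler x (lshift S j)) +
    ((a (lshift S j))%:R - (b (lshift S j))%:R) * (chi a b x * F l x))).
  apply: small_sum => // j; apply: small_scal.
  by have [L hL] := by_parts zM zn z1 zlim rad0 a b (lshift S j) nF; exact: (small_null hL).
have s2 : small (fun l x => rC ((1 / 2) ^+ l) * (chi a b x * (\sum_(i < S) \sum_(k < S) rC (nu i) * mainterm l x i k)) ).
  apply: small_unif_small => //; apply: unif_small_bnd; first exact: unif_small_geo.
  apply: bounded_torus_mul; first by apply: bounded_torus_near_torus; exact: near_torus_chi.
  apply: bounded_torus_sum => i; apply: bounded_torus_sum => k; apply: bounded_torus_mul => //.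
  by apply: bounded_torus_near_torus; exact: near_torus_const.
have s3 : small (fun l x => rC ((1 / 2) ^+ l) * (chi a b x * G l x)).
  apply: small_unif_small => //; apply: unif_small_bnd; first exact: unif_small_geo.
  apply: bounded_torus_mul; first by apply: bounded_torus_near_torus; exact: near_torus_chi.
  by have [L hL] := Gs ltr01; exists 1, L.
apply: small_ext (small_add s1 (small_add s2 s3)) => //.
have [L hL] := main_eq; exists L => l lL x xt.
have E := hL l lL x xt.
have -> : \sum_(j < M) rC (nu j) * (chi a b x * dd (F l) x (euler x (lshift S j)) +
    ((a (lshift S j))%:R - (b (lshift S j))%:R) * (chi a b x * F l x)) =
  chi a b x * (\sum_(j < M) rC (nu j) * dd (F l) x (euler x (lshift S j))) + wx a b * (chi a b x * F l x).
  rewrite /wx mulr_suml mulr_sumr -big_split; apply: eq_bigr => j _ /=; ring.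
move: E; set S1 := \sum_(j < M) _; set S2 := \sum_(i < S) _; set t := rC _ => E.
transitivity (chi a b x * (S1 + t * (S2 + G l x)) + wx a b * (chi a b x * F l x)); first by ring.
by rewrite E; ring.
Qed.

(** Absence of resonances, from the independence of the [nu j]: if the x-weight of a - b is 0, only
    the exponent [ga] itself compensates the denominator x^ga. *)
Let wx_extl a b (al ga : 'I_M -> nat) (k i : 'I_S) : wx a b = 0 -> al <> ga ->
  wx (addf (addf a (addf psie (ey i))) (extl al)) (addf b (addf (extl ga) (ey k))) != 0.
Proof.
move=> w0 alga; apply/eqP => h; apply: alga; rewrite funeqE; apply: indep.
apply: (@rC_inj R); move: h; rewrite /wx /addf.
under eq_bigr => j _ do rewrite psie_l !ey_l !extl_l !addn0 !natrD.
rewrite (eq_bigr (fun j : 'I_M => rC (nu j) * ((a (lshift S j))%:R - (b (lshift S j))%:R) + (rC (nu j * (al j)%:R) - rC (nu j * (ga j)%:R)))); last first.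
  by move=> j _; rewrite !rCM !rCn; ring.
rewrite big_split /= -/(wx a b) w0 add0r sumrB => /eqP; rewrite subr_eq0 => /eqP.
have sE (H : 'I_M -> R) : rC (\sum_j H j) = \sum_j rC (H j).
  by apply: (big_morph (@rC R)); [exact: rCD|exact: rC0].
by rewrite !sE.
Qed.

(** Expand [At i k] in powers of x. A monomial other than x^(gam i) has a nonzero x-weight and is
    killed by [step_x] after integration by parts in y_k; x^(gam i) cancels the denominator and has
    coefficient 1 if i = k and 0 otherwise. *)
Let step_term a b i k : wx a b = 0 ->
  small (fun l x => chi a b x * mainterm l x i k +
     (i == k)%:R * (((addf a psie) (rshift M k))%:R - (b (rshift M k))%:R) * (chi (addf a psie) b x * F l x)).
Proof.
move=> w0.
pose a3 al := addf (addf a (addf psie (ey i))) (extl al).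
pose b3 := addf b (addf (extl (gam i)) (ey k)).
have sm al : al <> gam i -> small (fun l x => chi (a3 al) b3 x * dd (F l) x (euler x (rshift M k))).
  move=> h; have w3 := wx_extl k i w0 h.
  have [L hL] := by_parts zM zn z1 zlim rad0 (a3 al) b3 (rshift M k) nF.
  have s1 := small_null hL.
  have s2 := small_scal (- ((a3 al (rshift M k))%:R - (b3 (rshift M k))%:R)) (step_x w3).
  apply: small_ext (small_add s1 s2) => //; exists 0%N => l _ x _.
  rewrite -/(a3 al) -/b3; ring.
apply: small_approx => // e e0.
have bq : bounded_torus (fun l x => chi a b x * chi (addf psie (ey i)) (addf (extl (gam i)) (ey k)) x * dd (F l) x (euler x (rshift M k))).
  apply: bounded_torus_mul; last exact: bounded_torus_dd.
  by apply: bounded_torus_mul; apply: bounded_torus_near_torus; exact: near_torus_chi.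
have [B [L hB]] := bq.
have BB : 0 < `|B| + 1 by rewrite ltr_wpDl.
have [m0 hm0] := Atexp i k (divr_gt0 e0 BB).
(* Large enough for the truncation error and for the box to contain the exponent [gam i]. *)
pose m := (maxn m0 (\max_j gam i j).+1)%N.
have gm j : (gam i j < m)%N.
  by rewrite leq_max ltnS; apply/orP; right; exact: (leq_bigmax j).
have {}hm0 := hm0 m (leq_maxl _ _).
pose ga : {ffun 'I_M -> 'I_m} := [ffun j => Ordinal (gm j)].
have gaE : (fun j => val (ga j)) = gam i by rewrite funeqE => j; rewrite ffunE.
exists (fun l x => chi a b x * chi (addf psie (ey i)) (addf (extl (gam i)) (ey k)) x * dd (F l) x (euler x (rshift M k)) * boxsum m (cc i k) (lsubmx x) +
  (i == k)%:R * (((addf a psie) (rshift M k))%:R - (b (rshift M k))%:R) * (chi (addf a psie) b x * F l x)); last first.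
  exists L => l lL x xt; rewrite /mainterm.
  set u := chi a b x; set v := chi _ _ x; set w := dd _ _ _; set q := _ * (chi _ _ _ * F l x).
  have -> : u * (v * At i k x * w) + q - (u * v * w * boxsum m (cc i k) (lsubmx x) + q) =
     u * v * w * (At i k x - boxsum m (cc i k) (lsubmx x)) by ring.
  rewrite (nrM (u * v * w)).
  have h1 := hm0 x xt; have h2 := hB l lL x xt; rewrite -/u -/v -/w in h2.
  rewrite ler_pdivlMr // in h1; have := nr_ge0 (At i k x - boxsum m (cc i k) (lsubmx x)); have := ler_norm B.
  have := nr_ge0 (u * v * w); clearbody u v w; nra.
have E x l : chi a b x * chi (addf psie (ey i)) (addf (extl (gam i)) (ey k)) x * dd (F l) x (euler x (rshift M k)) * boxsum m (cc i k) (lsubmx x) =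
   \sum_(al : {ffun 'I_M -> 'I_m}) cc i k (fun j => val (al j)) * (chi (a3 (fun j => val (al j))) b3 x * dd (F l) x (euler x (rshift M k))).
  rewrite /boxsum mulr_sumr; apply: eq_bigr => al _.
  have -> : chi (a3 (fun j => val (al j))) b3 x = chi a b x * chi (addf psie (ey i)) (addf (extl (gam i)) (ey k)) x * mon (fun j => val (al j)) (lsubmx x).
    rewrite chiM -mon_extl /chi mulrAC; congr (_ * _).
    by rewrite -big_split /=; apply: eq_bigr => j _; rewrite -exprD.
  ring.
have sOther : small (fun l x => \sum_(al | al != ga) cc i k (fun j => val (al j)) * (chi (a3 (fun j => val (al j))) b3 x * dd (F l) x (euler x (rshift M k)))).
  under eq_fun => l do under eq_fun => x do rewrite big_mkcond.
  apply: small_sum => // al; case: eqP => /= [_|alga].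
    by apply: (small_unif_small z1 rad0) => d d0; exists 0%N => l _ x _; rewrite nr0 ltW.
  apply: small_scal; apply: sm => h; apply: alga; apply/ffunP => j; apply: val_inj.
  by have := congr1 (fun g => g j) (etrans h (esym gaE)).
have sGa : small (fun l x => cc i k (gam i) * (chi (a3 (gam i)) b3 x * dd (F l) x (euler x (rshift M k))) +
   (i == k)%:R * (((addf a psie) (rshift M k))%:R - (b (rshift M k))%:R) * (chi (addf a psie) b x * F l x)).
  rewrite Atd; have [ik|ik] := eqVneq i k; last first.
    apply: (small_unif_small z1 rad0) => d d0; exists 0%N => l _ x _.
    by rewrite !mul0r addr0 nr0 ltW.
  have [L' hL'] := by_parts zM zn z1 zlim rad0 (addf a psie) b (rshift M k) nF.
  apply: small_ext (small_null hL') => //; exists 0%N => l _ x xt.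
  rewrite !mul1r -(chi_cancel rad0 (addf a psie) b (addf (extl (gam i)) (ey k)) xt); congr (_ * _ + _).
  congr chi; rewrite funeqE => j; rewrite /a3 /addf ik; lia.
apply: small_ext (small_add sOther sGa) => //; exists 0%N => l _ x _.
have D (H : {ffun 'I_M -> 'I_m} -> C) : \sum_al H al = H ga + \sum_(al | al != ga) H al by rewrite (bigD1 ga).
by rewrite E D gaE; ring.
Qed.

(** Dividing [main_eq] by t = 2^-l is harmless: for fixed [l] the averages of the x-part tend to 0
    with the mesh, whatever the factor 1/t. For this reason [small] lets the mesh go to 0 before the
    scale. *)
Let step_y a b : wx a b = 0 -> wy (addf a psie) b != 0 -> small (fun l x => chi (addf a psie) b x * F l x).
Proof.
move=> w0 wy0; apply: (small_div wy0).
have nul j : exists L, forall l, (L <= l)%N -> tendsto (fun k => Avg z rad k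
  (fun x => chi a b x * dd (F l) x (euler x (lshift S j)) + ((a (lshift S j))%:R - (b (lshift S j))%:R) * (chi a b x * F l x))) 0.
  exact: by_parts.
have s1 : small (fun l x => (rC ((1 / 2) ^+ l))^-1 * (\sum_(j < M) rC (nu j) * (chi a b x * dd (F l) x (euler x (lshift S j)) +
    ((a (lshift S j))%:R - (b (lshift S j))%:R) * (chi a b x * F l x)))).
  under eq_fun => l do under eq_fun => x do rewrite mulr_sumr.
  apply: small_sum => // j; have [L hL] := nul j; apply: (small_null (L := L)) => l lL.
  have h := tendstoZ ((rC ((1 / 2) ^+ l))^-1 * rC (nu j)) (hL l lL); rewrite scaler0 in h.
  move=> e /h[K hK]; exists K => k /hK.
  set g := fun x => chi a b x * dd (F l) x (euler x (lshift S j)) + _.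
  have -> : Avg z rad k (fun x => (rC ((1 / 2) ^+ l))^-1 * (rC (nu j) * g x)) =
    ((rC ((1 / 2) ^+ l))^-1 * rC (nu j)) *: Avg z rad k g :> C.
    rewrite -[_ *: _]/(_ * _) -AvgZ; congr (Avg z rad k _); rewrite funeqE => x; exact: mulrA.
  by [].
have s2 : small (fun l x => chi a b x * G l x).
  apply: small_unif_small => //.
  have h := unif_small_bnd Gs (bounded_torus_near_torus (near_torus_chi rad0 a b)).
  by move=> e /h[L hL]; exists L => l lL x xt; rewrite mulrC; exact: hL.
have s3 : small (fun l x => \sum_(i < S) \sum_(k < S) rC (nu i) * (chi a b x * mainterm l x i k +
     (i == k)%:R * (((addf a psie) (rshift M k))%:R - (b (rshift M k))%:R) * (chi (addf a psie) b x * F l x))).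
  by apply: small_sum => // i; apply: small_sum => // k; apply: small_scal; exact: step_term.
apply: small_ext (small_add s1 (small_add s2 s3)) => //.
have [L hL] := main_eq; exists L => l lL x xt; have E := hL l lL x xt.
have -> : \sum_(j < M) rC (nu j) * (chi a b x * dd (F l) x (euler x (lshift S j)) +
    ((a (lshift S j))%:R - (b (lshift S j))%:R) * (chi a b x * F l x)) =
  chi a b x * (\sum_(j < M) rC (nu j) * dd (F l) x (euler x (lshift S j))).
  transitivity (chi a b x * (\sum_(j < M) rC (nu j) * dd (F l) x (euler x (lshift S j))) + wx a b * (chi a b x * F l x)).
    rewrite /wx mulr_suml mulr_sumr -big_split; apply: eq_bigr => j _ /=; ring.
  by rewrite w0 mul0r addr0.
have -> : \sum_(i < S) \sum_(k < S) rC (nu i) * (chi a b x * mainterm l x i k +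
     (i == k)%:R * (((addf a psie) (rshift M k))%:R - (b (rshift M k))%:R) * (chi (addf a psie) b x * F l x)) =
   chi a b x * (\sum_(i < S) \sum_(k < S) rC (nu i) * mainterm l x i k) + wy (addf a psie) b * (chi (addf a psie) b x * F l x).
  rewrite /wy mulr_suml mulr_sumr -big_split; apply: eq_bigr => i _ /=.
  under eq_bigr => k _ do rewrite mulrDr; rewrite big_split /=; congr (_ + _).
    by rewrite mulr_sumr; apply: eq_bigr => k _; ring.
  have D (H : 'I_S -> C) : \sum_k (i == k)%:R * H k = H i.
    by rewrite (bigD1 i) //= eqxx mul1r big1 ?addr0 // => k; rewrite eq_sym => /negbTE ->; rewrite mul0r.
  rewrite -(D (fun k => rC (nu i) * ((addf a psie (rshift M k))%:R - (b (rshift M k))%:R) * (chi (addf a psie) b x * F l x))).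
  by apply: eq_bigr => k _; ring.
move: E; set S1 := \sum_(j < M) _; set S2 := \sum_(i < S) _; set t := rC _ => E.
have -> : S1 = - (t * (S2 + G l x)) by apply/eqP; rewrite -addr_eq0 E.
by rewrite mulrN mulrN mulrCA mulKf ?t0 //; ring.
Qed.

(* Integrate against [chi a b]. At order 1 the equation multiplies the average by
   [wx a b], the weight of the x-exponents. If they agree, divide by [t]: all terms
   of [At] but the one of exponent [gam i] have a nonzero x-weight, hence vanish,
   and what remains is the average of [psi chi F] times the weight of the
   y-exponents, the factor psi being there to reach every [chi]. *)
Theorem small_laurent a b : (exists i, a i <> b i) -> small (fun l x => chi a b x * F l x).
Proof.
move=> ab; have sE m (H : 'I_m -> R) : rC (\sum_j H j) = \sum_j rC (H j).
  by apply: (big_morph (@rC R)); [exact: rCD|exact: rC0].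
have [wx0|wx0] := eqVneq (wx a b) 0; last exact: step_x.
have xeq j : a (lshift S j) = b (lshift S j).
  apply: (indep (a := fun j => a (lshift S j)) (b := fun j => b (lshift S j))).
  apply: (@rC_inj R); apply/eqP; rewrite -subr_eq0 !sE -sumrB; apply/eqP; apply: etrans wx0; apply: eq_bigr => i _.
  by rewrite !rCM !rCn; ring.
(* [step_y] only reaches monomials carrying a factor psi; adding [psie] to both exponents leaves the
   monomial unchanged on the torus and preserves the weights. *)
have wyn : wy (addf a psie) (addf b psie) != 0.
  apply/eqP => h; case: ab => i; apply; rewrite -(splitK i).
  case: (fintype.split i) => [j|k] /=; first exact: xeq.
  apply: (indep (a := fun j => a (rshift M j)) (b := fun j => b (rshift M j))).
  apply: (@rC_inj R); apply/eqP; rewrite -subr_eq0 !sE -sumrB; apply/eqP; apply: etrans h; apply: eq_bigr => q _.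
  by rewrite !rCM !rCn /addf !natrD; ring.
have wx1 : wx a (addf b psie) = 0.
  by rewrite -wx0; apply: eq_bigr => j _; rewrite /addf psie_l addn0.
apply: small_ext (step_y wx1 wyn) => //; exists 0%N => l _ x xt.
by rewrite -(chi_cancel rad0 a b psie xt).
Qed.
End Laurent.

(** * Leading parts *)

Section Leading.
Variable R : realType.
Local Notation C := (cplx R).
Variables M S : nat.
Local Notation V := 'rV[C]_(M + S).

Definition scale_y (t : C) (x : V) : V := row_mx (lsubmx x) (t *: rsubmx x).

Lemma scale_y_l t x j : scale_y t x 0 (lshift S j) = x 0 (lshift S j).
Proof. by rewrite row_mxEl mxE. Qed.
Lemma scale_y_r t x k : scale_y t x 0 (rshift M k) = t * x 0 (rshift M k).
Proof. by rewrite row_mxEr !mxE. Qed.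
Lemma scale_yE t x i : scale_y t x 0 i = (if fintype.split i is inl _ then 1 else t) * x 0 i.
Proof.
rewrite -{1 3}(splitK i); case: (fintype.split i) => j /=; first by rewrite scale_y_l mul1r.
exact: scale_y_r.
Qed.
Lemma scale_yM t u x : scale_y t (scale_y u x) = scale_y (t * u) x.
Proof. by apply/rowP => i; rewrite !scale_yE; case: fintype.split => j; ring. Qed.
Lemma scale_y1 x : scale_y 1 x = x.
Proof. by apply/rowP => i; rewrite scale_yE; case: fintype.split => j; rewrite mul1r. Qed.
Lemma nr_scale_y t x : nr t <= 1 -> nr (scale_y t x) <= nr x.
Proof.
move=> t1; apply: nr_le_mx => [|i j]; first exact: nr_ge0.
rewrite (ord1 i) -(splitK j); case: (fintype.split j) => k /=; rewrite ?scale_y_l ?scale_y_r.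
  exact: nr_coord.
by rewrite (nrM t); have := nr_coord x 0 (rshift M k); have := nr_ge0 (x 0 (rshift M k)); nra.
Qed.

Lemma scale_y_affine : exists A B : 'M[C]_(M + S), forall t x, scale_y t x = x *m A + t *: (x *m B).
Proof.
exists (block_mx 1%:M 0 0 0), (block_mx 0 0 0 1%:M) => t x.
rewrite -{2 3}(hsubmxK x) !mul_row_block !mulmx0 !mulmx1 !addr0 !add0r scale_row_mx scaler0.
by rewrite add_row_mx addr0 add0r.
Qed.

Lemma diff_scale_y t x : differentiable (scale_y t) x /\ forall v, 'd (scale_y t) x v = scale_y t v.
Proof.
have [A [B hAB]] := scale_y_affine.
have [h1 h2] := diff_affine (A + t *: B) 0 x.
have E : (fun y : V => y *m (A + t *: B) + 0) = scale_y t.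
  by rewrite funeqE => y; rewrite addr0 mulmxDr -scalemxAr hAB.
rewrite E in h1 h2; split; first exact: h1.
by move=> v; rewrite h2 -[RHS](congr1 (fun f => f v) E) addr0.
Qed.

Lemma dd_scale_y (P : V -> C) t x : differentiable P (scale_y t x) ->
  differentiable (fun x => P (scale_y t x)) x /\ forall v, dd (fun x => P (scale_y t x)) x v = dd P (scale_y t x) (scale_y t v).
Proof.
move=> dP; have [d1 e1] := diff_scale_y t x.
have [h1 h2] := diff_comp_dd d1 dP; split; first exact: h1.
by move=> v; rewrite h2 e1.
Qed.

(** Expand t |-> P(x, t y) by [coef_family]: P0 is the first coefficient which is not identically 0,
    and the Taylor remainder gives the rate K t. *)
Lemma leading (P : V -> C) (r B : R) : 0 < r -> 0 <= B ->
  (forall x, nr x < r -> differentiable P x) -> (forall x, nr x < r -> nr (P x) <= B) ->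
  (exists2 x, nr x < r & P x != 0) ->
  exists d P0 K, [/\ 0 <= K, forall x, nr x < r -> differentiable P0 x, forall x, nr x < r -> nr (P0 x) <= K,
    exists2 x, nr x < r & P0 x != 0 &
    forall x (t : R), nr x < r -> 0 < t <= 1 / 4 -> nr (rC (t ^- d) * P (scale_y (rC t) x) - P0 x) <= K * t].
Proof.
move=> r0 B0 dP PB [x0 x0r Px0].
have [A [Bm hAB]] := scale_y_affine.
have in_r t x : nr t < 1 -> nr x < r -> nr (scale_y t x) < r.
  by move=> t1 xr; apply: le_lt_trans xr; apply: nr_scale_y; exact: ltW.
have [||||c [cB cd cE]] := @coef_family R V (fun t x => P (scale_y t x)) (fun x => nr x < r) 1 B ltr01 B0.
- move=> p Up; exists (r - nr p); first by rewrite subr_gt0.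
  by move=> q qp; have := nr_leB q p; lra.
- by move=> t p t1 pr; exact: (dd_scale_y (dP _ (in_r t p t1 pr))).1.
- move=> t p t1 pr.
  have -> : (fun s => P (scale_y s p)) = (fun s => P (p *m A + s *: (p *m Bm))) by rewrite funeqE => s; rewrite hAB.
  by apply: (diff_line _).1; rewrite -hAB; apply: dP; exact: in_r.
- by move=> t p t1 pr; apply: PB; exact: in_r.
have [d [[x1 x1r cx1] cmin]] : exists k, (exists2 y, nr y < r & c k y != 0) /\ forall l, (l < k)%N -> forall y, nr y < r -> c l y = 0.
  apply: contrapT => nk.
  have c0 l : forall y, nr y < r -> c l y = 0.
    elim/ltn_ind: l => l ihl y yr; apply: contrapT => cy; apply: nk.
    by exists l; split; [exists y => //; apply/eqP|].
  move/eqP: Px0; apply; apply: (identity dP PB (p := 0)) => //; first by rewrite nr0.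
  exists (r / 8) => [|q]; first by pos.
  rewrite subr0 => qr.
  have t8 : nr (rC (1 / 8 : R)) = 1 / 8 by rewrite nr_rC ger0_norm //; lra.
  (* If all coefficients vanished, so would P near 0: with |q| < r/8, multiplying y by 8 stays in
     the ball, and q is recovered at t = 1/8, where the expansion is valid. *)
  pose q' := scale_y (rC 8) q.
  have -> : q = scale_y (rC (1 / 8)) q'.
    by rewrite /q' scale_yM -rCM mul1r mulVf ?rC1 ?scale_y1 // lt0r_neq0.
  have q'r : nr q' < r.
    apply: nr_lt_mx => // i j; rewrite (ord1 i) -(splitK j); case: (fintype.split j) => k /=; rewrite ?scale_y_l ?scale_y_r.
      by have := nr_coord q 0 (lshift S k); lra.
    by rewrite (nrM (rC 8)) nr_rC ger0_norm //; have := nr_coord q 0 (rshift M k); lra.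
  have q1 : 0 <= (1 / 4 : R) < 1 by apply/andP; split; lra.
  apply: (small_const (A := 8 * B) (k0 := 0%N) q1) => m _.
  have := cE q' m (rC (1 / 8)) q'r; rewrite t8 => /(_ ltac:(lra)).
  rewrite big1 ?subr0 => [|l _]; last by rewrite c0 // mul0r.
  by rewrite (_ : 1 / 8 * (2 / 1) = 1 / 4 :> R) //; field.
exists d, (c d), (2 * B * (2 / 1) ^+ d + 8 * B * (2 / 1) ^+ d.+1).
have K1 : 0 <= 2 * B * (2 / 1) ^+ d :> R by rewrite divr1; pos.
have K2 : 0 <= 8 * B * (2 / 1) ^+ d.+1 :> R by rewrite divr1; pos.
split.
- by apply: addr_ge0.
- exact: cd.
- by move=> x xr; apply: le_trans (cB d x xr) _; rewrite lerDl.
- by exists x1.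
move=> x t xr /andP[t0 t4].
have nt : nr (rC t) = t by rewrite nr_rC gtr0_norm.
have td : 0 < t ^+ d by exact: exprn_gt0.
have := cE x d.+1 (rC t) xr; rewrite nt => /(_ ltac:(lra)).
rewrite big_ord_recr /= big1 => [|l _]; last by rewrite cmin // mul0r.
rewrite add0r => h.
have -> : rC (t ^- d) * P (scale_y (rC t) x) - c d x = rC (t ^- d) * (P (scale_y (rC t) x) - c d x * rC t ^+ d).
  rewrite mulrBr mulrCA -rCX -rCM mulVf ?rC1 ?mulr1 //; exact: lt0r_neq0.
rewrite (nrM (rC _)) nr_rC gtr0_norm ?invr_gt0 // ler_pdivrMl //.
apply: le_trans h _.
have -> : 8 * B * (t * (2 / 1)) ^+ d.+1 = t ^+ d * (8 * B * (2 / 1) ^+ d.+1 * t).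
  by rewrite (exprMn _ t) [t ^+ d.+1]exprSr; ring.
by rewrite ler_pM2l // ler_wpM2r ?(ltW t0) // lerDr.
Qed.
End Leading.

(** * Recovering power series from averages *)

Section Coef.
Variable R : realType.
Local Notation C := (cplx R).
(** Uniform convergence of the box sums without a rate: the form of [power_series] that survives
    linear combinations. *)
Definition expands n (f : 'rV[C]_n -> C) (c : ('I_n -> nat) -> C) (rho : R) :=
  forall e : R, 0 < e -> exists m0, forall m, (m0 <= m)%N -> forall x, nr x <= rho -> nr (f x - boxsum m c x) <= e.

Lemma expands_ball n (f : 'rV[C]_n -> C) (r B : R) : 0 < r -> 0 <= B ->
  (forall x, nr x < r -> differentiable f x) -> (forall x, nr x < r -> nr (f x) <= B) ->
  exists c, expands f c (r / 4).
Proof.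
move=> r0 B0 df fB; have [c [_ hc]] := power_series r0 B0 df fB.
exists c => e e0; have h16 : 0 < 16 ^+ n * B + 1 :> R by have := exprn_ge0 n (ler0n R 16); nra.
have q1 : 0 <= (1 / 2 : R) < 1 by apply/andP; split; lra.
have [m0 hm0] := pow_small q1 (divr_gt0 e0 h16).
exists m0 => m mm x xr; apply: le_trans (hc m x xr) _.
have h := hm0 m mm; rewrite ler_pdivlMr // in h.
have h2 : nr x * (2 / r) <= 1 / 2.
  by rewrite mulrA ler_pdivrMr //; nra.
have h3 : (nr x * (2 / r)) ^+ m <= (1 / 2) ^+ m.
  by rewrite lerXn2r // nnegrE; [apply: mulr_ge0; [exact: nr_ge0|rewrite divr_ge0 // ltW]|lra].
have h4 : 0 <= (1 / 2) ^+ m :> R by apply: exprn_ge0; lra.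
have h5 : 0 <= 16 ^+ n * B by apply: mulr_ge0 => //; exact: exprn_ge0.
move: h h3 h4 h5; set u := _ ^+ m; set w := _ ^+ m; set q := _ * B => h h3 h4 h5.
clearbody u w q; nra.
Qed.

Lemma boxsumB n m (p q : ('I_n -> nat) -> C) (k : C) x :
  boxsum m (fun a => p a - k * q a) x = boxsum m p x - k * boxsum m q x.
Proof.
by rewrite /boxsum mulr_sumr -sumrB; apply: eq_bigr => a _; ring.
Qed.

Lemma expands_comb n (f g : 'rV[C]_n -> C) p q (k : C) (rho : R) : expands f p rho -> expands g q rho ->
  expands (fun x => f x - k * g x) (fun a => p a - k * q a) rho.
Proof.
move=> hf hg e e0; have k1 : 0 < nr k + 1 by have := nr_ge0 k; lra.
have e2 : 0 < e / 2 by lra.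
have [m1 h1] := hf _ e2.
have [m2 h2] := hg _ (divr_gt0 e2 k1).
exists (maxn m1 m2) => m; rewrite geq_max => /andP[mm1 mm2] x xr.
rewrite boxsumB.
have -> : f x - k * g x - (boxsum m p x - k * boxsum m q x) = (f x - boxsum m p x) - k * (g x - boxsum m q x) by ring.
apply: le_trans (nrB _ _) _; rewrite (nrM k).
have a1 := h1 m mm1 x xr; have a2 := h2 m mm2 x xr; rewrite ler_pdivlMr // in a2.
have := nr_ge0 k; have := nr_ge0 (g x - boxsum m q x); nra.
Qed.

Lemma expands_zero n (f : 'rV[C]_n -> C) p (rho : R) : expands f p rho -> (forall a, p a = 0) ->
  forall x, nr x <= rho -> f x = 0.
Proof.
move=> hf p0 x xr; apply/eqP; rewrite -nr_eq0 eq_le nr_ge0 andbT; apply/ler_addgt0Pl => e e0.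
have [m0 h] := hf e e0; have := h m0 (leqnn _) x xr.
by rewrite /boxsum big1 ?subr0 ?addr0 // => a _; rewrite p0 mul0r.
Qed.

Section Torus.
Variable z : nat -> C.
Hypothesis zM : forall k, z k ^+ (2 ^ k.+1) = 1.
Hypothesis zn : forall k, z k != 1.
Hypothesis z1 : forall k, nr (z k) = 1.
Hypothesis zlim : tendsto z 1.
Variable n : nat.
Variable s : 'I_n -> R.
Hypothesis s0 : forall i, 0 < s i.
Variable rho : R.
Hypothesis srho : forall i, s i <= rho.
Hypothesis rho0 : 0 <= rho.
Local Notation V := 'rV[C]_n.
Local Notation torus := (torus s).
Local Notation small := (small z s).
Local Notation unif_small := (unif_small s).

Lemma torus_rho x : torus x -> nr x <= rho.
Proof. by move=> xt; apply: nr_le_mx => // i j; rewrite (ord1 i) xt. Qed.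

(** The case F = 1 of the hypothesis [sF], whence the factor 1: it lets [coef_extract] serve both
    [P] and [Q * F]. *)
Lemma chi_small a b : (exists i, a i <> b i) -> small (fun _ x => chi a b x * 1).
Proof.
move=> [i ab].
have n1 : near_torus_unif s (fun (_ : nat) (_ : V) => 1 : C).
  exists 1 => //; exists 1, 0%N => l _ x q _ _; split; first exact: (diff_const _ _).1.
  by rewrite nr1.
have [L hL] := by_parts zM zn z1 zlim s0 a b i n1.
have w0 : (a i)%:R - (b i)%:R != 0 :> C by rewrite subr_eq0 eqr_nat; apply/eqP.
apply: small_ext (small_scal ((a i)%:R - (b i)%:R)^-1 (small_null hL)) => //.
by exists 0%N => l _ x _; rewrite (diff_const _ _).2 mulr0 add0r mulKf.
Qed.

Variable F : nat -> V -> C.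
Hypothesis bF : bounded_torus s F.
Hypothesis sF : forall a b, (exists i, a i <> b i) -> small (fun l x => chi a b x * F l x).

Let o : 'I_n -> nat := fun=> 0%N.

(** Integration against x^(-ga) isolates the coefficient of x^ga in [f], since the other monomials
    meet only negligible Laurent coefficients of [F]. *)
Lemma coef_extract f p ga : expands f p rho -> small (fun l x => chi o ga x * f x * F l x - p ga * F l x).
Proof.
move=> fe; apply: small_approx => // e e0.
have bq : bounded_torus s (fun l x => chi o ga x * F l x).
  by apply: bounded_torus_mul => //; apply: bounded_torus_near_torus; exact: near_torus_chi.
have [B [L hB]] := bq.
have BB : 0 < `|B| + 1 by rewrite ltr_wpDl.
have [m0 hm0] := fe _ (divr_gt0 e0 BB).
pose m := (maxn m0 (\max_j ga j).+1)%N.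
have gm j : (ga j < m)%N.
  by rewrite leq_max ltnS; apply/orP; right; exact: (leq_bigmax j).
have {}hm0 := hm0 m (leq_maxl _ _).
pose g : {ffun 'I_n -> 'I_m} := [ffun j => Ordinal (gm j)].
have gE : (fun j => val (g j)) = ga by rewrite funeqE => j; rewrite ffunE.
exists (fun l x => chi o ga x * boxsum m p x * F l x - p ga * F l x); last first.
  exists L => l lL x xt.
  have -> : chi o ga x * f x * F l x - p ga * F l x - (chi o ga x * boxsum m p x * F l x - p ga * F l x) =
    chi o ga x * F l x * (f x - boxsum m p x) by ring.
  rewrite (nrM (chi o ga x * F l x)).
  have h1 := hm0 x (torus_rho xt); have h2 := hB l lL x xt.
  rewrite ler_pdivlMr // in h1; have := nr_ge0 (f x - boxsum m p x); have := ler_norm B.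
  have := nr_ge0 (chi o ga x * F l x); nra.
have s1 : small (fun l x => \sum_(al | al != g) p (fun j => val (al j)) * (chi (fun j => val (al j)) ga x * F l x)).
  under eq_fun => l do under eq_fun => x do rewrite big_mkcond.
  apply: small_sum => // al; case: eqP => /= [_|alga].
    by apply: (small_unif_small z1 s0) => d d0; exists 0%N => l _ x _; rewrite nr0 ltW.
  apply: small_scal; apply: sF; apply: contrapT => h; apply: alga; apply/ffunP => j; apply: val_inj.
  have <- : ga j = val (g j) by rewrite ffunE.
  by apply: contrapT => hj; apply: h; exists j.
apply: small_ext s1 => //; exists 0%N => l _ x xt.
have D (H : {ffun 'I_n -> 'I_m} -> C) : \sum_al H al = H g + \sum_(al | al != g) H al by rewrite (bigD1 g).
have c1 a : chi o ga x * mon a x = chi a ga x.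
  by rewrite /chi {1}/mon big1 ?mul1r 1?mulrC // => i _; rewrite expr0.
have c2 : chi ga ga x = 1.
  have := chi_cancel s0 o o ga xt; rewrite /o /= => ->.
  by rewrite /chi /mon /invmon !big1 ?mulr1 // => i _; rewrite expr0.
rewrite /boxsum D gE mulrDr mulrCA c1 c2 mulr1 mulrDl addrAC subrr add0r mulr_sumr mulr_suml.
by apply: eq_bigr => al _; rewrite -(c1 (fun j => val (al j))); ring.
Qed.
End Torus.

Section Proportional.
Variable z : nat -> C.
Hypothesis zM : forall k, z k ^+ (2 ^ k.+1) = 1.
Hypothesis zn : forall k, z k != 1.
Hypothesis z1 : forall k, nr (z k) = 1.
Hypothesis zlim : tendsto z 1.
Variable n : nat.
Variable s : 'I_n -> R.
Hypothesis s0 : forall i, 0 < s i.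
Variable r : R.
Hypothesis srho : forall i, s i <= r / 4.
Hypothesis r0 : 0 < r.
Local Notation V := 'rV[C]_n.
Variable F : nat -> V -> C.
Hypothesis bF : bounded_torus s F.
Hypothesis sF : forall a b, (exists i, a i <> b i) -> small z s (fun l x => chi a b x * F l x).
Variables P Q : V -> C.
Variable B : R.
Hypothesis dP : forall x, nr x < r -> differentiable P x.
Hypothesis dQ : forall x, nr x < r -> differentiable Q x.
Hypothesis PB : forall x, nr x < r -> nr (P x) <= B.
Hypothesis QB : forall x, nr x < r -> nr (Q x) <= B.
Hypothesis Q0 : exists2 x, nr x < r & Q x != 0.
Hypothesis PQ : unif_small s (fun l x => P x - Q x * F l x).

(* All nontrivial Laurent coefficients of [F] are negligible, so that the coefficients
   of [P = Q F] are in the limit those of [Q] times the mean value of [F]. *)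
Theorem proportional : exists c, forall x, nr x < r -> P x = c * Q x.
Proof.
have B0 : 0 <= B by apply: le_trans (PB (x := 0) _); [exact: nr_ge0|rewrite nr0].
have r4 : 0 <= r / 4 by rewrite divr_ge0 // ltW.
have [p hp] := expands_ball r0 B0 dP PB.
have [q hq] := expands_ball r0 B0 dQ QB.
pose o : 'I_n -> nat := fun=> 0%N.
have b1 : bounded_torus s (fun (_ : nat) (_ : V) => 1 : C) by apply: bounded_torus_near_torus; exact: near_torus_const.
have key ga : small z s (fun l x => p ga - q ga * F l x).
  have s1 := coef_extract z1 s0 srho r4 b1 (chi_small zM zn z1 zlim s0) ga hp.
  have s2 := coef_extract z1 s0 srho r4 bF sF ga hq.
  have u3 : unif_small s (fun l x => (P x - Q x * F l x) * chi o ga x).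
    by apply: unif_small_bnd => //; apply: bounded_torus_near_torus; exact: near_torus_chi.
  have s3 := small_unif_small z1 s0 u3.
  apply: small_ext (small_add (small_scal (-1) s1) (small_add s2 s3)) => //.
  by exists 0%N => l _ x _; ring.
(* The mean of [F] need not converge; eliminating it between two exponents leaves a constant, which
   is 0 because it is [small]. *)
have cross ga ga' : q ga' * p ga = q ga * p ga'.
  apply/eqP; rewrite -subr_eq0; apply/eqP; apply: (@small_cst R z n s).
  apply: small_ext (small_add (small_scal (q ga') (key ga)) (small_scal (- q ga) (key ga'))) => //.
  by exists 0%N => l _ x _; ring.
have r8 : 0 < r / 8 by rewrite divr_gt0.
have [ga qga] : exists ga, q ga != 0.
  apply: contrapT => nq; have [x0 x0r] := Q0; apply/negP; rewrite negbK; apply/eqP.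
  apply: (identity dQ QB (p := 0)) => //; first by rewrite nr0.
  exists (r / 8) => // y; rewrite subr0 => yr; apply: (expands_zero hq); last by lra.
  by move=> a; apply/eqP; apply: contrapT => /negP h; apply: nq; exists a.
exists (p ga / q ga) => x xr; apply/eqP; rewrite -subr_eq0; apply/eqP; move: x xr.
apply: (@identity R _ (fun x => P x - p ga / q ga * Q x) r (B + nr (p ga / q ga) * B) _ _ 0).
- move=> x xr; exact: (diff_sub (dP xr) (diff_scal _ (dQ xr)).1).1.
- move=> x xr; apply: le_trans (nrB _ _) _; rewrite (nrM (p ga / q ga)).
  by apply: lerD; [exact: PB|apply: ler_wpM2l; [exact: nr_ge0|exact: QB]].
- by rewrite nr0.
exists (r / 8) => // y; rewrite subr0 => yr.
apply: (expands_zero (expands_comb (p ga / q ga) hp hq)); last by lra.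
by move=> a; rewrite mulrAC [p ga * _]mulrC -cross [_ * p a]mulrC mulfK // subrr.
Qed.
End Proportional.
End Coef.

Lemma ball_lipschitz (R : realType) (V : normedModType (cplx R)) (f : V -> cplx R) p (r B : R) : 0 < r ->
  (forall q, nr (q - p) < r -> differentiable f q) ->
  (forall q, nr (q - p) < r -> nr (f q) <= B) ->
  forall q, nr (q - p) <= r / 4 -> nr (f q - f p) <= 16 * B / r * nr (q - p).
Proof.
move=> r0 df fB q qr.
have [->|qp] := eqVneq q p; first by rewrite !subrr !nr0 mulr0.
have n0 : 0 < nr (q - p) by rewrite nr_gt0 subr_eq0.
have nn : nr (rC (nr (q - p))) = nr (q - p) by rewrite nr_rC gtr0_norm.
pose u := rC (nr (q - p))^-1 *: (q - p).
have u1 : nr u <= 1 by rewrite /u nrZ nr_rC gtr0_norm ?invr_gt0 // mulVf ?gt_eqF.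
have [c [_ c0 _ hc]] := line_taylor r0 u1 df fB.
have := hc 1%N (rC (nr (q - p))); rewrite nn => /(_ qr).
rewrite big_ord_recl big_ord0 c0 expr0 mulr1 addr0 expr1 /u scalerA -rCM mulfV ?gt_eqF // rC1 scale1r (_ : p + (q - p) = q); last by rewrite addrC subrK.
by move=> h; apply: le_trans h _; rewrite le_eqVlt; apply/orP; left; apply/eqP; ring.
Qed.

Section Lead.
Variable R : realType.
Local Notation C := (cplx R).
Variables M S : nat.
Local Notation V := 'rV[C]_(M + S).
Variable r : R.
Hypothesis r0 : 0 < r.

(* [P0] is the part of lowest degree [d] in y of [P], characterized as the limit of
   [t^-d P(x, t y)]. *)
Definition leading_part (P : V -> C) d P0 (K : R) := [/\ 0 <= K, forall x, nr x < r -> differentiable P0 x,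
    forall x, nr x < r -> nr (P0 x) <= K, exists2 x, nr x < r & P0 x != 0 &
    forall x (t : R), nr x < r -> 0 < t <= 1 / 4 -> nr (rC (t ^- d) * P (scale_y (rC t) x) - P0 x) <= K * t].

Lemma small_t (K e : R) : 0 <= K -> 0 < e -> exists2 t : R, 0 < t <= 1 / 4 & K * t <= e.
Proof.
move=> K0 e0; exists (Num.min (1 / 4) (e / (K + 1))).
  rewrite ge_min lexx andbT lt_min; apply/andP; split; first by lra.
  by rewrite divr_gt0 //; lra.
have h : Num.min (1 / 4) (e / (K + 1)) <= e / (K + 1) by rewrite ge_min lexx orbT.
have K1 : 0 < K + 1 by lra.
have h2 : e / (K + 1) * K <= e.
  by rewrite mulrAC ler_pdivrMr //; nra.
by apply: le_trans h2; rewrite mulrC; apply: ler_wpM2r.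
Qed.

Lemma zero_of_small (K : R) (a : C) : 0 <= K -> (forall t : R, 0 < t <= 1 / 4 -> nr a <= K * t) -> a = 0.
Proof.
move=> K0 h; apply/eqP; rewrite -nr_eq0 eq_le nr_ge0 andbT; apply/ler_addgt0Pr => e e0.
by have [t /h h1 h2] := small_t K0 e0; lra.
Qed.

Lemma scale_in (t : R) (x : V) : 0 < t <= 1 -> nr x < r -> nr (scale_y (rC t) x) < r.
Proof.
by move=> /andP[t0 t1] xr; apply: le_lt_trans xr; apply: nr_scale_y; rewrite nr_rC gtr0_norm.
Qed.

(** Compare the limits along t and along t/2. Homogeneity under the single factor 1/2 already
    determines the degree. *)
Lemma leading_part_homog P d P0 K : leading_part P d P0 K -> forall x, nr x < r ->
  P0 (scale_y (rC (1 / 2)) x) = rC ((1 / 2) ^+ d) * P0 x.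
Proof.
move=> [K0 _ _ _ hP] x xr; apply/eqP; rewrite -subr_eq0; apply/eqP.
have h12 : 0 <= (1 / 2) ^+ d :> R by apply: exprn_ge0; lra.
have h1d : (1 / 2) ^+ d <= 1 :> R by apply: exprn_ile1; lra.
apply: (zero_of_small (K := 2 * K)) => [|t /andP[t0 t4]]; first by lra.
have hx : nr (scale_y (rC (1 / 2)) x) < r by apply: scale_in => //; apply/andP; split; lra.
have e1 := hP _ t hx ltac:(by apply/andP; split).
have e2 := hP _ (t / 2) xr ltac:(by apply/andP; split; lra).
rewrite scale_yM -rCM (_ : t * (1 / 2) = t / 2) in e1; last by ring.
set a := P0 (scale_y _ x) in e1 *; set b := P0 x in e2 *; set w := P _ in e1 e2.
have -> : a - rC ((1 / 2) ^+ d) * b = rC ((1 / 2) ^+ d) * (rC ((t / 2) ^- d) * w - b) - (rC (t ^- d) * w - a).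
  have -> : rC (t ^- d) = rC ((1 / 2) ^+ d) * rC ((t / 2) ^- d).
    rewrite -rCM; congr rC; rewrite -!exprVn -exprMn; congr (_ ^+ d).
    by rewrite invfM invrK; field; rewrite gt_eqF.
  ring.
apply: le_trans (nrB _ _) _; rewrite (nrM (rC ((1/2) ^+ d))) nr_rC ger0_norm //.
have := nr_ge0 (rC ((t / 2) ^- d) * w - b).
have : K * (t / 2) <= K * t by apply: ler_wpM2l => //; lra.
move: e1 e2; set u := nr _; set v := nr _; set g := _ ^+ d in h12 h1d *; move=> e1 e2 h3 h4.
clearbody u v g; nra.
Qed.

Lemma leading_part_order P d P0 K Q e Q0 K' c : leading_part P d P0 K -> leading_part Q e Q0 K' ->
  (forall x, nr x < r -> P0 x = c * Q0 x) -> d = e.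
Proof.
move=> lP lQ PQ; have hP := leading_part_homog lP; have hQ := leading_part_homog lQ.
case: lP => _ _ _ [x xr Px] _.
have hx : nr (scale_y (rC (1 / 2)) x) < r by apply: scale_in => //; apply/andP; split; lra.
have := hP x xr; rewrite PQ // hQ // (PQ x) // mulrCA -(PQ x) // => /(mulIf Px) /rC_inj E.
have h2 : (2 : R) ^+ d = 2 ^+ e.
  by apply: invr_inj; rewrite -!exprVn; move: E; rewrite !mul1r.
by apply: (ieexprIn (x := 2 : R)) => //; apply/eqP; lra.
Qed.
End Lead.

(** * The vector field in adapted coordinates *)

Section Field.
Variable R : realType.
Local Notation C := (cplx R).
Variables M S : nat.
Local Notation V := 'rV[C]_(M + S).
Variable nu : nat -> R.
Variable jdx : 'I_S -> 'I_M.
Variable gam : 'I_S -> 'I_M -> nat.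
Variable bx : 'I_M -> nat.
Hypothesis gam_bx : forall i j, (gam i j <= bx j)%N.
Variable At : 'I_M -> 'I_S -> 'rV[C]_M -> C.

(* In coordinates adapted to the distribution its basis is [frame], and the vector
   field is [normal_field]; [jdx i] and [gam i] locate the power series coefficients
   of the forms which are a basis of the span of all of them. *)
Definition normal_coef (j : 'I_M) (X : V) : C :=
  mon bx (lsubmx X) * (rC (nu j) * X 0 (lshift S j)) +
  mon (@psie M S) X * \sum_(i | jdx i == j) rC (nu i) * X 0 (rshift M i) * mon (fun q => bx q - gam i q)%N (lsubmx X).
Definition frame (j : 'I_M) (X : V) : V :=
  evec R (lshift S j) + \sum_k At j k (lsubmx X) *: evec R (rshift M k).
Definition normal_field (X : V) : V := \sum_j normal_coef j X *: frame j X.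

Lemma lsub_scale_y t (x : V) : lsubmx (scale_y t x) = lsubmx x.
Proof. by rewrite /scale_y row_mxKl. Qed.

Lemma mon_sub (al be : 'I_M -> nat) (x : 'rV[C]_M) : (forall j, (be j <= al j)%N) -> (forall j, x 0 j != 0) ->
  mon (fun q => al q - be q)%N x = mon al x * invmon be x.
Proof.
move=> h x0; rewrite /mon /invmon -big_split; apply: eq_bigr => j _ /=.
by rewrite exprVn -expfB_cond //; rewrite (negbTE (x0 j)) add0n.
Qed.

Lemma scale_y_evec_l t j : scale_y t (evec R (lshift S j)) = evec R (lshift S j) :> V.
Proof.
apply/rowP => i; rewrite -(splitK i); case: (fintype.split i) => k /=; rewrite ?scale_y_l ?scale_y_r //.
by rewrite mxE eq_rlshift mulr0.
Qed.
Lemma scale_y_evec_r t k : scale_y t (evec R (rshift M k)) = t *: evec R (rshift M k) :> V.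
Proof.
apply/rowP => i; rewrite scale_yE [RHS]mxE; have := splitK i; case: fintype.split => l //= <-.
by rewrite mxE eq_lrshift !mulr0.
Qed.
Lemma scale_yD t u v : scale_y t (u + v) = scale_y t u + scale_y t v :> V.
Proof. by apply/rowP => i; rewrite !scale_yE [RHS]mxE !scale_yE [in LHS]mxE mulrDr. Qed.
Lemma scale_yZ t c v : scale_y t (c *: v) = c *: scale_y t v :> V.
Proof. by apply/rowP => i; rewrite !scale_yE [RHS]mxE !scale_yE [in LHS]mxE mulrCA. Qed.
Lemma scale_y_sum t (I : Type) (s : seq I) (F : I -> V) : scale_y t (\sum_(i <- s) F i) = \sum_(i <- s) scale_y t (F i).
Proof.
apply: (big_morph (scale_y t)); first exact: scale_yD.
by apply/rowP => i; rewrite !scale_yE mxE mulr0.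
Qed.

Lemma dd_evec (G : V -> C) (x : V) i : x 0 i != 0 -> dd G x (evec R i) = (x 0 i)^-1 * dd G x (euler x i).
Proof. by move=> x0; rewrite /euler ddZ mulKf. Qed.

(** The index [i] only witnesses S > 0; for S = 0 the monomial is 1 and does not scale. *)
Lemma mon_psie_scale t (x : V) (i : 'I_S) : mon (@psie M S) (scale_y t x) = t * mon (@psie M S) x.
Proof.
have S0 : (0 < S)%N by case: i => q; exact: leq_ltn_trans.
have E y : mon (@psie M S) y = y 0 (rshift M (Ordinal S0)).
  rewrite /mon (bigD1 (rshift M (Ordinal S0))) //= /psie /= addn0 eqxx expr1 big1 ?mulr1 // => q.
  by rewrite -val_eqE /= addn0 => /negbTE ->.
by rewrite !E scale_y_r.
Qed.

(** Pulling back by (x, y) |-> (x, t y) divides the y-components by t. In the term x^B they vanish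
    by the relation on [At]; in the other term psi and y_i supply t^2, leaving t along y and t^2
    along x. *)
Lemma normal_field_scaled (G : V -> C) (t : C) (x : V) : t != 0 -> (forall i, x 0 i != 0) ->
  (forall k, \sum_(j < M) rC (nu j) * x 0 (lshift S j) * At j k (lsubmx x) = 0) ->
  dd G x (scale_y t^-1 (normal_field (scale_y t x))) = mon bx (lsubmx x) *
   (\sum_(j < M) rC (nu j) * dd G x (euler x (lshift S j)) + t * (\sum_(i < S) \sum_(k < S) rC (nu i) *
     (chi (addf (@psie M S) (ey i)) (addf (extl (gam i)) (ey k)) x * At (jdx i) k (lsubmx x) * dd G x (euler x (rshift M k))) +
     t * \sum_(i < S) rC (nu i) * (chi (addf (@psie M S) (ey i)) (addf (extl (gam i)) (fun q => q == lshift S (jdx i))) x *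
        dd G x (euler x (lshift S (jdx i)))))).
Proof.
move=> t0 x0 rl; set X := scale_y t x.
have lX : lsubmx X = lsubmx x := lsub_scale_y t x.
have x0' j : lsubmx x 0 j != 0 by rewrite mxE.
pose al j := dd G x (evec R (lshift S j)); pose be k := dd G x (evec R (rshift M k)).
have E1 j : dd G x (scale_y t^-1 (frame j X)) = al j + t^-1 * \sum_(k < S) At j k (lsubmx x) * be k.
  rewrite /frame scale_yD scale_y_evec_l ddD scale_y_sum dd_sum lX mulr_sumr; congr (_ + _).
  by apply: eq_bigr => k _; rewrite scale_yZ scale_y_evec_r !ddZ mulrCA.
have dE : dd G x (scale_y t^-1 (normal_field X)) = \sum_(j < M) normal_coef j X * (al j + t^-1 * \sum_(k < S) At j k (lsubmx x) * be k).
  by rewrite /normal_field scale_y_sum dd_sum; apply: eq_bigr => j _; rewrite scale_yZ ddZ E1.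
rewrite dE.
pose w (i : 'I_S) (j : 'I_M) := rC (nu i) * X 0 (rshift M i) * mon (fun q => bx q - gam i q)%N (lsubmx x) *
   (al j + t^-1 * \sum_(k < S) At j k (lsubmx x) * be k).
have E2 : \sum_(j < M) normal_coef j X * (al j + t^-1 * \sum_(k < S) At j k (lsubmx x) * be k) =
   mon bx (lsubmx x) * (\sum_(j < M) rC (nu j) * x 0 (lshift S j) * al j) + mon (@psie M S) X * \sum_(i < S) w i (jdx i).
  have -> : \sum_(j < M) normal_coef j X * (al j + t^-1 * \sum_(k < S) At j k (lsubmx x) * be k) =
    \sum_(j < M) (mon bx (lsubmx x) * (rC (nu j) * x 0 (lshift S j) * al j) +
       mon bx (lsubmx x) * t^-1 * (\sum_(k < S) rC (nu j) * x 0 (lshift S j) * At j k (lsubmx x) * be k)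
      + mon (@psie M S) X * \sum_(i | jdx i == j) w i j).
    apply: eq_bigr => j _; rewrite /normal_coef lX scale_y_l.
    rewrite mulrDl -[in RHS]addrA addrA; congr (_ + _).
      under [in RHS]eq_bigr => k _ do rewrite -[_ * be k]mulrA.
      by rewrite -mulr_sumr; ring.
    by rewrite -mulrA mulr_suml.
  rewrite !big_split /= -!mulr_sumr; congr (_ + _ * _); last first.
    by rewrite [RHS](partition_big jdx xpredT) //=; apply: eq_bigr => j _; apply: eq_bigr => i /eqP ->.
  rewrite exchange_big /= [X in _ + _ * X]big1 ?mulr0 ?addr0 // => k _.
  by rewrite -mulr_suml rl mul0r.
rewrite E2 mulrDr; congr (_ + _).
  congr (_ * _); apply: eq_bigr => j _; rewrite /euler ddZ; exact: esym (mulrA _ _ _).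
have E3 i : mon (@psie M S) X * w i (jdx i) = mon bx (lsubmx x) * (t * (\sum_(k < S) rC (nu i) *
     (chi (addf (@psie M S) (ey i)) (addf (extl (gam i)) (ey k)) x * At (jdx i) k (lsubmx x) * dd G x (euler x (rshift M k))) +
     t * (rC (nu i) * (chi (addf (@psie M S) (ey i)) (addf (extl (gam i)) (fun q => q == lshift S (jdx i))) x *
        dd G x (euler x (lshift S (jdx i))))))).
  have monD n (a b : 'I_n -> nat) y : mon (addf a b) y = mon a y * mon b y :> C.
    by rewrite /mon -big_split; apply: eq_bigr => q _; rewrite /addf exprD.
  have invD n (a b : 'I_n -> nat) y : invmon (addf a b) y = invmon a y * invmon b y :> C.
    by rewrite /invmon -big_split; apply: eq_bigr => q _; rewrite /addf exprD.
  have mond (p : 'I_(M + S)) : mon (fun q => q == p : nat) x = x 0 p.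
    rewrite /mon (bigD1 p) //= eqxx expr1 big1 ?mulr1 // => q /negbTE ->; by rewrite expr0.
  have invd (p : 'I_(M + S)) : invmon (fun q => q == p : nat) x = (x 0 p)^-1.
    rewrite /invmon (bigD1 p) //= eqxx expr1 big1 ?mulr1 // => q /negbTE ->; by rewrite expr0.
  have inve : invmon (extl (gam i)) x = invmon (gam i) (lsubmx x).
    rewrite /invmon big_split_ord /= [X in _ * X]big1 ?mulr1 => [|k _]; last by rewrite extl_r expr0.
    by apply: eq_bigr => j _; rewrite extl_l mxE.
  rewrite (mon_psie_scale t x i) /w scale_y_r (mon_sub (gam_bx i) x0').
  have c1 p : chi (addf (@psie M S) (ey i)) (addf (extl (gam i)) (fun q => q == p)) x =
     mon (@psie M S) x * x 0 (rshift M i) * (invmon (gam i) (lsubmx x) * (x 0 p)^-1).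
    by rewrite /chi monD invD inve mond invd.
  rewrite c1 /al dd_evec //.
  under [in RHS]eq_bigr => k _ do rewrite c1.
  set mb := mon bx _; set ps := mon _ x; set ig := invmon _ _.
  have -> : \sum_(k < S) rC (nu i) * (ps * x 0 (rshift M i) * (ig * (x 0 (rshift M k))^-1) * At (jdx i) k (lsubmx x) * dd G x (euler x (rshift M k)))
     = rC (nu i) * ps * x 0 (rshift M i) * ig * \sum_(k < S) At (jdx i) k (lsubmx x) * be k.
    by rewrite mulr_sumr; apply: eq_bigr => k _; rewrite /be dd_evec //; ring.
  set A := \sum_(k < S) _; field; by rewrite t0 x0.
rewrite [LHS]mulr_sumr (eq_bigr _ (fun i _ => E3 i)) -[LHS]mulr_sumr; congr (_ * _).
rewrite -[LHS]mulr_sumr; congr (_ * _).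
by rewrite big_split; congr (_ + _); rewrite -[LHS]mulr_sumr.
Qed.
End Field.

(** * First integrals of the normal field *)

Section Main.
Variable R : realType.
Local Notation C := (cplx R).
Variables M S : nat.
Local Notation V := 'rV[C]_(M + S).
Variable nu : nat -> R.
Hypothesis indep : forall m (a b : 'I_m -> nat),
  \sum_(i < m) nu i * (a i)%:R = \sum_(i < m) nu i * (b i)%:R -> forall i, a i = b i.
Variable jdx : 'I_S -> 'I_M.
Variable gam : 'I_S -> 'I_M -> nat.
Variable bx : 'I_M -> nat.
Hypothesis gam_bx : forall i j, (gam i j <= bx j)%N.
Variable At : 'I_M -> 'I_S -> 'rV[C]_M -> C.
Variables r BA : R.
Hypothesis r0 : 0 < r.
Hypothesis Atb : forall j k x, nr x < r -> nr (At j k x) <= BA.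
Variable ca : 'I_M -> 'I_S -> ('I_M -> nat) -> C.
Hypothesis Ate : forall j k, expands (At j k) (ca j k) (r / 4).
Hypothesis Atd : forall i k, ca (jdx i) k (gam i) = (i == k)%:R.
Hypothesis rel : forall (x : 'rV[C]_M) k, nr x < r -> \sum_(j < M) rC (nu j) * x 0 j * At j k x = 0.
Local Notation normal_field := (normal_field nu jdx gam bx At).
Local Notation leading_part := (@leading_part R M S r).

(** Numerator of the differential of P/Q; unlike the latter it makes sense at the zeros of Q. *)
Definition wronskian (P Q : V -> C) x v := Q x * dd P x v - P x * dd Q x v.

Lemma nr_lsub (x : V) : nr (lsubmx x) <= nr x.
Proof.
by apply: nr_le_mx => [|i j]; [exact: nr_ge0|rewrite mxE; exact: nr_coord].
Qed.

Definition rescale (P : V -> C) d (l : nat) (x : V) : C :=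
  rC (((1 / 2) ^+ l) ^- d) * P (scale_y (rC ((1 / 2) ^+ l)) x).

Lemma dd_rescale P d l x : nr x < r -> (forall x, nr x < r -> differentiable P x) ->
  differentiable (rescale P d l) x /\ forall v, dd (rescale P d l) x v =
    rC (((1 / 2) ^+ l) ^- d) * dd P (scale_y (rC ((1 / 2) ^+ l)) x) (scale_y (rC ((1 / 2) ^+ l)) v).
Proof.
move=> xr dP.
have tr : nr (scale_y (rC ((1 / 2) ^+ l)) x) < r.
  apply: scale_in => //; apply/andP; split; first by apply: exprn_gt0; lra.
  by apply: exprn_ile1; lra.
have [h1 h2] := dd_scale_y (dP _ tr).
have [h3 h4] := diff_scal (rC (((1 / 2) ^+ l) ^- d)) h1; split; first exact: h3.
by move=> v; rewrite h4 h2.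
Qed.

Lemma dd_quot (P Q : V -> C) x : differentiable P x -> differentiable Q x -> Q x != 0 ->
  differentiable (fun y => P y * (Q y)^-1) x /\ forall v, dd (fun y => P y * (Q y)^-1) x v = (Q x)^-2 * wronskian P Q x v.
Proof.
move=> dP dQ q0; have [h1 h2] := diff_inv dQ q0.
have [h3 h4] := diff_mul dP h1; split; first exact: h3.
move=> v; rewrite h4 h2 /wronskian.
by move: (dd P x v) (dd Q x v) (P x) (Q x) q0 => a b c y y0; field.
Qed.

Section Pair.
Variables P Q : V -> C.
Hypothesis dP : forall x, nr x < r -> differentiable P x.
Hypothesis dQ : forall x, nr x < r -> differentiable Q x.
Hypothesis PQ : forall x, nr x < r -> wronskian P Q x (normal_field x) = 0.

(* After the rescaling (x, y) |-> (x, t y) the equation for the first integral [P/Q]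
   has the shape required by [small_laurent], and [P/Q] tends to [P0/Q0]. *)
Lemma leading_prop d P0 K e Q0 K' : leading_part P d P0 K -> leading_part Q e Q0 K' ->
  exists c, forall x, nr x < r -> P0 x = c * Q0 x.
Proof.
move=> [K0 dP0 P0B nP0 hP] [K'0 dQ0 Q0B nQ0 hQ].
have [z [zM zn z1 zlim]] := roots_of_unity R.
have r8 : 0 < r / 8 by rewrite divr_gt0.
have [s [s0r [dl dl0 hdl]]] := torus_nonzero r0 K'0 dQ0 Q0B nQ0 r8.
have s0 i : 0 < s i by case/andP: (s0r i).
have sr i : s i <= r / 4 by case/andP: (s0r i) => _ h; lra.
have r40 : 0 <= r / 4 by lra.
have torr x : torus s x -> nr x <= r / 8.
  by move=> xt; apply: nr_le_mx => [|i j]; [lra|rewrite (ord1 i) xt; case/andP: (s0r j) => _ /ltW].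
have torn x i : torus s x -> x 0 i != 0.
  by move=> xt; rewrite -nr_eq0 xt gt_eqF.
pose T l : R := (1 / 2) ^+ l.
have T0 l : 0 < T l by apply: exprn_gt0; lra.
have q1 : 0 <= (1 / 2 : R) < 1 by apply/andP; split; lra.
have [L1 hL1] := @pow_small R (1 / 2) (1 / 4) q1 ltac:(lra).
have T4 l : (L1 <= l)%N -> 0 < T l <= 1 / 4 by move=> h; rewrite T0; exact: hL1.
have KK : 0 < K' + 1 by lra.
have [L2 hL2] := @pow_small R (1 / 2) (dl / 4 / (K' + 1)) q1 (divr_gt0 (divr_gt0 dl0 (ltr0n _ 4)) KK).
pose L := maxn L1 L2.
have Qnear l x : (L <= l)%N -> nr x < r -> nr (rescale Q e l x - Q0 x) <= dl / 4.
  rewrite geq_max => /andP[l1 l2] xr; apply: le_trans (hQ x (T l) xr (T4 l l1)) _.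
  have := hL2 l l2; rewrite ler_pdivlMr // -/(T l); have := T0 l; nra.
have Pb l x : (L <= l)%N -> nr x < r -> nr (rescale P d l x) <= 2 * K.
  rewrite geq_max => /andP[l1 l2] xr.
  have h1 := hP x (T l) xr (T4 l l1); have h2 := P0B x xr.
  rewrite -[rescale P d l x](subrK (P0 x)); apply: le_trans (nrD _ _) _.
  have /andP[_ h3] := T4 l l1; rewrite -/(T l) in h1.
  move: h1; rewrite -/(rescale P d l x) => h1; have := T0 l.
  have : K * T l <= K by rewrite ler_piMr //; lra.
  lra.
(* Lipschitz constant of Q0 from balls of radius r/2; [dn] is at most r/8, a quarter of that radius.
   Near the torus the lower bound [dl] loses dl/4 to the move away from it and dl/4 to the
   replacement of Q0 by the rescaled Q. *)
pose c1 := 16 * K' / (r / 2).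
have c10 : 0 <= c1 by rewrite /c1 divr_ge0 //; [nra|lra].
have c11 : 0 < c1 + 1 by lra.
pose dn := Num.min (r / 8) (dl / 4 / (c1 + 1)).
have dn0 : 0 < dn by rewrite /dn lt_min r8 /=; rewrite !divr_gt0.
have Qlow l x q : (L <= l)%N -> torus s x -> nr (q - x) < dn -> nr q < r /\ dl / 2 <= nr (rescale Q e l q).
  move=> lL xt; rewrite /dn lt_min => /andP[qx1 qx2].
  have xr := torr x xt.
  have qr : nr q < r.
    have := nrD (q - x) x; rewrite subrK; lra.
  split=> //.
  have inb y : nr (y - x) < r / 2 -> nr y < r.
    by have := nrD (y - x) x; rewrite subrK; lra.
  have r2 : 0 < r / 2 by lra.
  have lip := ball_lipschitz r2 (fun y h => dQ0 y (inb y h)) (fun y h => Q0B y (inb y h)) (q := q) ltac:(lra).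
  rewrite -/c1 in lip.
  have h1 := hdl x xt; have h2 := Qnear l q lL qr.
  rewrite ltr_pdivlMr // in qx2.
  have h3 : c1 * nr (q - x) <= dl / 4 by have := nr_ge0 (q - x); nra.
  have h4 := nr_leB (Q0 x) (Q0 q); have h5 := nr_leB (Q0 q) (rescale Q e l q).
  by rewrite -(nrN (Q0 x - Q0 q)) opprB in h4; rewrite -(nrN (Q0 q - _)) opprB in h5; lra.
have Tn l : rC (T l) != 0 :> C by rewrite -(rC0 R) (inj_eq (@rC_inj R)) gt_eqF.
pose F l (x : V) := rescale P d l x * (rescale Q e l x)^-1.
have torx x : torus s x -> nr (x - x) < dn by rewrite subrr nr0.
have qn l x q : (L <= l)%N -> torus s x -> nr (q - x) < dn -> rescale Q e l q != 0.
  by move=> lL xt qx; rewrite -nr_gt0; have [_ h] := Qlow l x q lL xt qx; lra.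
have dF l x q : (L <= l)%N -> torus s x -> nr (q - x) < dn -> differentiable (F l) q /\
    forall v, dd (F l) q v = (rescale Q e l q)^-2 * wronskian (rescale P d l) (rescale Q e l) q v.
  move=> lL xt qx; have [qr _] := Qlow l x q lL xt qx.
  exact: (dd_quot (dd_rescale d l qr dP).1 (dd_rescale e l qr dQ).1 (qn l x q lL xt qx)).
have Fb l x q : (L <= l)%N -> torus s x -> nr (q - x) < dn -> nr (F l q) <= 2 * K / (dl / 2).
  move=> lL xt qx; have [qr ql] := Qlow l x q lL xt qx.
  have d2 : 0 < dl / 2 by lra.
  have qg : 0 < nr (rescale Q e l q) by lra.
  rewrite /F (nrM (rescale P d l q)) nrV; apply: ler_pM; [exact: nr_ge0|by rewrite invr_ge0 ltW| exact: Pb|].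
  by rewrite lef_pV2 // posrE.
have nF : near_torus_unif s F.
  exists dn => //; exists (2 * K / (dl / 2)), L => l lL x q xt qx.
  by split; [exact: (dF l x q lL xt qx).1 | exact: (Fb l x q)].
have bF := bounded_torus_near_torus_unif nF.
have lr (x : V) : torus s x -> nr (lsubmx x) < r.
  by move=> /torr h; apply: le_lt_trans (nr_lsub x) _; lra.
(* The x-derivatives coming from the psi-term, of order t^2: after the factor t of [main_eq] is
   taken out they still carry a t. *)
pose G l (x : V) : C := rC (T l) * \sum_(i < S) rC (nu i) * (chi (addf (@psie M S) (ey i)) (addf (extl (gam i)) (fun q => q == lshift S (jdx i))) x *
        dd (F l) x (euler x (lshift S (jdx i)))).
have Gs : unif_small s G.
  apply: unif_small_bnd; first exact: unif_small_geo.
  apply: bounded_torus_sum => i; apply: bounded_torus_mul; first by apply: bounded_torus_near_torus; exact: near_torus_const.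
  by apply: bounded_torus_mul; [apply: bounded_torus_near_torus; exact: near_torus_chi | exact: bounded_torus_dd].
have sF a b : (exists i, a i <> b i) -> small z s (fun l x => chi a b x * F l x).
  apply: (small_laurent zM zn z1 zlim s0 indep nF (gam := gam)
     (At := fun i k x => At (jdx i) k (lsubmx x)) (cc := fun i k => ca (jdx i) k) _ _ _ Gs _) => //.
  - by move=> i k; exists BA, 0%N => l _ x xt; apply: Atb; exact: lr.
  - move=> i k e0 e00; have [m0 hm0] := Ate (jdx i) k e00; exists m0 => m mm x xt.
    by apply: hm0 => //; apply: le_trans (nr_lsub x) _; have := torr x xt; lra.
  exists L => l lL x xt.
  have xr : nr x < r by have := torr x xt; lra.
  have rl k : \sum_(j < M) rC (nu j) * x 0 (lshift S j) * At j k (lsubmx x) = 0.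
    by rewrite -[RHS](rel k (lr x xt)); apply: eq_bigr => j _; rewrite mxE.
  have E := normal_field_scaled jdx gam_bx (F l) (Tn l) (fun i => torn x i xt) rl.
  have mb0 : mon bx (lsubmx x) != 0 :> C.
    by apply/prodf_neq0 => i _; rewrite expf_neq0 // mxE; exact: torn.
  apply: (mulfI mb0); rewrite mulr0; apply: etrans (esym E) _.
  have [_ ->] := dF l x x lL xt (torx x xt).
  rewrite /wronskian (dd_rescale d l xr dP).2 (dd_rescale e l xr dQ).2 scale_yM mulfV // scale_y1.
  have tr : nr (scale_y (rC (T l)) x) < r.
    by apply: scale_in => //; rewrite T0 /=; apply: exprn_ile1; lra.
  have := PQ tr; rewrite /wronskian /rescale -/(T l).
  set w := normal_field _; set u := dd P _ _; set v := dd Q _ _; set pa := P _; set qb := Q _ => h.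
  clearbody u v pa qb.
  transitivity ((rC (T l ^- e) * qb)^-2 * (rC (T l ^- e) * rC (T l ^- d)) * (qb * u - pa * v)); first by ring.
  by rewrite h mulr0.
apply: (proportional zM zn z1 zlim s0 sr r0 bF sF (B := K + K')) => //.
- by move=> x xr; have := P0B x xr; lra.
- by move=> x xr; have := Q0B x xr; lra.
move=> e1 e10.
have Y0 : 0 < 2 * (K * K') / (dl / 2) + 1.
  by rewrite ltr_wpDl // divr_ge0 //; [nra|lra].
have [L3 hL3] := @pow_small R (1 / 2) (e1 / (2 * (K * K') / (dl / 2) + 1)) q1 (divr_gt0 e10 Y0).
exists (maxn L L3) => l; rewrite geq_max => /andP[lL l3] x xt.
have xr : nr x < r by have := torr x xt; lra.
have l1 : (L1 <= l)%N by apply: leq_trans lL; exact: leq_maxl.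
have h1 := hP x (T l) xr (T4 l l1); have h2 := hQ x (T l) xr (T4 l l1).
have [_ ql] := Qlow l x x lL xt (torx x xt).
have q0 := qn l x x lL xt (torx x xt).
have -> : P0 x - Q0 x * F l x = (P0 x * (rescale Q e l x - Q0 x) - Q0 x * (rescale P d l x - P0 x)) * (rescale Q e l x)^-1.
  by rewrite /F; field.
rewrite (nrM (_ - _)) nrV.
have h3 : nr (P0 x * (rescale Q e l x - Q0 x) - Q0 x * (rescale P d l x - P0 x)) <= 2 * (K * K') * T l.
  apply: le_trans (nrB _ _) _; rewrite (nrM (P0 x)) (nrM (Q0 x)).
  have a1 : nr (P0 x) * nr (rescale Q e l x - Q0 x) <= K * (K' * T l) by apply: ler_pM => //; [exact: nr_ge0|exact: nr_ge0|exact: P0B].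
  have a2 : nr (Q0 x) * nr (rescale P d l x - P0 x) <= K' * (K * T l) by apply: ler_pM => //; [exact: nr_ge0|exact: nr_ge0|exact: Q0B].
  by move: a1 a2; set u1 := _ * nr _; set u2 := _ * nr _; lra.
have d2 : 0 < dl / 2 by lra.
have qg : 0 < nr (rescale Q e l x) by lra.
have h4 : (nr (rescale Q e l x))^-1 <= (dl / 2)^-1 by rewrite lef_pV2 // posrE.
have h5 : 2 * (K * K') * T l * (dl / 2)^-1 <= e1.
  have := hL3 l l3; rewrite ler_pdivlMr // -/(T l) => h; have := T0 l; lra.
apply: le_trans h5; apply: ler_pM => //; first exact: nr_ge0.
by rewrite invr_ge0 ltW.
Qed.
End Pair.

(** The Wronskian is bilinear over constants and alternating, so P - c Q satisfies the same equation
    as P. *)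
Lemma wronskian_comb (P Q : V -> C) c x v : differentiable P x -> differentiable Q x ->
  wronskian (fun y => P y - c * Q y) Q x v = wronskian P Q x v.
Proof.
move=> dP dQ; have [h1 h2] := diff_scal c dQ; have [_ h3] := diff_sub dP h1.
rewrite /wronskian h3 h2; move: (dd P x v) (dd Q x v) (P x) (Q x) => a b p q; ring.
Qed.

(* If [P - c Q] is not 0, its leading part has the order of [Q0], but at that order
   it is [P0 - c Q0 = 0]. *)
Theorem main_prop (P Q : V -> C) (B : R) :
  (forall x, nr x < r -> differentiable P x) -> (forall x, nr x < r -> differentiable Q x) ->
  (forall x, nr x < r -> nr (P x) <= B) -> (forall x, nr x < r -> nr (Q x) <= B) ->
  (forall x, nr x < r -> wronskian P Q x (normal_field x) = 0) -> (exists2 x, nr x < r & Q x != 0) ->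
  exists c, forall x, nr x < r -> P x = c * Q x.
Proof.
move=> dP dQ PB QB PQ nQ.
have B0 : 0 <= B by apply: le_trans (PB 0 _); [exact: nr_ge0|rewrite nr0].
have [e [Q0 [K' lQ]]] := leading r0 B0 dQ QB nQ.
have [nP|zP] := EM (exists2 x, nr x < r & P x != 0); last first.
  exists 0 => x xr; rewrite mul0r; apply/eqP; apply: contrapT => /negP h; apply: zP; by exists x.
have [d [P0 [K lP]]] := leading r0 B0 dP PB nP.
have [c hc] := leading_prop dP dQ PQ lP lQ.
have de := leading_part_order lP lQ hc.
pose P' y := P y - c * Q y.
have dP' x : nr x < r -> differentiable P' x.
  by move=> xr; exact: (diff_sub (dP x xr) (diff_scal c (dQ x xr)).1).1.
have [nP'|zP'] := EM (exists2 x, nr x < r & P' x != 0); last first.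
  exists c => x xr; apply/eqP; rewrite -subr_eq0; apply: contrapT => /negP h; apply: zP'; by exists x.
have B'0 : 0 <= B + nr c * B by apply: addr_ge0 => //; apply: mulr_ge0 => //; exact: nr_ge0.
have P'B x : nr x < r -> nr (P' x) <= B + nr c * B.
  move=> xr; apply: le_trans (nrB _ _) _; rewrite (nrM c).
  by apply: lerD; [exact: PB|apply: ler_wpM2l; [exact: nr_ge0|exact: QB]].
have PQ' x : nr x < r -> wronskian P' Q x (normal_field x) = 0.
  by move=> xr; rewrite wronskian_comb ?PQ //; [exact: dP|exact: dQ].
have [d' [P0' [K2 lP']]] := leading r0 B'0 dP' P'B nP'.
have [c' hc'] := leading_prop dP' dQ PQ' lP' lQ.
have d'e := leading_part_order lP' lQ hc'.
case: lP' lP lQ => [K20 _ _ [x xr Px] hP'] [K0 _ _ _ hP] [K'0 _ _ _ hQ].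
move/eqP: Px; case.
apply: (zero_of_small (K := K2 + (K + nr c * K'))) => [|t t4].
  by apply: addr_ge0 => //; apply: addr_ge0 => //; apply: mulr_ge0 => //; exact: nr_ge0.
have := hP' x t xr t4; have := hP x t xr t4; have := hQ x t xr t4.
rewrite hc // de d'e /P'.
move: (rC (t ^- e)) (P (scale_y (rC t) x)) (Q (scale_y (rC t) x)) (Q0 x) (P0' x) => u p q q0 p0' h1 h2 h3.
have -> : p0' = (u * p - c * q0 - c * (u * q - q0)) - (u * (p - c * q) - p0') by ring.
apply: le_trans (nrB _ _) _.
have h4 := nrB (u * p - c * q0) (c * (u * q - q0)).
rewrite (nrM c) in h4.
have h5 : nr c * nr (u * q - q0) <= nr c * (K' * t) by apply: ler_wpM2l => //; exact: nr_ge0.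
move: h1 h2 h3 h4 h5; set v1 := nr _; set v2 := nr _; set v3 := nr _; set v4 := nr _; set v5 := nr c.
move=> h1 h2 h3 h4 h5; clearbody v1 v2 v3 v4 v5.
by rewrite !mulrDl; lra.
Qed.
End Main.

Lemma prime_sequence : exists p : nat -> nat, (forall i, prime (p i)) /\ injective p.
Proof.
pose p i := iter i (fun n => s2val (prime_above n)) 2%N.
have pS i : (p i < p i.+1)%N by rewrite /p iterS; case: prime_above.
exists p; split; first by case=> [|i] //; rewrite /p iterS; case: prime_above.
have lt := homo_ltn ltn_trans pS.
by move=> i j ij; case: (ltngtP i j) => // /lt; rewrite ij ltnn.
Qed.

(** Logarithms to base 2 of distinct primes: a relation with natural coefficients on both sides says
    that two products of primes agree, and unique factorization applies. Base 2 makes every weight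
    at least 1. *)
Lemma independent_weights (R : realType) : exists nu : nat -> R, (forall i, 1 <= nu i) /\
  forall m (a b : 'I_m -> nat),
  \sum_(i < m) nu i * (a i)%:R = \sum_(i < m) nu i * (b i)%:R -> forall i, a i = b i.
Proof.
have [p [pp pinj]] := prime_sequence.
have l2 : 0 < ln (2 : R) by rewrite ln_gt0 // ltr1n.
exists (fun i => ln (p i)%:R / ln 2); split.
  move=> i; rewrite ler_pdivlMr // mul1r ler_ln ?posrE ?ltr0n ?prime_gt0 //.
  by rewrite ler_nat prime_gt1.
move=> m a b.
have E (c : 'I_m -> nat) : \sum_(i < m) ln (p i)%:R / ln 2 * (c i)%:R = ln ((\prod_(i < m) p i ^ c i)%N%:R : R) / ln 2.
  have P0 (r : seq 'I_m) : 0 < (\prod_(i <- r) p i ^ c i)%N%:R :> R.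
    rewrite ltr0n; apply: prodn_gt0 => i; by rewrite expn_gt0 prime_gt0.
  suff -> : ln ((\prod_(i < m) p i ^ c i)%N%:R : R) = \sum_(i < m) ln (p i)%:R * (c i)%:R.
    by rewrite mulr_suml; apply: eq_bigr => i _; rewrite mulrAC.
  elim: (index_enum _) => [|i r ih]; first by rewrite !big_nil ln1.
  rewrite !big_cons natrM lnM ?posrE ?P0 //; last by rewrite ltr0n expn_gt0 prime_gt0.
  by rewrite ih natrX lnXn ?mulr_natr // ltr0n prime_gt0.
have P0 (c : 'I_m -> nat) : (0 < \prod_(i < m) p i ^ c i)%N.
  by apply: prodn_gt0 => i; rewrite expn_gt0 prime_gt0.
rewrite !E => /(mulIf (invr_neq0 (lt0r_neq0 l2))) /ln_inj; rewrite !posrE !ltr0n !P0 => /(_ isT isT) /eqP.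
rewrite eqr_nat => /eqP h i.
have lE (c : 'I_m -> nat) : logn (p i) (\prod_(j < m) p j ^ c j) = c i.
  have P1 : (0 < \prod_(j < m | j != i) p j ^ c j)%N.
    by apply: prodn_cond_gt0 => j _; rewrite expn_gt0 prime_gt0.
  rewrite (bigD1 i) //= lognM //; last by rewrite expn_gt0 prime_gt0.
  rewrite lognX logn_prime // eqxx muln1 [X in (_ + X)%N](_ : _ = 0%N) ?addn0 //.
  rewrite logn_coprime //; apply: (big_ind (fun n => coprime (p i) n)); first exact: coprimen1.
    by move=> x y hx hy; rewrite coprimeMr hx.
  move=> j ji; apply: coprimeXr; rewrite prime_coprime // dvdn_prime2 //.
  by apply/eqP => /pinj /val_inj ij; rewrite ij eqxx in ji.
by rewrite -(lE a) h lE.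
Qed.

(** * The homological equation *)

Section Box.
Variable R : realType.
Local Notation C := (cplx R).

(** Coefficients growing at most like k^|a| give increments decaying like 2^-m where |x| k is at
    most 1/4. Enlarging the box changes each inner sum and adds one power of the first variable;
    this costs at most 2 + 1 < 4 per variable. *)
Lemma boxsum_bounds n (c : ('I_n -> nat) -> C) (A k : R) : 0 <= A -> 0 <= k ->
  (forall a, nr (c a) <= A * \prod_i k ^+ a i) -> forall x : 'rV[C]_n, nr x * k <= 1 / 4 ->
  forall m, nr (boxsum m c x) <= A * 2 ^+ n /\ nr (boxsum m.+1 c x - boxsum m c x) <= A * 4 ^+ n * (1 / 2) ^+ m.
Proof.
elim: n c A => [|n ih] c A A0 k0 cA x xk m.
  have E q : boxsum q c x = c (fun i => val (ffun0 (card_ord 0) i : 'I_q)).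
    rewrite /boxsum (big_pred1 (ffun0 (card_ord 0))) ?/mon ?big_ord0 ?mulr1 //.
    by move=> a; apply/esym/eqP/ffunP => -[].
  have E2 (a b : 'I_0 -> nat) : a = b by rewrite funeqE => -[].
  rewrite !E; set a := (fun i => _); set b := (fun i => _); rewrite (E2 a b) subrr nr0 !expr0 !mulr1.
  split; first by have := cA b; rewrite big_ord0 mulr1.
  by apply: mulr_ge0 => //; apply: exprn_ge0; lra.
have xx := nr_coord x 0 0; have xt := nr_vtail x.
have xx4 : nr (x 0 0) * k <= 1 / 4 by apply: le_trans xk; exact: ler_wpM2r.
have xt4 : nr (vtail x) * k <= 1 / 4 by apply: le_trans xk; exact: ler_wpM2r.
have x00 : 0 <= nr (x 0 0) * k by apply: mulr_ge0 => //; exact: nr_ge0.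
pose cc q (a : 'I_n -> nat) := c (fcons q a).
have ccA q a : nr (cc q a) <= A * k ^+ q * \prod_i k ^+ a i.
  apply: le_trans (cA _) _; rewrite big_ord_recl fcons0 mulrA.
  by rewrite (eq_bigr (fun i => k ^+ a i)) // => i _; rewrite fconsS.
have Aq q : 0 <= A * k ^+ q by apply: mulr_ge0 => //; exact: exprn_ge0.
have H q m0 := ih (cc q) (A * k ^+ q) (Aq q) k0 (ccA q) (vtail x) xt4 m0.
have bE m0 : boxsum m0 c x = \sum_(q < m0) boxsum m0 (cc q) (vtail x) * x 0 0 ^+ q.
  by rewrite -{1}(vcons_eta x) boxsum_vcons.
have geo m0 (D : R) (f : nat -> C) : 0 <= D -> (forall q, nr (f q) <= k ^+ q * D) ->
    nr (\sum_(q < m0) f q * x 0 0 ^+ q) <= 2 * D.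
  move=> D0 fD; apply: le_trans (nr_sum _ _ _) _.
  apply: (@le_trans _ _ (\sum_(q < m0) D * (nr (x 0 0) * k) ^+ q)).
    apply: ler_sum => q _; rewrite (nrM (f q)) nrX.
    have -> : D * (nr (x 0 0) * k) ^+ q = k ^+ q * D * nr (x 0 0) ^+ q by rewrite (exprMn _ (nr (x 0 0))); ring.
    by apply: ler_wpM2r => //; rewrite exprn_ge0 // nr_ge0.
  by rewrite -mulr_sumr mulrC; apply: ler_wpM2r => //; apply: geo_le2 => //; lra.
have p2 : 0 < (2 : R) ^+ n by apply: exprn_gt0; lra.
have p4 : 0 < (4 : R) ^+ n by apply: exprn_gt0; lra.
have p24 : (2 : R) ^+ n <= 4 ^+ n by rewrite lerXn2r // ?nnegrE //; lra.
split.
  rewrite bE exprS; apply: le_trans (geo m (A * 2 ^+ n) (fun q => boxsum m (cc q) (vtail x)) _ _) _.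
  - by apply: mulr_ge0 => //; exact: ltW.
  - by move=> q; apply: le_trans (H q m).1 _; rewrite le_eqVlt; apply/orP; left; apply/eqP; ring.
  - by rewrite le_eqVlt; apply/orP; left; apply/eqP; ring.
have pm : 0 < (1 / 2 : R) ^+ m by apply: exprn_gt0; lra.
rewrite !bE big_ord_recr /=.
have -> : \sum_(q < m) boxsum m.+1 (cc q) (vtail x) * x 0 0 ^+ q + boxsum m.+1 (cc m) (vtail x) * x 0 0 ^+ m -
     \sum_(q < m) boxsum m (cc q) (vtail x) * x 0 0 ^+ q =
   \sum_(q < m) (boxsum m.+1 (cc q) (vtail x) - boxsum m (cc q) (vtail x)) * x 0 0 ^+ q + boxsum m.+1 (cc m) (vtail x) * x 0 0 ^+ m.
  by rewrite addrAC -sumrB; congr (_ + _); apply: eq_bigr => q _; rewrite mulrBl.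
apply: le_trans (nrD _ _) _.
have h1 : nr (\sum_(q < m) (boxsum m.+1 (cc q) (vtail x) - boxsum m (cc q) (vtail x)) * x 0 0 ^+ q) <= 2 * (A * 4 ^+ n * (1 / 2) ^+ m).
  apply: (geo m _ (fun q => boxsum m.+1 (cc q) (vtail x) - boxsum m (cc q) (vtail x))).
    by apply: mulr_ge0; [apply: mulr_ge0 => //; exact: ltW|exact: ltW].
  by move=> q; apply: le_trans (H q m).2 _; rewrite le_eqVlt; apply/orP; left; apply/eqP; ring.
have h2 : nr (boxsum m.+1 (cc m) (vtail x) * x 0 0 ^+ m) <= A * 2 ^+ n * (1 / 2) ^+ m.
  rewrite (nrM (boxsum _ _ _)) nrX; have [h _] := H m m.+1.
  apply: le_trans (ler_wpM2r (exprn_ge0 m (nr_ge0 (x 0 0))) h) _.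
  have -> : A * k ^+ m * 2 ^+ n * nr (x 0 0) ^+ m = A * 2 ^+ n * (nr (x 0 0) * k) ^+ m by rewrite (exprMn _ (nr (x 0 0))); ring.
  apply: ler_wpM2l; first by apply: mulr_ge0 => //; exact: ltW.
  by rewrite lerXn2r // ?nnegrE; lra.
have h3 : A * 2 ^+ n * (1 / 2) ^+ m <= A * 4 ^+ n * (1 / 2) ^+ m.
  by apply: ler_wpM2r; [exact: ltW|exact: ler_wpM2l].
have h4 : 0 <= A * 4 ^+ n * (1 / 2) ^+ m by apply: mulr_ge0; [apply: mulr_ge0 => //; exact: ltW|exact: ltW].
have -> : A * 4 ^+ n.+1 * (1 / 2) ^+ m = 4 * (A * 4 ^+ n * (1 / 2) ^+ m) by rewrite exprS; ring.
lra.
Qed.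

Lemma tendsto_geo (u : nat -> C) (D : R) : 0 <= D -> (forall m, nr (u m.+1 - u m) <= D * (1 / 2) ^+ m) ->
  exists2 v, tendsto u v & forall m, nr (u m - v) <= 2 * D * (1 / 2) ^+ m.
Proof.
move=> D0 hu.
have h m k : nr (u (m + k)%N - u m) <= 2 * D * (1 / 2) ^+ m - 2 * D * (1 / 2) ^+ (m + k).
  elim: k => [|k ih]; first by rewrite addn0 !subrr nr0.
  rewrite addnS; have -> : u (m + k).+1 - u m = (u (m + k).+1 - u (m + k)%N) + (u (m + k)%N - u m) by ring.
  apply: le_trans (nrD _ _) _; have := hu (m + k)%N; move: ih; rewrite exprS.
  set w := _ ^+ (m + k); set w' := _ ^+ m; set v1 := nr _; set v2 := nr _; clearbody w w' v1 v2; lra.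
have g m : 0 <= 2 * D * (1 / 2) ^+ m by apply: mulr_ge0; [lra|apply: exprn_ge0; lra].
have h' m k : nr (u (m + k)%N - u m) <= 2 * D * (1 / 2) ^+ m by have := h m k; have := g (m + k)%N; lra.
have q1 : 0 <= (1 / 2 : R) < 1 by apply/andP; split; lra.
have [|v hv] := @C_cauchy R u.
  move=> e e0; have D1 : 0 < 4 * D + 1 by lra.
  have [K hK] := pow_small q1 (divr_gt0 e0 D1).
  have {}hK := hK K (leqnn _); rewrite ler_pdivlMr // in hK.
  exists K => k l Kk Kl.
  have a1 := h' K (k - K)%N; have a2 := h' K (l - K)%N; rewrite !subnKC // in a1 a2.
  have -> : u k - u l = (u k - u K) - (u l - u K) by ring.
  apply: le_trans (nrB _ _) _.
  have : 0 <= (1 / 2 : R) ^+ K by apply: exprn_ge0; lra.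
  move: hK a1 a2; set w := _ ^+ K; set v1 := nr _; set v2 := nr _; clearbody w v1 v2; nra.
exists v => // m; rewrite -nrN opprB; apply: (tendsto_le (K := m) hv) => k mk.
by have := h' m (k - m)%N; rewrite subnKC.
Qed.
End Box.

Section Homological.
Variable R : realType.
Local Notation C := (cplx R).

Lemma dd_near0 (V : normedModType C) (f : V -> C) p (e : R) v : 0 < e ->
  (forall q, nr (q - p) < e -> differentiable f q) -> (forall q, nr (q - p) < e -> f q = 0) -> dd f p v = 0.
Proof.
move=> e0 df f0; have fB q : nr (q - p) < e -> nr (f q) <= 0 by move=> /f0 ->; rewrite nr0.
have := cauchy_deriv e0 df fB v; rewrite mulr0 mul0r mul0r => h.
by apply/eqP; rewrite -nr_eq0 eq_le nr_ge0 h.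
Qed.

Lemma diff_mon n (a : 'I_n -> nat) (x : 'rV[C]_n) : differentiable (mon a) x.
Proof.
suff [] : eig (mon a) (\sum_(i < n) (a i)%:R * 0) x 0 by [].
apply: eig_prod => i; apply: eig_exp; have [h1 h2] := diff_coord x 0 i; split; first exact: h1.
by rewrite h2 mxE mul0r.
Qed.

Lemma eig_mon n (a : 'I_n -> nat) (x : 'rV[C]_n) j : eig (mon a) (a j)%:R x (euler x j).
Proof.
have -> : (a j)%:R = \sum_(i < n) (a i)%:R * (i == j)%:R :> C.
  by rewrite (bigD1 j) //= eqxx mulr1 big1 ?addr0 // => i /negbTE ->; rewrite mulr0.
by apply: eig_prod => i; apply: eig_exp; exact: eig_coord.
Qed.

Lemma diff_boxsum n m (c : ('I_n -> nat) -> C) (x : 'rV[C]_n) :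
  differentiable (boxsum m c) x /\ forall j, dd (boxsum m c) x (euler x j) = boxsum m (fun a => (a j)%:R * c a) x.
Proof.
have dm (a : {ffun 'I_n -> 'I_m}) : differentiable (fun x : 'rV[C]_n => c (fun i => val (a i)) * mon (fun i => val (a i)) x) x.
  exact: (diff_scal _ (diff_mon _ x)).1.
have [h1 h2] := diff_big (index_enum {ffun 'I_n -> 'I_m}) dm; split; first exact: h1.
move=> j; rewrite h2; apply: eq_bigr => a _; rewrite (diff_scal _ (diff_mon _ x)).2 (eig_mon _ x j).2.
move: (mon _ _) => w; ring.
Qed.

(* Divide the coefficient of [x^a] by [nu . a], which is at least 1: no small divisors. *)
Lemma homological n (nu : nat -> R) (g : 'rV[C]_n -> C) (r B : R) : (forall i, 1 <= nu i) -> 0 < r -> 0 <= B ->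
  (forall x, nr x < r -> differentiable g x) -> (forall x, nr x < r -> nr (g x) <= B) -> g 0 = 0 ->
  exists h B', [/\ h 0 = 0, forall x, nr x < r / 8 -> differentiable h x,
    forall x, nr x < r / 8 -> nr (h x) <= B' &
    forall x, nr x < r / 8 -> \sum_(j < n) rC (nu j) * dd h x (euler x j) = g x].
Proof.
move=> nu1 r0 B0 dg gB g0.
have [c [cB cE]] := power_series r0 B0 dg gB.
have r8 : 0 < r / 8 by rewrite divr_gt0.
pose w (a : 'I_n -> nat) : R := \sum_(j < n) nu j * (a j)%:R.
have w0 (a : 'I_n -> nat) (j : 'I_n) : 0 <= nu j * (a j)%:R.
  by apply: mulr_ge0; [exact: le_trans (ler01) (nu1 j)|exact: ler0n].
have w1 a : (exists j, a j != 0%N) -> 1 <= w a.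
  move=> [j aj]; rewrite /w (bigD1 j) //=.
  have a1 : (1 : R) <= (a j)%:R by rewrite ler1n lt0n.
  have : 0 <= \sum_(i < n | i != j) nu i * (a i)%:R by apply: sumr_ge0 => i _; exact: w0.
  have := nu1 j; nra.
(* The zero exponent is the only one of weight 0; its coefficient vanishes because g 0 = 0. *)
have c00 a : ~ (exists j, a j != 0%N) -> c a = 0.
  move=> h; have {h} -> : a = fun=> 0%N.
    by rewrite funeqE => j; apply/eqP; apply: contrapT => /negP h1; apply: h; exists j.
  have h0 : nr (0 : 'rV[C]_n) <= r / 4 by rewrite nr0 divr_ge0 // ltW.
  have := cE 1%N 0 h0; rewrite g0 nr0 mul0r expr1 mulr0 sub0r nrN.
  have bE : boxsum 1 c 0 = c (fun=> 0%N).
    rewrite /boxsum (big_pred1 [ffun=> ord0]); last first.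
      by move=> a0; apply/esym/eqP/ffunP => i; rewrite ffunE; exact: ord1.
    have -> : (fun i : 'I_n => val ([ffun=> ord0] i : 'I_1)) = fun=> 0%N by rewrite funeqE => i; rewrite ffunE.
    by rewrite /mon big1 ?mulr1 // => i _; rewrite expr0.
  by rewrite bE => h; apply/eqP; rewrite -nr_eq0 eq_le nr_ge0 h.
pose c' a : C := (rC (w a))^-1 * c a.
have c'B a : nr (c' a) <= 2 ^+ n * B * \prod_i (2 / r) ^+ a i.
  apply: le_trans (cB a); rewrite /c'.
  have [/w1 h|/c00 ->] := EM (exists j, a j != 0%N); last by rewrite mulr0.
  rewrite (nrM (rC _)^-1) nrV nr_rC ger0_norm; last by lra.
  rewrite mulrC ler_piMr ?nr_ge0 // invf_le1 //; lra.
have c'E a : rC (w a) * c' a = c a.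
  rewrite /c'; have [/w1 h|/c00 ->] := EM (exists j, a j != 0%N); last by rewrite !mulr0.
  by rewrite mulVKf // -(rC0 R) (inj_eq (@rC_inj R)) gt_eqF //; lra.
have A0 : 0 <= 2 ^+ n * B by apply: mulr_ge0 => //; apply: exprn_ge0; lra.
have k0 : 0 <= 2 / r by rewrite divr_ge0 // ltW.
have xk (x : 'rV[C]_n) : nr x < r / 8 -> nr x * (2 / r) <= 1 / 4.
  by move=> xr; rewrite mulrA ler_pdivrMr //; lra.
have bb x (xr : nr x < r / 8) m := boxsum_bounds A0 k0 c'B (xk x xr) m.
pose D := 2 ^+ n * B * 4 ^+ n.
have D0 : 0 <= D by apply: mulr_ge0 => //; apply: exprn_ge0; lra.
(* Outside the ball the value of [h] is arbitrary. *)
have /choice[h hh] : forall x, exists v, nr x < r / 8 -> tendsto (fun m => boxsum m c' x) v /\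
    forall m, nr (boxsum m c' x - v) <= 2 * D * (1 / 2) ^+ m.
  move=> x; have [xr|xr] := boolP (nr x < r / 8); last by exists 0.
  by have [v v1 v2] := tendsto_geo D0 (fun m => (bb x xr m).2); exists v.
have bE m x : boxsum m c x = \sum_(j < n) rC (nu j) * dd (boxsum m c') x (euler x j).
  transitivity (\sum_(j < n) rC (nu j) * boxsum m (fun a => (a j)%:R * c' a) x); last first.
    by apply: eq_bigr => i _; rewrite (diff_boxsum m c' x).2.
  rewrite /boxsum; under [RHS]eq_bigr => i _ do rewrite mulr_sumr.
  rewrite exchange_big; apply: eq_bigr => a _ /=.
  rewrite -(c'E (fun i => val (a i))); move: (c' _) (mon _ _) => u v.
  have -> : rC (w (fun i => val (a i))) = \sum_(j < n) rC (nu j) * (val (a j))%:R.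
    rewrite /w (big_morph (@rC R) (@rCD R) (rC0 R)).
    by apply: eq_bigr => i _; rewrite rCM rCn.
  by rewrite !mulr_suml; apply: eq_bigr => i _; ring.
have hd x : nr x < r / 8 -> differentiable h x /\ forall v, tendsto (fun k => dd (boxsum k c') x v) (dd h x v).
  move=> xr; pose rr := r / 8 - nr x.
  have rr0 : 0 < rr by rewrite subr_gt0.
  have inb q : nr (q - x) < rr -> nr q < r / 8.
    by have := nrD (q - x) x; rewrite subrK /rr; lra.
  apply: (diff_uniform_limit rr0) => [k q _|e e0]; first exact: (diff_boxsum k c' q).1.
  have q1 : 0 <= (1 / 2 : R) < 1 by apply/andP; split; lra.
  have D1 : 0 < 2 * D + 1 by lra.
  have [K hK] := pow_small q1 (divr_gt0 e0 D1).
  exists K => k kK q /inb qr; apply: le_trans ((hh q qr).2 k) _.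
  have := hK k kK; rewrite ler_pdivlMr // => h1.
  have : 0 <= (1 / 2 : R) ^+ k by apply: exprn_ge0; lra.
  move: h1; set y := _ ^+ k; lra.
exists h, (2 ^+ n * B * 2 ^+ n + 2 * D); split.
- have z8 : nr (0 : 'rV[C]_n) < r / 8 by rewrite nr0.
  apply: (tendsto_uniq (hh 0 z8).1) => e e0; exists 1%N => m m1.
  rewrite /boxsum big1 ?subr0 ?nr0 ?ltW // => a _.
  have [/existsP[j aj]|na] := boolP [exists j, val (a j) != 0%N].
    by rewrite /mon (bigD1 j) //= mxE expr0n (negbTE aj) mul0r mulr0.
  rewrite /c' c00 ?mulr0 ?mul0r // => -[j aj]; move/existsP: na; apply; by exists j.
- by move=> x /hd[].
- move=> x xr; have h1 := (hh x xr).2 0%N; have h2 := (bb x xr 0%N).1.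
  rewrite expr0 mulr1 in h1.
  have := nrB (boxsum 0 c' x) (boxsum 0 c' x - h x); rewrite opprB addrC subrK; lra.
move=> x xr; have [_ ht] := hd x xr.
have t1 : tendsto (fun k => \sum_(j < n) rC (nu j) * dd (boxsum k c') x (euler x j)) (\sum_(j < n) rC (nu j) * dd h x (euler x j)).
  apply: tendsto_sum => j; exact: (tendstoZ (rC (nu j)) (ht (euler x j))).
apply: (tendsto_uniq t1) => e e0.
have [cc ex] := expands_ball r0 B0 dg gB.
have h16 : 0 < 16 ^+ n * B + 1 :> R by have := exprn_ge0 n (ler0n R 16); nra.
have q1 : 0 <= (1 / 4 : R) < 1 by apply/andP; split; lra.
have [K hK] := pow_small q1 (divr_gt0 e0 h16).
exists K => k kK; rewrite -bE // -nrN opprB; apply: le_trans (cE k x _) _; first by lra.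
have := hK k kK; rewrite ler_pdivlMr // => h1.
have h3 : (nr x * (2 / r)) ^+ k <= (1 / 4) ^+ k.
  by rewrite lerXn2r // ?nnegrE ?mulr_ge0 ?nr_ge0 ?xk //; lra.
have h5 : 0 <= 16 ^+ n * B by apply: mulr_ge0 => //; exact: exprn_ge0.
have h4 : 0 <= (1 / 4 : R) ^+ k by apply: exprn_ge0; lra.
move: h1 h3 h4 h5; set u := _ ^+ k; set y := _ ^+ k; set q := _ * B; clearbody u y q; nra.
Qed.

(** Difference quotients with increments tending to 0 converge locally uniformly by the Taylor bound
    on lines, so [diff_uniform_limit] applies to them. *)
Lemma partial_diff n (f : 'rV[C]_n -> C) (r B : R) u : 0 < r -> nr u <= 1 ->
  (forall x, nr x < r -> differentiable f x) -> (forall x, nr x < r -> nr (f x) <= B) ->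
  forall x, nr x < r / 2 -> differentiable (fun y => dd f y u) x /\ nr (dd f x u) <= 8 * B / r.
Proof.
move=> r0 u1 df fB x xr.
have B0 : 0 <= B by apply: le_trans (fB 0 _); [exact: nr_ge0|rewrite nr0].
have inb (p q : 'rV[C]_n) (d : R) : nr p < r - d -> nr (q - p) < d -> nr q < r.
  by have := nrD (q - p) p; rewrite subrK; lra.
split; last first.
  have r2 : 0 < r / 2 by lra.
  have xd : nr x < r - r / 2 by lra.
  have := cauchy_deriv r2 (fun q h => df q (inb x q _ xd h)) (fun q h => fB q (inb x q _ xd h)) u.
  move=> h; apply: le_trans h _; have E : 4 * B / (r / 2) = 8 * B / r by field; rewrite gt_eqF.
  rewrite E ler_piMr //; apply: divr_ge0; lra.
have r8 : 0 < r / 8 by rewrite divr_gt0.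
have r4 : 0 < r / 4 by rewrite divr_gt0.
pose t k : R := r / 16 * (1 / 2) ^+ k.
have t0 k : 0 < t k by apply: mulr_gt0; [rewrite divr_gt0|apply: exprn_gt0; lra].
have t1 k : t k <= r / 16.
  rewrite ler_piMr //; [lra|apply: exprn_ile1; lra].
pose fk k q := (rC (t k))^-1 * (f (q *m 1%:M + rC (t k) *: u) - f q).
have ndx k q : nr (q - x) < r / 8 -> nr (q *m 1%:M + rC (t k) *: u) < r.
  move=> qx; rewrite mulmx1; apply: le_lt_trans (nrD _ _) _; rewrite nrZ nr_rC gtr0_norm //.
  have := nrD (q - x) x; rewrite subrK; have := t1 k; have := t0 k; have := nr_ge0 u; nra.
have inx q : nr (q - x) < r / 8 -> nr q < r.
  by have := nrD (q - x) x; rewrite subrK; lra.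
apply: (@diff_uniform_limit R _ fk (fun y => dd f y u) x (r / 8) r8 _ _).1.
  move=> k q qx.
  have h1 := diff_affine 1%:M (rC (t k) *: u) q.
  have h2 := diff_comp_dd h1.1 (df _ (ndx k q qx)).
  exact: (diff_scal _ (diff_sub h2.1 (df q (inx q qx))).1).1.
move=> e e0.
have q1 : 0 <= (1 / 2 : R) < 1 by apply/andP; split; lra.
have Y0 : 0 < 32 * B / r + 1 by rewrite ltr_wpDl // divr_ge0 //; lra.
have [K hK] := pow_small q1 (divr_gt0 e0 Y0).
exists K => k kK q qx.
have q4 : nr q < r - r / 4 by have := nrD (q - x) x; rewrite subrK; lra.
have [c [_ c0 c1 hc]] := line_taylor r4 u1 (fun y h => df y (inb q y _ q4 h)) (fun y h => fB y (inb q y _ q4 h)).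
have nt : nr (rC (t k)) = t k by rewrite nr_rC gtr0_norm.
have tn : rC (t k) != 0 :> C by rewrite -(rC0 R) (inj_eq (@rC_inj R)) gt_eqF.
have := hc 2%N (rC (t k)); rewrite nt => /(_ ltac:(have := t1 k; lra)).
rewrite big_ord_recl big_ord1 /= c0 c1 expr0 expr1 mulr1 => h.
rewrite /fk mulmx1; rewrite -/(dd f q u) in h.
move: h; move: (f (q + _)) (f q) (dd f q u) => a b d h.
have -> : (rC (t k))^-1 * (a - b) - d = (rC (t k))^-1 * (a - (b + d * rC (t k))) by field.
rewrite (nrM (rC (t k))^-1) nrV nt ler_pdivrMl //; apply: le_trans h _.
have -> : 8 * B * (t k * (2 / (r / 4))) ^+ 2 = t k * (32 * B / r * (1 / 2) ^+ k).
  by rewrite /t; set y := _ ^+ k; field; rewrite gt_eqF.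
apply: ler_wpM2l; first exact: ltW.
have := hK k kK; rewrite ler_pdivlMr // => h1.
have : 0 <= (1 / 2 : R) ^+ k by apply: exprn_ge0; lra.
move: h1; set y := _ ^+ k; lra.
Qed.
End Homological.

(** * Normal form and slices *)

Section Basis.
Variable R : realType.
Local Notation C := (cplx R).

Lemma expands_sum n (I : Type) (s : seq I) (f : I -> 'rV[C]_n -> C) (c : I -> ('I_n -> nat) -> C) (k : I -> C) rho :
  (forall i, expands (f i) (c i) rho) ->
  expands (fun x => \sum_(i <- s) f i x * k i) (fun a => \sum_(i <- s) c i a * k i) rho.
Proof.
move=> h; elim: s => [|i s ih].
  move=> e e0; exists 0%N => m _ x _; rewrite big_nil /boxsum big1 ?subrr ?nr0 ?ltW // => a _.
  by rewrite big_nil mul0r.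
have := expands_comb (- k i) ih (h i).
rewrite (_ : (fun x => _) = (fun x => \sum_(j <- i :: s) f j x * k j)); last first.
  by rewrite funeqE => x; rewrite big_cons; ring.
rewrite (_ : (fun a => _ - _) = (fun a => \sum_(j <- i :: s) c j a * k j)) //.
by rewrite funeqE => x; rewrite big_cons; ring.
Qed.

Lemma expands_le n (f : 'rV[C]_n -> C) c (rho rho' : R) : rho' <= rho -> expands f c rho -> expands f c rho'.
Proof.
move=> le h e /h[m0 hm]; exists m0 => m mm x xr; apply: hm => //; exact: le_trans le.
Qed.

(** The index type may be infinite, so the basis is obtained as an independent subfamily of maximal
    size, which is at most [N]. Its matrix [E] has a right inverse [L], and [w t *m L] is the row of
    coordinates of [w t]. *)
Lemma coef_basis (F : fieldType) (T : Type) (N : nat) (w : T -> 'rV[F]_N) :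
  exists S (tt : 'I_S -> T) (E : 'M[F]_(S, N)) (L : 'M[F]_(N, S)),
  [/\ E *m L = 1%:M, forall k, row k E = w (tt k) & forall t, w t *m L *m E = w t].
Proof.
pose fam S := exists (tt : 'I_S -> T), row_free (\matrix_k w (tt k)).
have fam0 : exists S, `[<fam S>].
  exists 0%N; apply/asboolP; have t0 : 'I_0 -> T by case.
  by exists t0; rewrite -row_leq_rank.
have famN S : `[<fam S>] -> (S <= N)%N.
  by move=> /asboolP[tt]; rewrite -row_leq_rank => h; exact: leq_trans h (rank_leq_col _).
case: (ex_maxnP fam0 famN) => S /asboolP[tt fr] mx.
set E := \matrix_k w (tt k) in fr.
have [L EL] := row_freeP fr.
exists S, tt, E, L; split=> // [k|t]; first by rewrite rowK.
suff /submxP[u ->] : (w t <= E)%MS by rewrite -[u *m E *m L]mulmxA EL mulmx1.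
apply: contrapT => /negP nw.
have fS : fam S.+1.
  exists (fun i : 'I_S.+1 => if unlift ord_max i is Some j then tt j else t).
  rewrite -row_leq_rank; set E' := \matrix_k _.
  have EE : (E <= E')%MS.
    apply/row_subP => k; have -> : row k E = row (lift ord_max k) E' by rewrite !rowK liftK.
    exact: row_sub.
  have wE : (w t <= E')%MS.
    have -> : w t = row ord_max E' by rewrite rowK unlift_none.
    exact: row_sub.
  have lt : (E < E')%MS.
    rewrite /ltmx EE /=; apply/negP => h; move/negP: nw; apply; exact: submx_trans h.
  have := rank_ltmx lt; rewrite (eqP fr); exact.
by have := mx S.+1 (asboolT fS); rewrite ltnn.
Qed.
End Basis.

Section NormalForm.
Variable R : realType.
Local Notation C := (cplx R).

Lemma germ_ball (V W : normedModType C) (f : V -> W) : holomorphic_germ f ->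
  exists r B, [/\ 0 < r, 0 <= B, forall x, nr x < r -> differentiable f x & forall x, nr x < r -> nr (f x) <= B].
Proof.
move=> /nbhs_nrP[e e0 he].
have d0 : differentiable f 0 by apply: he; rewrite subrr nr0.
have [d dd0 hd] := diff_cont d0 ltr01.
exists (Num.min e d), (nr (f 0) + 1); split; first by rewrite lt_min e0.
- by have := nr_ge0 (f 0); lra.
- by move=> x; rewrite lt_min => /andP[xe _]; apply: he; rewrite subr0.
- move=> x; rewrite lt_min => /andP[_ /hd]; rewrite add0r => h.
  by have := nrD (f x - f 0) (f 0); rewrite subrK; lra.
Qed.

Lemma ball_germ (V W : normedModType C) (f : V -> W) (r : R) : 0 < r ->
  (forall x, nr x < r -> differentiable f x) -> holomorphic_germ f.
Proof. by move=> r0 h; apply/nbhs_nrP; exists r => // q; rewrite subr0; exact: h. Qed.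

Lemma evec_decomp n (u : 'rV[C]_n) : u = \sum_j u 0 j *: evec R j.
Proof.
apply/rowP => i; rewrite summxE (bigD1 i) //= big1 ?addr0; last first.
  by move=> j; rewrite !mxE eq_sym => /negbTE ->; rewrite mulr0.
by rewrite !mxE eqxx mulr1.
Qed.

Variables M N : nat.
Variable a : 'rV[C]_M -> 'M[C]_(M, N).
Hypothesis ha : holomorphic_germ a.

Theorem normal_form (nu : nat -> R) : (forall i, 1 <= nu i) ->
  exists (h : 'I_N -> 'rV[C]_M -> C) S (jdx : 'I_S -> 'I_M) (gam : 'I_S -> 'I_M -> nat)
    (E : 'M[C]_(S, N)) (L : 'M[C]_(N, S)) (At : 'I_M -> 'I_S -> 'rV[C]_M -> C)
    (ca : 'I_M -> 'I_S -> ('I_M -> nat) -> C) (r BA : R),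
  (0 < r /\ E *m L = 1%:M) /\
  [/\ forall i, h i 0 = 0, forall i x, nr x < r -> differentiable (h i) x &
    forall x j i, nr x < r -> dd (h i) x (evec R j) + \sum_k At j k x * E k i = a x j i] /\
  [/\ forall j k x, nr x < r -> nr (At j k x) <= BA,
    forall j k, expands (At j k) (ca j k) (r / 4),
    forall i k, ca (jdx i) k (gam i) = (i == k)%:R &
    forall (x : 'rV[C]_M) k, nr x < r -> \sum_(j < M) rC (nu j) * x 0 j * At j k x = 0].
Proof.
move=> nu1.
have [r0 [B0 [r00 B00 da aB]]] := germ_ball ha.
have daj x j i : nr x < r0 -> differentiable (fun y => a y j i) x.
  by move=> xr; exact: (diff_comp_dd (da x xr) (diff_coord (a x) j i).1).1.
pose g (x : 'rV[C]_M) : 'rV[C]_N := \row_i \sum_(j < M) rC (nu j) * x 0 j * a x j i.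
have gE i : (fun x => g x 0 i) = fun x => \sum_(j < M) rC (nu j) * x 0 j * a x j i.
  by rewrite funeqE => x; rewrite mxE.
have dg x i : nr x < r0 -> differentiable (fun x => g x 0 i) x.
  move=> xr; rewrite gE.
  have dj (j : 'I_M) : differentiable (fun x : 'rV[C]_M => rC (nu j) * x 0 j * a x j i) x.
    by apply: (diff_mul _ (daj x j i xr)).1; exact: (diff_scal _ (diff_coord x 0 j).1).1.
  exact: (diff_big (index_enum 'I_M) dj).1.
have hg : holomorphic_germ g.
  by apply: (ball_germ r00) => x xr; apply: (diff_mx _).1 => i0 i; rewrite (ord1 i0); exact: dg.
have [r1 [B1 [r10 B10 dg1 gB1]]] := germ_ball hg.
have dgi i x : nr x < r1 -> differentiable (fun x => g x 0 i) x.
  by move=> xr; exact: (diff_comp_dd (dg1 x xr) (diff_coord (g x) 0 i).1).1.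
have gBi i x : nr x < r1 -> nr (g x 0 i) <= B1.
  by move=> xr; apply: le_trans (nr_coord _ _ _) (gB1 x xr).
have g0 i : g 0 0 i = 0.
  by rewrite mxE big1 // => j _; rewrite mxE mulr0 mul0r.
have /choice[h hh] := fun i => homological nu1 r10 B10 (dgi i) (gBi i) (g0 i).
pose r8 := r1 / 8.
have r80 : 0 < r8 by rewrite divr_gt0.
have h0 i : h i 0 = 0 by have [B' []] := hh i.
have dh i x : nr x < r8 -> differentiable (h i) x by have [B' [_ h1 _ _]] := hh i; exact: h1.
have hE i x : nr x < r8 -> \sum_(j < M) rC (nu j) * dd (h i) x (euler x j) = g x 0 i by have [B' [_ _ _ h1]] := hh i; exact: h1.
have nr_evec j : nr (evec R j : 'rV[C]_M) <= 1.
  by apply: nr_le_mx => // i0 i; rewrite !mxE; case: eqP => _; rewrite ?nr1 ?nr0.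
have dpart i j x : nr x < r8 / 2 -> differentiable (fun y => dd (h i) y (evec R j)) x.
  by have [B' [_ h1 h2 _]] := hh i; move=> xr; exact: (partial_diff r80 (nr_evec j) h1 h2 xr).1.
pose w (x : 'rV[C]_M) : 'M[C]_(M, N) := \matrix_(j, i) (a x j i - dd (h i) x (evec R j)).
have wE j i : (fun x => w x j i) = fun x => a x j i - dd (h i) x (evec R j).
  by rewrite funeqE => x; rewrite mxE.
pose r2 := Num.min r0 (r8 / 2).
have r20 : 0 < r2 by rewrite lt_min r00 divr_gt0.
have hw : holomorphic_germ w.
  apply: (ball_germ r20) => x; rewrite lt_min => /andP[xr0 xr8].
  apply: (diff_mx _).1 => j i; rewrite wE.
  exact: (diff_sub (daj x j i xr0) (dpart i j x xr8)).1.
have [r3 [B3 [r30 B30 dw wB]]] := germ_ball hw.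
have dwj j i x : nr x < r3 -> differentiable (fun x => w x j i) x.
  by move=> xr; exact: (diff_comp_dd (dw x xr) (diff_coord (w x) j i).1).1.
have wBj j i x : nr x < r3 -> nr (w x j i) <= B3.
  by move=> xr; apply: le_trans (nr_coord _ _ _) (wB x xr).
have /choice[cw hcw] : forall ji : 'I_M * 'I_N, exists c, expands (fun x => w x ji.1 ji.2) c (r3 / 4).
  by move=> ji; exact: (expands_ball r30 B30 (dwj ji.1 ji.2) (wBj ji.1 ji.2)).
(* The family is indexed by pairs of a direction dx_j and an exponent; [jdx] and [gam] will be the
   two components of the chosen indices. *)
have [S [tt [E [L [EL rE wL]]]]] := coef_basis
   (fun t : 'I_M * ('I_M -> nat) => \row_(i < N) cw (t.1, i) t.2).
pose r := Num.min r0 (Num.min (r8 / 2) (r3 / 4)).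
have rr0 : 0 < r by rewrite !lt_min r00 !divr_gt0.
have rle (x : 'rV[C]_M) : nr x < r -> [/\ nr x < r0, nr x < r8 / 2 & nr x < r3 / 4].
  by rewrite !lt_min => /andP[-> /andP[-> ->]].
exists h, S, (fun k => (tt k).1), (fun k => (tt k).2), E, L,
  (fun j k x => \sum_i w x j i * L i k), (fun j k al => \sum_i cw (j, i) al * L i k), r, (\sum_(i < N) B3 * nr L).
have r3r : r <= r3 / 4 by rewrite !ge_min lexx !orbT.
split=> //; split; split.
- exact: h0.
- by move=> i x /rle[_ xr _]; apply: dh; lra.
- move=> x j i /rle[_ _ xr].
  have -> : a x j i = dd (h i) x (evec R j) + w x j i by rewrite mxE addrC subrK.
  congr (_ + _); apply/eqP; rewrite -subr_eq0; apply/eqP.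
  (* The decomposition of [w] in the basis holds for each Taylor coefficient, hence for the
     functions, which are sums of their expansions on this ball. *)
  have e1 k : expands (fun x => \sum_i w x j i * L i k) (fun al => \sum_i cw (j, i) al * L i k) (r3 / 4).
    by apply: expands_sum => q; exact: (hcw (j, q)).
  have e2 := expands_sum (index_enum 'I_S) (E^~ i) e1.
  have e3 := expands_comb 1 e2 (hcw (j, i)).
  rewrite -[X in _ - X]mul1r; apply: (expands_zero e3) => [al|]; last exact: ltW.
  have := wL (j, al) => /rowP/(_ i); rewrite !mxE => <-; rewrite mul1r.
  apply/eqP; rewrite subr_eq0; apply/eqP; apply: eq_bigr => k _; congr (_ * _).
  by rewrite !mxE; apply: eq_bigr => q _; rewrite mxE.
- move=> j k x /rle[_ _ xr]; apply: le_trans (nr_sum _ _ _) _; apply: ler_sum => i _.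
  rewrite (nrM (w x j i)); apply: ler_pM; [exact: nr_ge0|exact: nr_ge0| |exact: nr_coord].
  by apply: wBj; lra.
- move=> j k; apply: (expands_le (rho := r3 / 4)); first by lra.
  by apply: expands_sum => q; exact: (hcw (j, q)).
- move=> i k; have := congr1 (fun X : 'M_S => X i k) EL; rewrite !mxE => <-.
  apply: eq_bigr => q _; congr (_ * _).
  by have := rE i => /rowP/(_ q); rewrite !mxE => ->; case: (tt i).
- move=> x k /rle[_ xr _].
  have -> : \sum_(j < M) rC (nu j) * x 0 j * (\sum_i w x j i * L i k) =
     \sum_i (\sum_(j < M) rC (nu j) * x 0 j * w x j i) * L i k.
    under eq_bigr => j _ do rewrite mulr_sumr.
    rewrite exchange_big; apply: eq_bigr => i _; rewrite mulr_suml.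
    by apply: eq_bigr => j _; rewrite mulrA.
  apply: big1 => i _; have -> : \sum_(j < M) rC (nu j) * x 0 j * w x j i = 0; last by rewrite mul0r.
  under eq_bigr => j _ do rewrite mxE mulrBr.
  rewrite sumrB; apply/eqP; rewrite subr_eq0; apply/eqP.
  have := hE i x; rewrite mxE => <-; last by lra.
  by apply: eq_bigr => j _; rewrite /euler ddZ mulrA.
Qed.
End NormalForm.

Section Slices.
Variable R : realType.
Local Notation C := (cplx R).
Variables M N S : nat.
Variable a : 'rV[C]_M -> 'M[C]_(M, N).
Variable h : 'I_N -> 'rV[C]_M -> C.
Variables (E : 'M[C]_(S, N)) (L : 'M[C]_(N, S)).
Variable At : 'I_M -> 'I_S -> 'rV[C]_M -> C.
Variable r : R.
Hypothesis EL : E *m L = 1%:M.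
Hypothesis dh : forall i x, nr x < r -> differentiable (h i) x.
Hypothesis aE : forall x j i, nr x < r -> dd (h i) x (evec R j) + \sum_k At j k x * E k i = a x j i.

Definition hrow x : 'rV[C]_N := \row_i h i x.
Definition horizontal_lift (p : 'rV[C]_(M + N)) (u : 'rV[C]_M) : 'rV[C]_(M + N) := row_mx u (u *m a (lsubmx p)).
Definition ycoord (p : 'rV[C]_(M + N)) : 'rV[C]_(M + S) :=
  row_mx (lsubmx p) ((rsubmx p - hrow (lsubmx p)) *m L).
(* The submanifolds z = h(x) + y E + zeta with [zeta *m L = 0] fill the space and the
   distribution is tangent to each of them; [ycoord] gives the coordinates (x, y) on them. *)
Definition slice (zeta : 'rV[C]_N) (X : 'rV[C]_(M + S)) : 'rV[C]_(M + N) :=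
  row_mx (lsubmx X) (hrow (lsubmx X) + rsubmx X *m E + zeta).

Lemma ycoord_slice zeta X : zeta *m L = 0 -> ycoord (slice zeta X) = X.
Proof.
have G (V : zmodType) (x y z : V) : x + y + z - x = y + z by rewrite -(addrA x) [x + _]addrC addrK.
move=> zL; rewrite /ycoord /slice row_mxKl row_mxKr G.
by rewrite mulmxDl zL addr0 -mulmxA EL mulmx1 hsubmxK.
Qed.

(** The part of z - h(x) not reached by [E]: it labels the slice through [p]. *)
Definition resid (p : 'rV[C]_(M + N)) : 'rV[C]_N :=
  rsubmx p - hrow (lsubmx p) - rsubmx (ycoord p) *m E.

Lemma resid_L p : resid p *m L = 0.
Proof. by rewrite /resid /ycoord row_mxKr [LHS]mulmxBl -[_ *m E *m L]mulmxA EL mulmx1 subrr. Qed.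

Lemma slice_ycoord p : slice (resid p) (ycoord p) = p.
Proof.
have G (V : zmodType) (x y z : V) : x + y + (z - x - y) = z by rewrite -[z - x - y]addrA -opprD [LHS]addrC subrK.
by rewrite /slice (row_mxKl (lsubmx p)) /resid G hsubmxK.
Qed.

Lemma lsubmxM m n (x : 'rV[C]_(m + n)) : lsubmx x = x *m col_mx 1%:M 0.
Proof. by rewrite -{2}(hsubmxK x) mul_row_col mulmx1 mulmx0 addr0. Qed.
Lemma rsubmxM m n (x : 'rV[C]_(m + n)) : rsubmx x = x *m col_mx 0 1%:M.
Proof. by rewrite -{2}(hsubmxK x) mul_row_col mulmx1 mulmx0 add0r. Qed.

Lemma diff_lsub m n (f : 'rV[C]_m -> C) (X : 'rV[C]_(m + n)) : differentiable f (lsubmx X) ->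
  differentiable (fun Y : 'rV[C]_(m + n) => f (lsubmx Y)) X /\
  forall v, dd (fun Y : 'rV[C]_(m + n) => f (lsubmx Y)) X v = dd f (lsubmx X) (lsubmx v).
Proof.
move=> df; have [h1 h2] := diff_affine (col_mx 1%:M 0 : 'M[C]_(m + n, m)) 0 X.
have eq1 : (fun Y : 'rV[C]_(m + n) => Y *m col_mx 1%:M 0 + 0) = fun Y => lsubmx Y.
  by rewrite funeqE => Y; rewrite addr0 -lsubmxM.
rewrite eq1 in h1 h2.
have [h3 h4] := diff_comp_dd h1 df; split; first exact: h3.
by move=> v; rewrite h4; congr dd; rewrite (lsubmxM v); apply: etrans (h2 v).
Qed.

Lemma diff_slice zeta X : nr X < r -> differentiable (slice zeta) X /\ forall w,
  'd (slice zeta) X w = row_mx (lsubmx w) (\row_i dd (h i) (lsubmx X) (lsubmx w) + rsubmx w *m E).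
Proof.
move=> Xr; have lr : nr (lsubmx X) < r by apply: le_lt_trans Xr; exact: nr_lsub.
have H i k : differentiable (fun Y => slice zeta Y i k) X /\ forall w, dd (fun Y => slice zeta Y i k) X w =
    (row_mx (lsubmx w) (\row_i dd (h i) (lsubmx X) (lsubmx w) + rsubmx w *m E) : 'rV[C]_(M + N)) i k.
  rewrite (ord1 i) -(splitK k); case: (fintype.split k) => [j|q] /=.
    rewrite (_ : (fun Y => _) = fun Y : 'rV[C]_(M + S) => Y 0 (lshift S j)); last first.
      by rewrite funeqE => Y; rewrite /slice row_mxEl mxE.
    have [h1 h2] := diff_coord X 0 (lshift S j); split; first exact: h1.
    by move=> w; rewrite h2 row_mxEl mxE.
  have eq1 : (fun Y => slice zeta Y 0 (rshift M q)) = fun Y : 'rV[C]_(M + S) => h q (lsubmx Y) + (Y *m (col_mx 0 1%:M *m E) + zeta) 0 q.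
    by rewrite funeqE => Y; rewrite /slice row_mxEr rsubmxM mulmxA !mxE addrA.
  have [h1 h2] := diff_lsub (dh q lr).
  have [h3 h4] := diff_affine (col_mx 0 1%:M *m E) zeta X.
  have [h5 h6] := diff_comp_dd h3 (diff_coord (X *m (col_mx 0 1%:M *m E) + zeta) 0 q).1.
  have [h7 h8] := diff_add h1 h5.
  rewrite eq1; split; first exact: h7.
  move=> w; rewrite h8 h2 h6 (diff_coord _ 0 q).2 row_mxEr mxE [X in _ = X + _]mxE; congr (_ + _).
  by rewrite (rsubmxM w) -mulmxA; exact: (congr1 (fun Z : 'rV[C]_N => Z 0 q) (h4 w)).
have [h1 h2] := diff_mx (fun i k => (H i k).1); split; first exact: h1.
by move=> w; apply/matrixP => i k; rewrite h2 (H i k).2.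
Qed.

(** By [aE] the slice map carries the frame vectors to horizontal vectors; derivatives along the
    distribution can therefore be computed on one slice. *)
Lemma dd_slice (P : 'rV[C]_(M + N) -> C) zeta X (u : 'I_M -> C) : nr X < r -> differentiable P (slice zeta X) ->
  differentiable (fun Y => P (slice zeta Y)) X /\
  dd (fun Y => P (slice zeta Y)) X (\sum_j u j *: frame At j X) = dd P (slice zeta X) (horizontal_lift (slice zeta X) (\row_j u j)).
Proof.
move=> Xr dP; have [h1 h2] := diff_slice zeta Xr.
have lr : nr (lsubmx X) < r by apply: le_lt_trans Xr; exact: nr_lsub.
have [h3 h4] := diff_comp_dd h1 dP; split; first exact: h3.
rewrite h4 h2; congr dd.
have wE : \sum_j u j *: frame At j X = row_mx (\row_j u j) (\row_k \sum_j u j * At j k (lsubmx X)).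
  apply/rowP => i; rewrite summxE -(splitK i); case: (fintype.split i) => [q|k] /=.
    rewrite row_mxEl mxE (bigD1 q) //= big1 ?addr0.
      rewrite !mxE summxE eqxx big1 ?addr0 ?mulr1 // => k _.
      by rewrite !mxE eq_lrshift mulr0.
    move=> j jq; rewrite !mxE summxE big1 ?addr0.
      by rewrite (inj_eq (@lshift_inj _ _)) eq_sym (negbTE jq) mulr0.
    by move=> k _; rewrite !mxE eq_lrshift mulr0.
  rewrite row_mxEr mxE; apply: eq_bigr => j _; rewrite !mxE summxE eq_rlshift add0r; congr (_ * _).
  rewrite (bigD1 k) //= !mxE eqxx mulr1 big1 ?addr0 // => l lk.
  by rewrite !mxE (inj_eq (@rshift_inj _ _)) eq_sym (negbTE lk) mulr0.
rewrite /horizontal_lift wE row_mxKl row_mxKr /slice row_mxKl; congr row_mx.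
apply/rowP => i; rewrite !mxE.
have du : dd (h i) (lsubmx X) (\row_j u j) = \sum_j u j * dd (h i) (lsubmx X) (evec R j).
  by rewrite [X in dd _ _ X]evec_decomp dd_sum; apply: eq_bigr => j _; rewrite ddZ mxE.
rewrite du.
under [X in _ + X]eq_bigr => k _ do rewrite mxE mulr_suml.
rewrite exchange_big -big_split; apply: eq_bigr => j _ /=.
rewrite mxE -(aE _ _ lr) mulrDr mulr_sumr; congr (_ + _).
by apply: eq_bigr => k _; rewrite mulrA.
Qed.

Lemma diff_ycoord p : nr p < r -> differentiable ycoord p.
Proof.
move=> pr; have lr : nr (lsubmx p) < r by apply: le_lt_trans pr; exact: nr_lsub.
apply: (diff_mx _).1 => i k; rewrite (ord1 i) -(splitK k); case: (fintype.split k) => [j|q] /=.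
  rewrite (_ : (fun Y => _) = fun Y : 'rV[C]_(M + N) => Y 0 (lshift N j)); last first.
    by rewrite funeqE => Y; rewrite /ycoord row_mxEl mxE.
  exact: (diff_coord p 0 (lshift N j)).1.
rewrite (_ : (fun Y => _) = fun Y : 'rV[C]_(M + N) => \sum_i (Y 0 (rshift M i) - h i (lsubmx Y)) * L i q); last first.
  rewrite funeqE => Y; rewrite /ycoord row_mxEr mxE; apply: eq_bigr => l _; rewrite !mxE //.
have dj l : differentiable (fun Y : 'rV[C]_(M + N) => (Y 0 (rshift M l) - h l (lsubmx Y)) * L l q) p.
  apply: (diff_mul _ (diff_const (L l q) p).1).1.
  exact: (diff_sub (diff_coord p 0 (rshift M l)).1 (diff_lsub (dh l lr)).1).1.
exact: (diff_big (index_enum 'I_N) dj).1.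
Qed.
End Slices.

(** * The vector field in the original coordinates *)

Section Final.
Variable R : realType.
Local Notation C := (cplx R).

Lemma diff_normal_coef M S (nu : nat -> R) (jdx : 'I_S -> 'I_M) gam bx j (X : 'rV[C]_(M + S)) :
  differentiable (normal_coef nu jdx gam bx j) X.
Proof.
have dl al : differentiable (fun Y : 'rV[C]_(M + S) => mon al (lsubmx Y)) X by exact: (diff_lsub (diff_mon al (lsubmx X))).1.
have d1 : differentiable (fun Y : 'rV[C]_(M + S) => rC (nu j) * Y 0 (lshift S j)) X.
  exact: (diff_scal _ (diff_coord X 0 _).1).1.
have d2 i : differentiable (fun Y : 'rV[C]_(M + S) => if jdx i == j then rC (nu i) * Y 0 (rshift M i) * mon (fun q => bx q - gam i q)%N (lsubmx Y) else 0) X.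
  case: eqP => _; last exact: (diff_const 0 X).1.
  exact: (diff_mul (diff_scal _ (diff_coord X 0 _).1).1 (dl _)).1.
have d3 := (diff_big (index_enum 'I_S) d2).1.
rewrite (_ : normal_coef _ _ _ _ _ = fun Y => mon bx (lsubmx Y) * (rC (nu j) * Y 0 (lshift S j)) + mon (@psie M S) Y *
   \sum_i (if jdx i == j then rC (nu i) * Y 0 (rshift M i) * mon (fun q => bx q - gam i q)%N (lsubmx Y) else 0)).
  exact: (diff_add (diff_mul (dl bx) d1).1 (diff_mul (diff_mon _ X) d3).1).1.
by rewrite funeqE => Y; rewrite /normal_coef big_mkcond.
Qed.

Lemma distributionE M N (omega : 'I_N -> form_coeffs R M) (p v : 'rV[C]_(M + N)) :
  distribution omega p v <-> v = horizontal_lift (fun x => \matrix_(j, i) omega i x j 0) p (lsubmx v).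
Proof.
have E i : (lsubmx v *m (\matrix_(j, i) omega i (lsubmx p) j 0)) 0 i = form_eval (omega i) (lsubmx p) (lsubmx v).
  by rewrite /form_eval !mxE; apply: eq_bigr => j _; rewrite !mxE.
split=> [h|->].
  by rewrite -[LHS]hsubmxK /horizontal_lift; congr row_mx; apply/rowP => i; rewrite E; exact: h.
by move=> i; rewrite /horizontal_lift row_mxKr row_mxKl; exact: E.
Qed.

Lemma dd_quot_eq0 M S (P Q : 'rV[C]_(M + S) -> C) x v : differentiable P x -> differentiable Q x -> Q x != 0 ->
  dd (fun y => P y / Q y) x v = 0 <-> wronskian P Q x v = 0.
Proof.
move=> dP dQ q0; rewrite (dd_quot dP dQ q0).2; split=> [/eqP|->]; last by rewrite mulr0.
by rewrite mulf_eq0 invr_eq0 expf_eq0 /= (negbTE q0) => /eqP.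
Qed.

Lemma wronskian_vanish M S (P Q : 'rV[C]_(M + S) -> C) x v : P x = 0 -> dd P x v = 0 -> wronskian P Q x v = 0.
Proof. by move=> P0 dP0; rewrite /wronskian P0 dP0 mulr0 mul0r subr0. Qed.

Lemma nr_shift_lt (V : normedModType C) (x y : V) (d : R) : nr (x - y) < d - nr y -> nr x < d.
Proof. by rewrite ltrBrDr; apply: le_lt_trans; rewrite -{1}(subrK y x); exact: nrD. Qed.

(** Makes the Wronskian along the field holomorphic; the radius is halved because [partial_diff]
    controls the partial derivatives on half the ball. *)
Lemma diff_dd_field n (P : 'rV[C]_n -> C) (Z : 'rV[C]_n -> 'rV[C]_n) (r B : R) : 0 < r ->
  (forall x, nr x < r -> differentiable P x) -> (forall x, nr x < r -> nr (P x) <= B) ->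
  (forall x, nr x < r -> differentiable Z x) ->
  forall x, nr x < r / 2 -> differentiable (fun y => dd P y (Z y)) x.
Proof.
move=> r0 dP PB dZ x xr.
rewrite (_ : (fun y => _) = fun y => \sum_j Z y 0 j * dd P y (evec R j)); last first.
  by rewrite funeqE => y; rewrite [X in dd _ _ X]evec_decomp dd_sum; apply: eq_bigr => j _; rewrite ddZ.
have nr_evec j : nr (evec R j : 'rV[C]_n) <= 1.
  by apply: nr_le_mx => // i0 i; rewrite !mxE; case: eqP => _; rewrite ?nr1 ?nr0.
have xr1 : nr x < r by lra.
have dj j : differentiable (fun y => Z y 0 j * dd P y (evec R j)) x.
  apply: (diff_mul (diff_comp_dd (dZ x xr1) (diff_coord (Z x) 0 j).1).1 _).1.
  exact: (partial_diff r0 (nr_evec j) dP PB xr).1.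
exact: (diff_big (index_enum 'I_n) dj).1.
Qed.

End Final.
Theorem corollary4 (R : realType) (M N : nat) (hM : (2 <= M)%N) (hN : (1 <= N)%N)
    (omega : 'I_N -> form_coeffs R M)
    (homega : forall i : 'I_N, holomorphic_germ (omega i)) :
  exists Z : 'rV[cplx R]_(M + N) -> 'rV[cplx R]_(M + N),
    [/\ holomorphic_germ Z,
        tangent_germ (distribution omega) Z &
        first_integrals_vector_field Z =
          first_integrals_distribution (distribution omega)].
Proof.
set C := cplx R.
pose a (x : 'rV[C]_M) : 'M[C]_(M, N) := \matrix_(j, i) omega i x j 0.
have ha : holomorphic_germ a.
  have : \forall x \near (0 : 'rV[C]_M), forall i : 'I_N, differentiable (omega i) x.
    exact: (@filter_forall _ _ (fun i x => differentiable (omega i) x) _ (nbhs_filter (0 : 'rV[C]_M)) homega).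
  move=> /nbhs_nrP[e e0 he]; apply: (ball_germ e0) => x xe; apply: (diff_mx _).1 => j i.
  rewrite (_ : (fun q => _) = fun q => omega i q j 0); last by rewrite funeqE => q; rewrite mxE.
  have di : differentiable (omega i) x by apply: he; rewrite subr0.
  exact: (diff_comp_dd di (diff_coord (omega i x) j 0).1).1.
have [nu [nu1 indep]] := independent_weights R.
have [h [S [jdx [gam [E [L [At [ca [r [BA [[r0 EL] [[h0 dh aE] [Atb Ate Atd rel]]]]]]]]]]]]] := normal_form ha nu1.
pose bx q := \max_(i < S) gam i q.
have gam_bx i j : (gam i j <= bx j)%N by exact: (leq_bigmax i).
pose Y := ycoord h L.
(* The coefficients depend on [p] only through [ycoord p], so by [ycoord_slice] the field restricts
   to [normal_field] on all slices at once. *)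
pose f (p : 'rV[C]_(M + N)) : 'rV[C]_M := \row_j normal_coef nu jdx gam bx j (Y p).
pose Z p := horizontal_lift a p (f p).
have lsubr n m (x : 'rV[C]_(n + m)) e : nr x < e -> nr (lsubmx x) < e by move=> xe; apply: le_lt_trans xe; exact: nr_lsub.
have [ra [Ba [ra0 _ da _]]] := germ_ball ha.
pose rz := Num.min r ra.
have dZ p : nr p < rz -> differentiable Z p.
  rewrite lt_min => /andP[pr pra].
  have dY : differentiable Y p by exact: (diff_ycoord L dh pr).
  have dfj j : differentiable (fun q => normal_coef nu jdx gam bx j (Y q)) p.
    exact: (diff_comp_dd dY (diff_normal_coef nu jdx gam bx j (Y p))).1.
  apply: (diff_mx _).1 => i k; rewrite (ord1 i) -(splitK k); case: (fintype.split k) => [j|q] /=.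
    rewrite (_ : (fun q => _) = fun q => normal_coef nu jdx gam bx j (Y q)) //.
    by rewrite funeqE => y; rewrite /Z /horizontal_lift row_mxEl mxE.
  rewrite (_ : (fun q => _) = fun y => \sum_j normal_coef nu jdx gam bx j (Y y) * a (lsubmx y) j q); last first.
    by rewrite funeqE => y; rewrite /Z /horizontal_lift row_mxEr mxE; apply: eq_bigr => j _; rewrite mxE.
  have daj j : differentiable (fun y => a y j q) (lsubmx p).
    exact: (diff_comp_dd (da _ (lsubr _ _ _ _ pra)) (diff_coord (a (lsubmx p)) j q).1).1.
  have dj j : differentiable (fun y => normal_coef nu jdx gam bx j (Y y) * a (lsubmx y) j q) p.
    exact: (diff_mul (dfj j) (diff_lsub (daj j)).1).1.
  exact: (diff_big (index_enum 'I_M) dj).1.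
have rz0 : 0 < rz by rewrite lt_min r0.
clearbody rz.
have tan p : distribution omega p (Z p) by apply/distributionE; rewrite /Z /horizontal_lift row_mxKl.
exists Z; split.
- exact: (ball_germ rz0 dZ).
- by apply/nbhs_nrP; exists 1.
apply/seteqP; split=> F; last first.
  move=> /nbhs_nrP[e e0 he]; apply/nbhs_nrP; exists e => // p pe q0.
  exact: (he p pe q0 (Z p) (tan p)).
move=> /nbhs_nrP[e e0 he].
case: F he => P Q hP hQ nQ /= he.
have [rP [BP [rP0 BP0 dP PB]]] := germ_ball hP.
have [rQ [BQ [rQ0 BQ0 dQ QB]]] := germ_ball hQ.
pose r1 := Num.min e (Num.min rz (Num.min rP rQ)).
have r10 : 0 < r1 by rewrite !lt_min e0 rz0 rP0.
have r1E (x : 'rV[C]_(M + N)) : nr x < r1 -> [/\ nr x < e, nr x < rz, nr x < rP & nr x < rQ].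
  by rewrite !lt_min => /and4P.
have dP1 x : nr x < r1 -> differentiable P x by case/r1E => _ _ /dP.
have dQ1 x : nr x < r1 -> differentiable Q x by case/r1E => _ _ _ /dQ.
have dZ1 x : nr x < r1 -> differentiable Z x by case/r1E => _ /dZ.
have PB1 x : nr x < r1 -> nr (P x) <= BP by case/r1E => _ _ /PB.
have QB1 x : nr x < r1 -> nr (Q x) <= BQ by case/r1E => _ _ _ /QB.
(* The hypothesis says that [Xi] vanishes off the zeros of [Q]; [zero_product] extends this to the
   whole ball, including the poles of P/Q. *)
pose Xi p := wronskian P Q p (Z p).
have r20 : 0 < r1 / 2 by rewrite divr_gt0.
have hXi : holomorphic_germ Xi.
  apply: (ball_germ r20) => x xr; have xr1 : nr x < r1 by lra.
  have d1 := (diff_mul (dQ1 x xr1) (diff_dd_field r10 dP1 PB1 dZ1 xr)).1.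
  have d2 := (diff_mul (dP1 x xr1) (diff_dd_field r10 dQ1 QB1 dZ1 xr)).1.
  exact: (diff_sub d1 d2).1.
have [rX [BX [rX0 BX0 dX XB]]] := germ_ball hXi.
pose r4 := Num.min r1 rX.
have r40 : 0 < r4 by rewrite lt_min r10.
have r4E (x : 'rV[C]_(M + N)) : nr x < r4 -> nr x < r1 /\ nr x < rX by rewrite lt_min => /andP.
have [pn pnr Qpn] : exists2 p, nr p < r4 & Q p != 0.
  apply: contrapT => nex; have := nQ; apply; apply/nbhs_nrP; exists r4 => // q; rewrite subr0 => qr.
  by apply/eqP; apply: contrapT => /negP h1; apply: nex; exists q.
have Xi0 p : nr p < r4 -> Xi p = 0.
  apply: (@zero_product R _ Xi Q r4 BX _ _ _ _ pn pnr Qpn).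
  - by move=> x /r4E[_ /dX].
  - by move=> x /r4E[_ /XB].
  - by move=> x /r4E[/dQ1].
  move=> x /r4E[xr _]; have [q0|q0] := eqVneq (Q x) 0; first by rewrite q0 mulr0.
  have xe : nr (x - 0) < e by rewrite subr0; case/r1E: xr.
  by have := (dd_quot_eq0 (Z x) (dP1 x xr) (dQ1 x xr) q0).1 (he x xe q0) => E0; rewrite /Xi E0 mul0r.
have n00 n : nr (0 : 'rV[C]_n) = 0 by rewrite nr0.
have l0 n m : lsubmx (0 : 'rV[C]_(n + m)) = 0 by apply/rowP => i; rewrite !mxE.
have h00 : hrow h 0 = 0 by apply/rowP => i; rewrite !mxE h0.
have Y0 : Y 0 = 0 by rewrite /Y /ycoord l0 h00 subr0 -[rsubmx 0]/(rsubmx _) rsubmxM mul0mx mul0mx row_mx0.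
pose Ps := slice h E.
have Ps0 : Ps 0 0 = 0 by rewrite /Ps /slice l0 h00 rsubmxM !mul0mx !addr0 row_mx0.
have Y_r : nr (0 : 'rV[C]_(M + N)) < r by rewrite n00.
have Ps_r : nr (0 : 'rV[C]_(M + S)) < r by rewrite n00.
have r48 : 0 < r4 / 8 by rewrite divr_gt0.
have r44 : r4 / 8 + r4 / 8 = r4 / 4 by field.
have r4lt : r4 / 8 + r4 / 4 < r4 by lra.
(* One radius [rr] must serve every slice near 0. The slice through [p] is the central one
   translated by zeta; the central one stays within r4/8 and zeta is at most r4/8 + r4/8, so their
   sum stays in the ball of radius r4. *)
have [d1 d10 hd1] := diff_cont (diff_slice E dh 0 Ps_r).1 r48.
pose rr := Num.min r d1.
have rr0 : 0 < rr by rewrite lt_min r0.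
have rr2 : 0 < rr / 2 by rewrite divr_gt0.
have [d2 d20 hd2] := diff_cont (diff_ycoord L dh Y_r) rr2.
have PsB X : nr X < rr -> nr (Ps 0 X) <= r4 / 8.
  by rewrite lt_min => /andP[_ /hd1]; rewrite add0r -/Ps Ps0 subr0.
have YB p : nr p < d2 -> nr (Y p) < rr.
  by move=> /hd2; rewrite add0r -/Y Y0 subr0 => /le_lt_trans; apply; rewrite gtr_pMr // invf_lt1 // ltr1n.
pose e3 := Num.min d2 (r4 / 8).
have e30 : 0 < e3 by rewrite lt_min d20.
apply/nbhs_nrP; exists e3 => // p; rewrite subr0 lt_min => /andP[/YB Yp p8] q0 v /distributionE vE.
pose zeta := resid h E L p.
have zL : zeta *m L = 0 by exact: resid_L.
have pE : Ps zeta (Y p) = p by exact: slice_ycoord.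
have PsE z0 X : Ps z0 X = Ps 0 X + row_mx 0 z0.
  by rewrite /Ps /slice add_row_mx addr0 addr0.
have zB : nr (row_mx 0 zeta : 'rV[C]_(M + N)) <= r4 / 4.
  have -> : row_mx 0 zeta = p - Ps 0 (Y p) by rewrite -{1}pE PsE addrC addKr.
  rewrite -r44; apply: le_trans (nrB _ _) _; apply: lerD; [exact: ltW|exact: PsB].
have PsR X : nr X < rr -> nr (Ps zeta X) < r4.
  move=> Xr; rewrite PsE; apply: le_lt_trans (nrD _ _) _.
  by apply: le_lt_trans (lerD (PsB X Xr) zB) _.
have rE (X : 'rV[C]_(M + S)) : nr X < rr -> nr X < r by rewrite lt_min => /andP[].
have rE' (X : 'rV[C]_M) : nr X < rr -> nr X < r by rewrite lt_min => /andP[].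
have p4 : nr p < r1 by have := PsR _ Yp; rewrite pE => /r4E[].
apply/(dd_quot_eq0 v (dP1 p p4) (dQ1 p p4) q0).
pose P' X := P (Ps zeta X); pose Q' X := Q (Ps zeta X).
have sl (G : 'rV[C]_(M + N) -> C) X (u : 'I_M -> C) : (forall x, nr x < r1 -> differentiable G x) -> nr X < rr ->
   differentiable (fun W => G (Ps zeta W)) X /\
   dd (fun W => G (Ps zeta W)) X (\sum_j u j *: frame At j X) = dd G (Ps zeta X) (horizontal_lift a (Ps zeta X) (\row_j u j)).
  by move=> dG Xr; apply: (dd_slice dh aE u (rE X Xr)); apply: dG; have /r4E[] := PsR X Xr.
(* The constant [c] belongs to the slice through [p]. This is enough, as the distribution at [p] is
   tangent to that slice. *)
have [c hc] : exists c, forall X, nr X < rr -> P' X = c * Q' X.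
  apply: (main_prop indep gam_bx rr0 (fun j k x xr => Atb j k x (rE' x xr)) _ Atd (fun x k xr => rel x k (rE' x xr)) (B := BP + BQ)).
  - move=> j k; apply: (expands_le _ (Ate j k)).
    by apply: ler_wpM2r; [rewrite invr_ge0|rewrite ge_min lexx].
  - by move=> X Xr; exact: (sl P X (fun=> 0) dP1 Xr).1.
  - by move=> X Xr; exact: (sl Q X (fun=> 0) dQ1 Xr).1.
  - by move=> X /PsR/r4E[/PB1 h1 _]; apply: le_trans h1 _; rewrite lerDl.
  - by move=> X /PsR/r4E[/QB1 h1 _]; apply: le_trans h1 _; rewrite lerDr.
  - move=> X Xr; rewrite /wronskian /normal_field.
    have [_ ->] := sl P X (fun j => normal_coef nu jdx gam bx j X) dP1 Xr.
    have [_ ->] := sl Q X (fun j => normal_coef nu jdx gam bx j X) dQ1 Xr.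
    have := Xi0 _ (PsR X Xr); rewrite /Xi /wronskian /Z /f.
    by rewrite [Y _](ycoord_slice h EL X zL).
  - by exists (Y p) => //; rewrite /Q' pE.
rewrite vE -/a -pE.
have lv : lsubmx v = \row_j lsubmx v 0 j by apply/rowP => i; rewrite !mxE.
rewrite lv.
have [dP' eP] := sl P (Y p) (fun j => lsubmx v 0 j) dP1 Yp.
have [dQ' eQ] := sl Q (Y p) (fun j => lsubmx v 0 j) dQ1 Yp.
rewrite /wronskian -eP -eQ -/(wronskian P' Q' (Y p) _) -(wronskian_comb c _ dP' dQ').
(* On a whole neighbourhood in the slice P' - c Q' is 0, so its derivative vanishes in every
   direction, not just along the field. *)
have z0 : dd (fun y => P' y - c * Q' y) (Y p) (\sum_j lsubmx v 0 j *: frame At j (Y p)) = 0.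
  have ee : 0 < rr - nr (Y p) by rewrite subr_gt0.
  apply: (dd_near0 _ ee) => q /nr_shift_lt qr; last by rewrite hc // subrr.
  exact: (diff_sub (sl P q (fun=> 0) dP1 qr).1 (diff_scal c (sl Q q (fun=> 0) dQ1 qr).1).1).1.
have z1 : P' (Y p) - c * Q' (Y p) = 0 by rewrite hc // subrr.
exact: (wronskian_vanish _ z1 z0).
Qed.
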